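(* Fix $p\in[1,2]$. For all $n,d,\Delta\in\mathbb{N}$ and any $\varepsilon>0$ there is a (one-pass) turnstile streaming algorithm using $O(1/\varepsilon)\cdot\mathrm{polylog}(n,d,\Delta)$ bits of space which, given two multisets $A,B\subset[\Delta]^d$ of size $n$, outputs $\hat\eta\in\mathbb{R}$ satisfying \[\mathsf{EMD}_{\ell_p}(A,B)\le\hat\eta\le\tilde O(\log n)\cdot\mathsf{EMD}_{\ell_p}(A,B)+\varepsilon d\Delta n\] with high probability.
   Context: $[\Delta]=\{1,\dots,\Delta\}$. For multisets $A,B$ of equal size $n$, $\mathsf{EMD}_{\ell_p}(A,B)=\min_{M}\sum_{(a,b)\in M}\|a-b\|_p$ over perfect matchings $M\subset A\times B$. In the turnstile geometric streaming model the algorithm receives an arbitrarily ordered sequence of insertions and deletions of points of $[\Delta]^d$, each specifying whether it applies to $A$ or $B$; $A,B$ are the resulting multisets at the end of the stream. Space is measured in the random-oracle model (random bits are free; space is the number of bits stored between updates). $\tilde O(\log n)$ denotes a quantity at most $\log n\cdot\mathrm{poly}(\log\log n)$ up to absolute constants, independent of $d,\Delta$. *)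

(* Defs.v *)
From HB Require Import structures.
From mathcomp Require Import all_boot all_order all_algebra all_fingroup.
From mathcomp Require Import reals exp.

Set Implicit Arguments.
Unset Strict Implicit.
Unset Printing Implicit Defensive.

Import Order.TTheory GRing.Theory Num.Theory.
Local Open Scope ring_scope.

(* The grid {1, ..., Delta}^d: the i-th coordinate of x is (x i).+1. *)
Definition point (d Delta : nat) := {ffun 'I_d -> 'I_Delta}.

Definition coord (R : realType) (d Delta : nat) (x : point d Delta) (i : 'I_d)
  : R := ((x i).+1)%:R.

Definition lp_dist (R : realType) (p : R) (d Delta : nat)
  (x y : point d Delta) : R :=
  (\sum_(i < d) `|coord R x i - coord R y i| `^ p) `^ p^-1.

(* A multiset of size n is represented by an arbitrary listing of its elements
   with repetitions, and a perfect matching by a permutation s that matches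
   the i-th element of A with the (s i)-th element of B. *)
Definition matching_cost (R : realType) (p : R) (n d Delta : nat)
  (A B : n.-tuple (point d Delta)) (s : 'S_n) : R :=
  \sum_(i < n) lp_dist p (tnth A i) (tnth B (s i)).

Definition EMD (R : realType) (p : R) (n d Delta : nat)
  (A B : n.-tuple (point d Delta)) : R :=
  \big[Num.min/matching_cost p A B 1%g]_(s : 'S_n) matching_cost p A B s.

(* The value depends only on the multisets, not on the listings. *)
Lemma EMD_perm (R : realType) (p : R) (n d Delta : nat)
  (A A' B B' : n.-tuple (point d Delta)) :
  perm_eq A A' -> perm_eq B B' -> EMD p A B = EMD p A' B'.
Proof.
have le_EMD (X Y : n.-tuple (point d Delta)) (s : 'S_n) :
    EMD p X Y <= matching_cost p X Y s by exact: bigmin_le_cond.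
have EMD_ge (X X' Y Y' : n.-tuple (point d Delta)) :
    perm_eq X X' -> perm_eq Y Y' -> EMD p X Y <= EMD p X' Y'.
  move=> pX; rewrite perm_sym => pY.
  have [s Es] := tuple_permP pX; have [t Et] := tuple_permP pY.
  have EX i : tnth X i = tnth X' (s i).
    by rewrite (_ : X = [tuple tnth X' (s j) | j < n]) ?tnth_mktuple //;
      apply: val_inj.
  have EY i : tnth Y' i = tnth Y (t i).
    by rewrite (_ : Y' = [tuple tnth Y (t j) | j < n]) ?tnth_mktuple //;
      apply: val_inj.
  have key u : EMD p X Y <= matching_cost p X' Y' u.
    apply: le_trans (le_EMD X Y (s * u * t)%g) _.
    rewrite /matching_cost [leRHS](reindex_inj (@perm_inj _ s)) /=.
    by apply: ler_sum => i _; rewrite EX EY !permM.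
  by apply: le_bigmin.
move=> pA pB; have pA' : perm_eq A' A by rewrite perm_sym.
have pB' : perm_eq B' B by rewrite perm_sym.
have le1 := EMD_ge _ _ _ _ pA pB; have le2 := EMD_ge _ _ _ _ pA' pB'.
by apply: (@le_anti _ R); apply/andP; split; [exact: le1|exact: le2].
Qed.

Record update (d Delta : nat) := Update {
  upd_insert : bool;  (* true: insertion, false: deletion *)
  upd_toA : bool;     (* true: applies to A, false: applies to B *)
  upd_point : point d Delta
}.

(* Net multiplicity of x in A (toA = true) or B (toA = false) after the stream;
   it is an integer, since deletions may precede the matching insertions. *)
Definition net_count (d Delta : nat) (st : seq (update d Delta)) (toA : bool)
  (x : point d Delta) : int :=
  \sum_(u <- st | (upd_toA u == toA) && (upd_point u == x))
    (if upd_insert u then 1 else -1).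

Definition stream_result (n d Delta : nat) (st : seq (update d Delta))
  (A B : n.-tuple (point d Delta)) : Prop :=
  forall x, net_count st true x = (count_mem x A)%:Z /\
            net_count st false x = (count_mem x B)%:Z.

(* A one-pass streaming algorithm in the random-oracle model.  The oracle is a
   uniform string of alg_rand bits; its length is unrestricted and uncharged,
   and it can be read in full at initialisation, at each update and at the end.
   Only the alg_space bits of state persist between updates. *)
Record algorithm (R : realType) (d Delta : nat) := Algorithm {
  alg_space : nat;
  alg_rand : nat;
  alg_init : alg_rand.-tuple bool -> alg_space.-tuple bool;
  alg_step : alg_rand.-tuple bool -> alg_space.-tuple bool ->
             update d Delta -> alg_space.-tuple bool;
  alg_out : alg_rand.-tuple bool -> alg_space.-tuple bool -> R
}.

Definition alg_run (R : realType) (d Delta : nat) (alg : algorithm R d Delta)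
  (st : seq (update d Delta)) (w : (alg_rand alg).-tuple bool) : R :=
  alg_out w (foldl (alg_step w) (alg_init w) st).

Definition prob_bits (R : realType) (r : nat) (E : pred (r.-tuple bool)) : R :=
  #|[set w | E w]|%:R / (2 ^ r)%:R.

(* Logarithm regularised so that it is at least 1 on nonnegative reals; with
   ln itself, O(log n) would be 0 at n = 1 and log log n undefined there. *)
Definition rlog (R : realType) (x : R) : R := 1 + ln (1 + x).

Definition tilde_log (R : realType) (C : R) (k n : nat) : R :=
  C * rlog n%:R * rlog (rlog (n%:R : R)) ^+ k.

Definition polylog3 (R : realType) (C : R) (k n d Delta : nat) : R :=
  C * (rlog n%:R + rlog d%:R + rlog Delta%:R) ^+ k.

(* Main.v *)
(* A distribution on two-valued functions of the points ("cuts") gives the metric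
   D(x, y) = M Pr[the cut separates x and y], and l_p is equivalent to such a
   metric: threshold an integer combination of the coordinates whose coefficients
   imitate independent p-stable variables.

   Independent cuts generate nested partitions, the one of level i + 1 using a
   number of cuts that is uniform in [2^i, 2^(i+1)). Let mu(u) be the number of
   points of A minus the number of points of B in the cell u. A greedy matching
   along the partitions costs at most the sum over all cells of |mu(u)| times the
   average distance between u and its parent. Conversely this sum is O(log n) EMD
   in expectation: an optimal pair x, y contributes to |mu| only where it is
   separated, and the average distances from x to its cells are controlled by the
   logarithm of the size of the cell of x, because the next cut is expected to
   remove a fraction of that cell equal to the average distance.

   The average distance between u and its parent is read off the parity of a
   suitable number of fresh cuts, as the probability that random points of the two
   cells get different parities. The sum over the cells is estimated by one trial
   using eight counters: parents and cells are sampled at random rates 2^-a and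
   2^-b, and if the sizes observed in the sample are those expected of a single
   cell, then the sample is essentially a single cell. A trial is nonnegative and
   at most polylog d Delta n, so that the average of polylog / eps independent
   trials is correct up to a constant factor and an error eps d Delta n, which is
   compensated by adding it to the output. *)

(* The logarithm has to be paid once for the whole tree and not once per level. What achieves this
   is a cancellation: the factor 2^i in the probability that scale i separates a pair meets the
   density 2^-i of the random number of cuts, so the main term loses nothing in the number B of
   levels. The sampling errors are instead proportional to the weighted total imbalance, for which
   only the naive bound O(B^2) EMD is used; the accuracies [eta] and 1/[G] are inverse powers of B
   that absorb this loss, and powers of B only enter the space. The range of a trial matters as much
   as its mean: with values in [0, z] and additive slack s about z/s trials suffice, whence 1/eps
   and not its square. Truncating distances by parities keeps z proportional to d Delta n although
   the scale M of the cut metric may be far larger. Cuts and sampling tables are fully independent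
   and exponentially large, which the random oracle permits. Since p >= 1, EMD on the grid is 0 or
   at least 1, and this absorbs the exponentially small contribution of bad partitions. *)
Require Import Defs.
From HB Require Import structures.
From mathcomp Require Import all_boot all_order all_algebra all_fingroup.
From mathcomp Require Import reals sequences exp.
From mathcomp Require boolp.
From mathcomp Require Import zify ring lra.

Set Implicit Arguments.
Unset Strict Implicit.
Unset Printing Implicit Defensive.

Import Order.TTheory GRing.Theory Num.Theory.
Local Open Scope ring_scope.

(** * Expectations over finite types *)

Definition Ex (R : realType) (T : finType) (f : T -> R) : R :=
  (\sum_t f t) / #|T|%:R.

Definition Pr (R : realType) (T : finType) (E : T -> bool) : R :=
  Ex (fun t => (E t)%:R).

Section Expectation.
Variable R : realType.
Implicit Types T : finType.

Lemma eq_Ex T (f g : T -> R) : f =1 g -> Ex f = Ex g.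
Proof. by move=> fg; rewrite /Ex (eq_bigr _ (fun t _ => fg t)). Qed.

Lemma ExD T (f g : T -> R) : Ex (fun t => f t + g t) = Ex f + Ex g.
Proof. by rewrite /Ex big_split /= mulrDl. Qed.

Lemma ExZ T c (f : T -> R) : Ex (fun t => c * f t) = c * Ex f.
Proof. by rewrite /Ex -mulr_sumr mulrA. Qed.

Lemma ExB T (f g : T -> R) : Ex (fun t => f t - g t) = Ex f - Ex g.
Proof. by rewrite /Ex sumrB mulrBl. Qed.

Lemma Ex_sum T (I : finType) (P : pred I) (F : I -> T -> R) :
  Ex (fun t => \sum_(i | P i) F i t) = \sum_(i | P i) Ex (F i).
Proof. by rewrite /Ex exchange_big /= mulr_suml. Qed.

Lemma Ex_sum_nat T m n (F : nat -> T -> R) :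
  Ex (fun t => \sum_(m <= i < n) F i t) = \sum_(m <= i < n) Ex (F i).
Proof. by rewrite /Ex exchange_big /= mulr_suml. Qed.

Lemma Ex_const T (c : R) : (0 < #|T|)%N -> Ex (fun _ : T => c) = c.
Proof.
move=> T0; rewrite /Ex sumr_const -[c *+ _]mulr_natr mulfK // pnatr_eq0 -lt0n.
by [].
Qed.

Lemma ler_Ex T (f g : T -> R) : (forall t, f t <= g t) -> Ex f <= Ex g.
Proof.
by move=> fg; rewrite ler_wpM2r ?invr_ge0 ?ler0n // ler_sum.
Qed.

Lemma Ex_ge0 T (f : T -> R) : (forall t, 0 <= f t) -> 0 <= Ex f.
Proof. by move=> f0; rewrite divr_ge0 ?ler0n ?sumr_ge0. Qed.

Lemma Ex_ord_scale B (F : nat -> R) : (0 < B)%N ->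
  Ex (fun i : 'I_B => B%:R * F i) = \sum_(0 <= i < B) F i.
Proof.
move=> B0; rewrite ExZ /Ex card_ord big_mkord mulrCA mulfV ?mulr1 //.
by rewrite pnatr_eq0 -lt0n.
Qed.

Lemma Ex_pair T1 T2 (f : T1 * T2 -> R) :
  Ex f = Ex (fun x => Ex (fun y => f (x, y))).
Proof.
rewrite /Ex -mulr_suml pair_bigA card_prod natrM invfM [_^-1 * _]mulrC mulrA.
by congr (_ / _ / _); apply: eq_bigr => -[].
Qed.

Lemma Ex_swap T1 T2 (f : T1 -> T2 -> R) :
  Ex (fun x => Ex (fun y => f x y)) = Ex (fun y => Ex (fun x => f x y)).
Proof.
rewrite /Ex -!mulr_suml exchange_big /= -!mulrA; congr (_ * _).
by rewrite mulrC.
Qed.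

Lemma Ex_bij T1 T2 (h : T1 -> T2) (f : T2 -> R) :
  bijective h -> Ex (fun x => f (h x)) = Ex f.
Proof.
move=> bh; rewrite /Ex (bij_eq_card bh); congr (_ / _).
by rewrite [RHS](reindex h) //; apply: onW_bij.
Qed.

Lemma Ex_ffun_prod (I : finType) T (F : I -> T -> R) :
  Ex (fun f : {ffun I -> T} => \prod_i F i (f i)) = \prod_i Ex (F i).
Proof.
rewrite /Ex -(bigA_distr_bigA F) card_ffun big_split /= prodr_const.
by rewrite natrX exprVn.
Qed.

Lemma Ex_ffun1 (I : finType) T (i : I) (F : T -> R) : (0 < #|T|)%N ->
  Ex (fun f : {ffun I -> T} => F (f i)) = Ex F.
Proof.
move=> T0; pose G k := if k == i then F else fun=> 1.
rewrite (eq_Ex (g := fun f : {ffun I -> T} => \prod_k G k (f k))).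
  rewrite Ex_ffun_prod (bigD1 i) //= /G eqxx big1 ?mulr1 // => k /negPf ->.
  by rewrite Ex_const.
move=> f; rewrite (bigD1 i) //= /G eqxx big1 ?mulr1 //.
by move=> k /negPf ->.
Qed.

Lemma Ex_ffun2 (I : finType) T (i j : I) (F G : T -> R) :
  (0 < #|T|)%N -> i != j ->
  Ex (fun f : {ffun I -> T} => F (f i) * G (f j)) = Ex F * Ex G.
Proof.
move=> T0 ij; have ji : j != i by rewrite eq_sym.
pose H k := if k == i then F else if k == j then G else fun=> 1.
rewrite (eq_Ex (g := fun f : {ffun I -> T} => \prod_k H k (f k))).
  rewrite Ex_ffun_prod (bigD1 i) //= (bigD1 j) //= /H eqxx (negPf ji) eqxx.
  rewrite big1 ?mulr1 // => k /andP[/negPf -> /negPf ->].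
  by rewrite Ex_const.
move=> f; rewrite (bigD1 i) //= (bigD1 j) //= /H eqxx (negPf ji) eqxx.
by rewrite big1 ?mulr1 // => k /andP[/negPf -> /negPf ->].
Qed.

(** Iterated expectations on plain sequences let inductions peel off the first draw without lengths
    in the types; [Ex_tuple] connects them to uniform tuples. *)
Fixpoint Eseq T (k : nat) (f : seq T -> R) : R :=
  if k is k'.+1 then Ex (fun c => Eseq k' (fun s => f (c :: s))) else f [::].

Lemma eq_Eseq T k (f g : seq T -> R) :
  (forall s, size s = k -> f s = g s) -> Eseq k f = Eseq k g.
Proof.
elim: k f g => [|k IH] f g fg /=; first exact: fg.
by apply: eq_Ex => c; apply: IH => s sk; rewrite fg //= sk.
Qed.

Lemma ler_Eseq T k (f g : seq T -> R) :
  (forall s, size s = k -> f s <= g s) -> Eseq k f <= Eseq k g.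
Proof.
elim: k f g => [|k IH] f g fg /=; first exact: fg.
by apply: ler_Ex => c; apply: IH => s sk; rewrite fg //= sk.
Qed.

Lemma EseqD T k (f g : seq T -> R) :
  Eseq k (fun s => f s + g s) = Eseq k f + Eseq k g.
Proof.
elim: k f g => [|k IH] f g //=; rewrite -ExD.
by apply: eq_Ex => c; rewrite IH.
Qed.

Lemma EseqZ T k a (f : seq T -> R) : Eseq k (fun s => a * f s) = a * Eseq k f.
Proof.
elim: k f => [|k IH] f //=; rewrite -ExZ.
by apply: eq_Ex => c; rewrite IH.
Qed.

Lemma Eseq_sum_nat T k m n (F : nat -> seq T -> R) :
  Eseq k (fun s => \sum_(m <= i < n) F i s) = \sum_(m <= i < n) Eseq k (F i).
Proof.
elim: k F => [|k IH] F //=; rewrite -Ex_sum_nat.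
by apply: eq_Ex => c; rewrite IH.
Qed.

Lemma Eseq_const T k (a : R) : (0 < #|T|)%N -> Eseq k (fun _ : seq T => a) = a.
Proof. by move=> T0; elim: k => //= k ->; rewrite Ex_const. Qed.

Lemma Eseq_ge0 T k (f : seq T -> R) : (forall s, 0 <= f s) -> 0 <= Eseq k f.
Proof.
elim: k f => [|k IH] f f0 //=; apply: Ex_ge0 => c; exact: IH.
Qed.

Lemma Ex_Eseq T T' k (f : T' -> seq T -> R) :
  Ex (fun c => Eseq k (f c)) = Eseq k (fun s => Ex (fun c => f c s)).
Proof.
elim: k f => [|k IH] f //=; rewrite Ex_swap.
by apply: eq_Ex => c; rewrite IH.
Qed.

Lemma Eseq_take T k n (f : seq T -> R) : (0 < #|T|)%N -> (k <= n)%N ->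
  Eseq n (fun s => f (take k s)) = Eseq k f.
Proof.
move=> T0; elim: k n f => [|k IH] [|n] f //= kn.
  rewrite (eq_Ex (g := fun=> f [::])) ?Ex_const // => c.
  by rewrite Eseq_const.
by apply: eq_Ex => c; rewrite (IH n (fun s => f (c :: s))).
Qed.

Lemma Ex_tuple T n (f : seq T -> R) :
  Ex (fun t : n.-tuple T => f t) = Eseq n f.
Proof.
elim: n f => [|n IH] f /=.
  by rewrite /Ex (big_pred1 [tuple]) ?card_tuple ?expn0 ?divr1 // => t; apply/esym/eqP; apply: tuple0.
rewrite -(eq_Ex (fun c => IH (fun s => f (c :: s)))).
rewrite -(Ex_pair (fun p : T * n.-tuple T => f (p.1 :: p.2))).
rewrite -(Ex_bij (h := fun p : T * n.-tuple T => cons_tuple p.1 p.2)) //.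
exists (fun t : n.+1.-tuple T => (thead t, behead_tuple t)).
  by case=> c t; congr (_, _); apply: val_inj.
by move=> t; rewrite [RHS]tuple_eta; apply: val_inj.
Qed.

Lemma Ex_tuple_take T k n (f : seq T -> R) : (0 < #|T|)%N -> (k <= n)%N ->
  Ex (fun t : n.-tuple T => f (take k t)) = Eseq k f.
Proof. by move=> T0 kn; rewrite (Ex_tuple n (fun s => f (take k s))) Eseq_take. Qed.

End Expectation.

(** Every random object must be an exact image of a uniform bit string of the oracle, which asks for
    a sample space whose size is a power of two. *)
Definition dyadic (T : finType) := exists r, #|T| = (2 ^ r)%N.

Lemma dyadic_gt0 T : dyadic T -> (0 < #|T|)%N.
Proof. by case=> r ->; rewrite expn_gt0. Qed.

Lemma dyadic_prod T1 T2 : dyadic T1 -> dyadic T2 -> dyadic (T1 * T2)%type.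
Proof. by case=> r1 e1 [r2 e2]; exists (r1 + r2)%N; rewrite card_prod e1 e2 expnD. Qed.

Lemma dyadic_ffun (I T : finType) : dyadic T -> dyadic {ffun I -> T}.
Proof. by case=> r e; exists (r * #|I|)%N; rewrite card_ffun e expnM. Qed.

Lemma dyadic_tuple n T : dyadic T -> dyadic (n.-tuple T).
Proof. by case=> r e; exists (r * n)%N; rewrite card_tuple e expnM. Qed.

Lemma dyadic_ord k : dyadic 'I_(2 ^ k).
Proof. by exists k; rewrite card_ord. Qed.

Lemma dyadic_bool : dyadic bool.
Proof. by exists 1%N; rewrite card_bool. Qed.

Lemma dyadic_bij (T : finType) r : #|T| = (2 ^ r)%N ->
  exists h : r.-tuple bool -> T, bijective h.
Proof.
move=> Tr; have e : #|{: r.-tuple bool}| = #|T|.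
  by rewrite card_tuple card_bool Tr.
exists (fun w => enum_val (cast_ord e (enum_rank w))).
exists (fun x => enum_val (cast_ord (esym e) (enum_rank x))) => x.
  by rewrite enum_valK cast_ordK enum_rankK.
by rewrite enum_valK cast_ordKV enum_rankK.
Qed.

(** * Concentration of averages *)

Section Chernoff.
Variable R : realType.

Lemma expRN_le (y : R) : 0 <= y <= 1 -> expR (- y) <= 1 - y / 2.
Proof.
move=> /andP[y0 y1]; rewrite expRN -[leRHS]invrK lef_pV2 ?posrE ?expR_gt0 //.
  2: by rewrite invr_gt0; lra.
apply: le_trans (expR_ge1Dx y).
rewrite -div1r ler_pdivrMr; last lra.
by have : 0 <= y * (1 - y) by [rewrite mulr_ge0 // subr_ge0]; nra.
Qed.

Lemma expR_le (y : R) : 0 <= y <= 2^-1 -> expR y <= 1 + 2 * y.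
Proof.
move=> /andP[y0 y1]; have y1' : 0 < 1 - y by lra.
have h : 1 - y <= expR (- y) by rewrite expR_ge1Dx.
rewrite -[y in expR y]opprK expRN.
apply: (@le_trans _ _ (1 - y)^-1).
  by rewrite lef_pV2 ?posrE ?expR_gt0.
rewrite -div1r ler_pdivrMr //.
by have : 0 <= y * (2^-1 - y) by [rewrite mulr_ge0 // subr_ge0]; nra.
Qed.

(** Nonnegativity of [Z] permits a constant factor on the mean next to the additive slack [s]; the
    exponent is then linear in [s / zm], so the number of trials grows like [zm / s] and not like
    its square. *)
Lemma chernoff (Om : finType) (T : nat) (Z : Om -> R) (zm s : R) :
  (0 < #|Om|)%N -> (0 < T)%N -> 0 < zm -> (forall w, 0 <= Z w <= zm) ->
  1 - 2 * expR (- (T%:R * s / (2 * zm))) <=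
  Pr R (fun f : {ffun 'I_T -> Om} =>
    Ex Z / 4 - s <= (\sum_t Z (f t)) / T%:R <= 2 * Ex Z + s).
Proof.
move=> Om0 T0 zm0 Zb; set m := Ex Z; pose l := (2 * zm)^-1.
have l0 : 0 < l by rewrite invr_gt0 mulr_gt0.
have m0 : 0 <= m by apply: Ex_ge0 => w; case/andP: (Zb w).
have T0r : 0 < T%:R :> R by rewrite ltr0n.
(* The choice of [l] puts [l * Z] where both exponentials lie below a line; taking expectations of
   the line leaves only the mean. *)
have lZ w : 0 <= l * Z w <= 2^-1.
  have /andP[z0 z1] := Zb w; rewrite mulr_ge0 ?(ltW l0) //=.
  rewrite /l mulrC ler_pdivrMr ?mulr_gt0 //; lra.
have E1 : Ex (fun w => expR (- (l * Z w))) <= expR (- (l * m / 2)).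
  apply: le_trans (expR_ge1Dx _).
  apply: (@le_trans _ _ (Ex (fun w => 1 - l / 2 * Z w))).
    apply: ler_Ex => w; apply: le_trans (expRN_le _) _; last by lra.
    by have /andP[-> ?] := lZ w; lra.
  by rewrite ExB Ex_const // ExZ -/m; lra.
have E2 : Ex (fun w => expR (l * Z w)) <= expR (2 * l * m).
  apply: le_trans (expR_ge1Dx _).
  apply: (@le_trans _ _ (Ex (fun w => 1 + 2 * l * Z w))).
    by apply: ler_Ex => w; apply: le_trans (expR_le (lZ w)) _; lra.
  by rewrite ExD Ex_const // ExZ.
have prodE (F : Om -> R) : Ex (fun f : {ffun 'I_T -> Om} => \prod_t F (f t)) = Ex F ^+ T.
  by rewrite (Ex_ffun_prod (fun _ => F)) prodr_const card_ord.
pose S (f : {ffun 'I_T -> Om}) := \sum_t Z (f t).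
have X1 : Ex (fun f => expR (l * (T%:R * (m / 4 - s) - S f))) <= expR (- (T%:R * s * l)).
  rewrite (eq_Ex (g := fun f : {ffun 'I_T -> Om} => expR (l * T%:R * (m / 4 - s)) *
      \prod_t expR (- (l * Z (f t))))); last first.
    move=> f; rewrite -expR_sum -expRD sumrN -mulr_sumr.
    by congr expR; rewrite /S; ring.
  rewrite ExZ (prodE (fun w => expR (- (l * Z w)))).
  apply: (@le_trans _ _ (expR (l * T%:R * (m / 4 - s)) * expR (- (l * m / 2)) ^+ T)).
    rewrite ler_pM2l ?expR_gt0 // lerXn2r ?nnegrE ?expR_ge0 //.
    by apply: Ex_ge0 => w; exact: expR_ge0.
  rewrite -expRM_natl -expRD ler_expR.
  have : 0 <= l * T%:R * m by rewrite mulr_ge0 // mulr_ge0 // ltW.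
  by lra.
have X2 : Ex (fun f => expR (l * (S f - T%:R * (2 * m + s)))) <= expR (- (T%:R * s * l)).
  rewrite (eq_Ex (g := fun f : {ffun 'I_T -> Om} => expR (- (l * T%:R * (2 * m + s))) *
      \prod_t expR (l * Z (f t)))); last first.
    move=> f; rewrite -expR_sum -expRD -mulr_sumr.
    by congr expR; rewrite /S; ring.
  rewrite ExZ (prodE (fun w => expR (l * Z w))).
  apply: (@le_trans _ _ (expR (- (l * T%:R * (2 * m + s))) * expR (2 * l * m) ^+ T)).
    rewrite ler_pM2l ?expR_gt0 // lerXn2r ?nnegrE ?expR_ge0 //.
    by apply: Ex_ge0 => w; exact: expR_ge0.
  by rewrite -expRM_natl -expRD ler_expR; lra.
rewrite /Pr -[T%:R * s / _]/(T%:R * s * l).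
have Om0' : (0 < #|{ffun 'I_T -> Om}|)%N by rewrite card_ffun expn_gt0 Om0.
(* Markov's inequality in pointwise form: the exponential of a deviation is at least 1 wherever that
   deviation occurs. *)
apply: (@le_trans _ _ (Ex (fun f => 1 - (expR (l * (T%:R * (m / 4 - s) - S f)) +
    expR (l * (S f - T%:R * (2 * m + s))))))).
  by rewrite ExB ExD Ex_const //; lra.
apply: ler_Ex => f.
have e1 := expR_ge0 (l * (T%:R * (m / 4 - s) - S f)).
have e2 := expR_ge0 (l * (S f - T%:R * (2 * m + s))).
rewrite ler_pdivlMr // ler_pdivrMr //.
case: (lerP ((m / 4 - s) * T%:R) (\sum_t Z (f t))) => /= h1; last first.
  suff : 1 <= expR (l * (T%:R * (m / 4 - s) - S f)) by lra.
  apply: le_trans (expR_ge1Dx _); rewrite lerDl mulr_ge0 ?(ltW l0) // subr_ge0.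
  by rewrite mulrC ltW.
case: (lerP (\sum_t Z (f t)) ((2 * m + s) * T%:R)) => /= h2; first by lra.
suff : 1 <= expR (l * (S f - T%:R * (2 * m + s))) by lra.
apply: le_trans (expR_ge1Dx _); rewrite lerDl mulr_ge0 ?(ltW l0) // subr_ge0.
by rewrite mulrC ltW.
Qed.

End Chernoff.

(** * Linear sketches as streaming algorithms *)

Lemma prob_bits_bij (R : realType) r (T : finType) (h : r.-tuple bool -> T)
    (E : T -> bool) : bijective h ->
  prob_bits R (fun w => E (h w)) = Pr R E.
Proof.
move=> bh; rewrite /Pr -(Ex_bij _ bh) /Ex /prob_bits card_tuple card_bool.
congr (_ / _); rewrite -natr_sum; congr _%:R.
by rewrite cardsE -sum1_card big_mkcond.
Qed.

Lemma net_sum (n d Delta : nat) (st : seq (update d Delta)) (b : bool)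
    (A : n.-tuple (point d Delta)) (Q : pred (point d Delta)) :
  (forall x, net_count st b x = (count_mem x A)%:Z) ->
  \sum_(u <- st | (upd_toA u == b) && Q (upd_point u))
    (if upd_insert u then 1 else -1 : int) = (count Q A)%:Z.
Proof.
move=> netA.
rewrite (partition_big (fun u => upd_point u) Q) /=; last by move=> u /andP[].
have -> : (count Q A)%:Z = \sum_(x | Q x) (count_mem x A)%:Z.
  rewrite -sum1_count (partition_big id Q) //= -natz natr_sum.
  apply: eq_bigr => x Qx; rewrite natz -sum1_count; congr Posz.
  by apply: eq_bigl => y /=; case: eqP => [->|_]; rewrite ?Qx ?andbF.
apply: eq_bigr => x Qx; rewrite -netA; apply: eq_bigl => u.
by case: (upd_point u =P x) => [->|_]; rewrite ?Qx ?andbF ?andbT.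
Qed.

(* The state is the vector of the counters modulo a power of two exceeding n,
   so that intermediate values of arbitrary size do no harm. *)
Lemma algorithm_of_predicates (R : realType) (d Delta n : nat)
    (Om J : finType) (Q : Om -> J -> pred (point d Delta))
    (dec : Om -> {ffun J * bool -> nat} -> R) : dyadic Om ->
  exists alg : algorithm R d Delta,
    alg_space alg = ((trunc_log 2 n).+1 * (#|J| * 2))%N /\
    forall (A B : n.-tuple (point d Delta)) (st : seq (update d Delta)),
      stream_result st A B -> forall E : pred R,
      prob_bits R (fun w : (alg_rand alg).-tuple bool => E (alg_run st w)) =
      Pr R (fun w => E (dec w
        [ffun jb => count (Q w jb.1) (if jb.2 then A else B)])).
Proof.
move=> [r /dyadic_bij[h bh]].
set b := (trunc_log 2 n).+1; pose m := (2 ^ b)%N.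
have m1 : (1 < m)%N by rewrite /m expnS; move: (expn_gt0 2 (trunc_log 2 n)); lia.
have nm : (n < m)%N by rewrite trunc_log_ltn.
pose S : finType := {ffun J * bool -> 'Z_m}.
have [|enc [dc encK dcK]] := @dyadic_bij S (b * (#|J| * 2)).
  rewrite card_ffun card_prod card_bool card_ord Zp_cast //.
  by rewrite [RHS]expnM.
pose sgn (u : update d Delta) : 'Z_m := if upd_insert u then 1 else -1.
pose step (w : Om) (s : S) (u : update d Delta) : S :=
  [ffun jb => s jb + (if (upd_toA u == jb.2) && Q w jb.1 (upd_point u)
                      then sgn u else 0)].
pose alg := @Algorithm R d Delta (b * (#|J| * 2)) r (fun _ => dc 0)
  (fun w s u => dc (step (h w) (enc s) u))
  (fun w s => dec (h w) [ffun jb => nat_of_ord (enc s jb)]).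
exists alg; split=> // A B st stAB E.
rewrite -(prob_bits_bij _ (r := r) (h := h)) //; congr (_ / _); congr _%:R.
apply: eq_card => w; rewrite !inE; congr (E _).
rewrite /alg_run /=.
have runE s us : foldl (fun s u => dc (step (h w) (enc s) u)) (dc s) us =
    dc (foldl (step (h w)) s us).
  by elim: us s => //= u us IH s; rewrite dcK IH.
rewrite runE dcK; congr (dec _ _).
have stepE s us jb : foldl (step (h w)) s us jb = s jb +
    \sum_(u <- us | (upd_toA u == jb.2) && Q (h w) jb.1 (upd_point u)) sgn u.
  elim: us s => [|u us IH] s /=; first by rewrite big_nil addr0.
  by rewrite IH ffunE big_cons; case: ifP => _; rewrite ?addr0 ?addrA.
apply/ffunP => jb; rewrite !ffunE stepE ffunE add0r.
have -> : \sum_(u <- st | (upd_toA u == jb.2) && Q (h w) jb.1 (upd_point u)) sgn u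
    = (count (Q (h w) jb.1) (if jb.2 then A else B))%:R.
  rewrite [RHS]pmulrn.
  rewrite -(@net_sum n d Delta st jb.2).
    rewrite (big_morph intr (rmorphD _) (rmorph0 _)); apply: eq_bigr => u _.
    by rewrite /sgn; case: (upd_insert u).
  by move=> x; have [] := stAB x; case: jb.2.
rewrite val_Zp_nat // modn_small //; apply: leq_ltn_trans nm.
by apply: leq_trans (count_size _ _) _; case: jb.2; rewrite size_tuple.
Qed.

(** * Matchings along nested partitions *)

Definition avg (R : realType) (I : finType) (P : pred I) (f : I -> R) : R :=
  (\sum_(i | P i) f i) / #|P|%:R.

Section Average.
Variables (R : realType) (I : finType).
Implicit Types (P Q S : pred I) (f : I -> R).

Lemma ler_avg P f f' : (forall i, P i -> f i <= f' i) -> avg P f <= avg P f'.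
Proof. by move=> ff; rewrite ler_wpM2r ?invr_ge0 ?ler0n // ler_sum. Qed.

Lemma eq_avg P f f' : (forall i, P i -> f i = f' i) -> avg P f = avg P f'.
Proof. by move=> ff; rewrite /avg (eq_bigr _ ff). Qed.

Lemma eq_avgl P Q f : P =1 Q -> avg P f = avg Q f.
Proof. by move=> PQ; rewrite /avg (eq_bigl _ _ PQ) (eq_card PQ). Qed.

Lemma avg_ge0 P f : (forall i, P i -> 0 <= f i) -> 0 <= avg P f.
Proof. by move=> f0; rewrite divr_ge0 ?ler0n ?sumr_ge0. Qed.

Lemma avgD P f f' : avg P (fun i => f i + f' i) = avg P f + avg P f'.
Proof. by rewrite /avg big_split mulrDl. Qed.

Lemma avgZ P c f : avg P (fun i => c * f i) = c * avg P f.
Proof. by rewrite /avg -mulr_sumr mulrA. Qed.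

Lemma avg_const P (c : R) x : P x -> avg P (fun=> c) = c.
Proof.
move=> Px; rewrite /avg sumr_const -[c *+ _]mulr_natr mulfK //.
by rewrite pnatr_eq0 -lt0n; apply/card_gt0P; exists x.
Qed.

Lemma avg_le_sum P f x : P x -> (forall i, P i -> 0 <= f i) ->
  avg P f <= \sum_(i | P i) f i.
Proof.
move=> Px f0; have s0 : 0 <= \sum_(i | P i) f i by rewrite sumr_ge0.
rewrite ler_pdivrMr ?ler_peMr // ?ltr0n ?ler1n; apply/card_gt0P; by exists x.
Qed.

Lemma Ex_avg (T : finType) P (F : I -> T -> R) :
  Ex (fun t => avg P (fun i => F i t)) = avg P (fun i => Ex (F i)).
Proof. by rewrite /avg -Ex_sum -mulrC -ExZ; apply: eq_Ex => t; rewrite mulrC. Qed.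

Variable D : I -> I -> R.
Hypothesis Dtri : forall x y z, D x z <= D x y + D y z.

Definition avg_dist P Q := avg P (fun x => avg Q (D x)).

(** All three terms are averages over triples drawn from [P], [Q], [S]; nonemptiness makes averaging
    over the absent variable neutral. *)
Lemma avg_dist_triangle P Q S p q s : P p -> Q q -> S s ->
  avg_dist P S <= avg_dist P Q + avg_dist Q S.
Proof.
move=> Pp Qq Ss.
have e1 : avg_dist P S = avg P (fun x => avg Q (fun y => avg S (fun z => D x z))).
  by apply: eq_avg => x _; rewrite (avg_const _ Qq).
have e2 : avg_dist P Q = avg P (fun x => avg Q (fun y => avg S (fun z => D x y))).
  by apply: eq_avg => x _; apply: eq_avg => y _; rewrite (avg_const _ Ss).
have e3 : avg_dist Q S = avg P (fun x => avg Q (fun y => avg S (fun z => D y z))).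
  by rewrite (avg_const _ Pp).
rewrite e1 e2 e3 -avgD; apply: ler_avg => x _; rewrite -avgD.
apply: ler_avg => y _; rewrite -avgD.
by apply: ler_avg => z _; exact: Dtri.
Qed.

End Average.

(** Positions rather than points: equal points of a multiset remain distinct tokens, and both sides
    share one type. *)
Definition token (n : nat) : finType := (bool * 'I_n)%type.

Definition side (R : pzRingType) n (x : token n) : R := if x.1 then 1 else -1.

Definition tk n (b : bool) (i : 'I_n) : token n := (b, i).

Lemma sum_token (R : realType) n (f : token n -> R) :
  \sum_x f x = \sum_a f (tk true a) + \sum_a f (tk false a).
Proof.
transitivity (\sum_b \sum_a f (tk b a)); last by rewrite big_bool.
by rewrite pair_bigA; apply: eq_bigr => -[].
Qed.

Section Tree.
Variables (R : realType) (n : nat) (Id : finType).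
Variables (lev : nat -> token n -> Id) (par : nat -> Id -> Id).
Hypothesis lev0 : forall x y, lev 0 x = lev 0 y.
Hypothesis levS : forall i x, lev i x = par i (lev i.+1 x).

Definition cell i u : pred (token n) := [pred x | lev i x == u].

Definition mu i u : R := \sum_(x | cell i u x) side R x.

Lemma lev_nested i j x y : (j <= i)%N -> lev i x = lev i y -> lev j x = lev j y.
Proof.
elim: i => [|i IH]; first by rewrite leqn0 => /eqP ->.
rewrite leq_eqVlt => /predU1P[-> //|ji] e.
by apply: IH => //; rewrite (levS i x) (levS i y) e.
Qed.

Definition agree i (a b : 'I_n) := lev i (tk true a) == lev i (tk false b).

(* Maximising the total number of levels at which matched points agree yields
   the bottom-up greedy matching: exchanging two partners whenever a cell has
   points of both sides matched outside increases that number. *)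
Lemma greedy_matching L : exists s : 'S_n, forall i a b, (i <= L)%N ->
  agree i a (s b) -> agree i a (s a) || agree i b (s b).
Proof.
pose pot (s : 'S_n) := (\sum_(i < L.+1) \sum_a agree i a (s a))%N.
pose s := [arg max_(t > (1%g : 'S_n) in predT) pot t].
have smax t : (pot t <= pot s)%N.
  by rewrite /s; case: arg_maxnP => // r _; apply.
exists s => i a b iL ab; apply/negPn/negP; rewrite negb_or => /andP[na nb].
have aNb : a != b by apply: contraNneq na => {2}->.
have := smax (tperm a b * s)%g; rewrite leqNgt => /negP; apply.
have key (j : 'I_L.+1) :
    (\sum_x agree j x (s x) + (j == i :> nat) <=
     \sum_x agree j x ((tperm a b * s)%g x))%N.
  rewrite (bigD1 a) //= (bigD1 b) 1?eq_sym //=.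
  rewrite [in leqRHS](bigD1 a) //= [in leqRHS](bigD1 b) 1?eq_sym //=.
  rewrite !permM tpermL tpermR.
  rewrite (eq_bigr (fun x => agree j x (s x) : nat) (P := fun x => (x != a) && (x != b))
    (F1 := fun x => agree j x ((tperm a b * s)%g x) : nat)); last first.
    by move=> x /andP[xa xb]; rewrite permM tpermD 1?eq_sym.
  rewrite !addnA [leqLHS]addnAC leq_add2r.
  have [jilt|ijlt|e] := ltngtP j i.
  - have jle := ltnW jilt.
    have ab' : agree j a (s b) by rewrite /agree (lev_nested jle (eqP ab)).
    rewrite ab' addn0.
    case: (boolP (agree j a (s a))) => [h1|_]; last by case: (agree j b (s b)).
    case: (boolP (agree j b (s b))) => [h2|_] //.
    have -> // : agree j b (s a).
    by rewrite /agree (eqP h2) -(eqP ab') (eqP h1).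
  - have na' : agree j a (s a) = false.
      by apply: contraNF na => /eqP/(lev_nested (ltnW ijlt)) e; apply/eqP.
    have nb' : agree j b (s b) = false.
      by apply: contraNF nb => /eqP/(lev_nested (ltnW ijlt)) e; apply/eqP.
    by rewrite na' nb'.
  - by rewrite e (negPf na) (negPf nb) ab.
rewrite /pot; have iL' : (i < L.+1)%N by [].
rewrite (bigD1 (Ordinal iL')) // [ltnRHS](bigD1 (Ordinal iL')) //=.
rewrite -addSn leq_add //.
  by have := key (Ordinal iL'); rewrite /= eqxx addn1.
by apply: leq_sum => j _; apply: leq_trans (key j); rewrite leq_addr.
Qed.

Variable D : token n -> token n -> R.
Hypothesis Dtri : forall x y z, D x z <= D x y + D y z.
Hypothesis Dsym : forall x y, D x y = D y x.
Hypothesis D0 : forall x y, 0 <= D x y.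

Definition edge_len i u := avg_dist D (cell i.+1 u) (cell i (par i u)).

Definition to_cell i x := avg (cell i (lev i x)) (D x).

Lemma to_cell_par i x : to_cell i x <= to_cell i.+1 x + edge_len i (lev i.+1 x).
Proof.
have cx : cell i.+1 (lev i.+1 x) x by rewrite /cell /=.
have cx' : cell i (par i (lev i.+1 x)) x by rewrite /cell /= levS.
have := avg_dist_triangle Dtri (P := pred1 x) (eqxx x) cx cx'.
have e P : avg_dist D (pred1 x) P = avg P (D x).
  by rewrite /avg_dist {1}/avg big_pred1_eq card1 divr1.
by rewrite !e /to_cell /edge_len [lev i x]levS.
Qed.

(** Climb from both cells of level [L] until they coincide: each level at which they still differ
    contributes its two edges, and [lev0] makes the climb end. *)
Lemma dist_le_path L x y :
  D x y <= to_cell L x + to_cell L y +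
    \sum_(0 <= i < L) (lev i.+1 x != lev i.+1 y)%:R *
      (edge_len i (lev i.+1 x) + edge_len i (lev i.+1 y)).
Proof.
have edge0 i u : 0 <= edge_len i u.
  by apply: avg_ge0 => *; apply: avg_ge0.
have meet i : lev i x = lev i y -> D x y <= to_cell i x + to_cell i y.
  move=> e; have cx : cell i (lev i x) x by rewrite /cell /=.
  rewrite /to_cell -e -avgD -[leLHS](avg_const (D x y) cx).
  by apply: ler_avg => z _; rewrite (Dsym y); exact: Dtri.
elim: L => [|L IH]; first by rewrite big_geq // addr0; apply: meet; exact: lev0.
have [e|ne] := eqVneq (lev L.+1 x) (lev L.+1 y).
  apply: le_trans (meet _ e) _; rewrite lerDl sumr_ge0 // => i _.
  by rewrite mulr_ge0 // addr_ge0.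
rewrite big_nat_recr //= ne mul1r.
have := to_cell_par L x; have := to_cell_par L y; lra.
Qed.

(** For such a matching no cell holds points of both sides that are matched outside it, so nothing
    cancels except the pairs matched inside. *)
Lemma mu_out (s : 'S_n) i u :
  (forall a b, agree i a (s b) -> agree i a (s a) || agree i b (s b)) ->
  `|mu i u| = \sum_a (agree i a (s a) == false)%:R *
     ((lev i (tk true a) == u)%:R + (lev i (tk false (s a)) == u)%:R).
Proof.
move=> sP; rewrite /mu big_mkcond /=.
rewrite sum_token /side /= [X in `|_ + X|](reindex_inj (@perm_inj _ s)) /=.
rewrite -big_split /=.
pose p a := lev i (tk true a) == u; pose q a := lev i (tk false (s a)) == u.
have agreeE a : agree i a (s a) -> p a = q a.
  by rewrite /agree /p /q => /eqP ->.
have -> : \sum_a ((if p a then 1 else 0) + (if q a then -1 else 0)) =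
    \sum_a (~~ agree i a (s a))%:R * ((p a)%:R - (q a)%:R) :> R.
  apply: eq_bigr => a _; case: (boolP (agree i a (s a))) => [/agreeE ->|_] /=.
    by rewrite mul0r; case: (q a); rewrite ?subrr ?addr0.
  by rewrite mul1r; case: (p a); case: (q a); rewrite ?subr0 ?addr0 ?sub0r ?add0r.
(* One point of A in [u] matched outside excludes every such point of B; otherwise only points of B
   remain. Either way all terms have one sign. *)
have [/existsP[a /andP[nab pa]]|noA] := boolP [exists a, ~~ agree i a (s a) && p a].
  have noq b : ~~ agree i b (s b) -> q b = false.
    move=> nb; apply/negP => qb.
    have ab : agree i a (s b) by rewrite /agree (eqP pa) (eqP qb).
    by have := sP a b ab; rewrite (negPf nab) (negPf nb).
  rewrite ger0_norm ?sumr_ge0 //.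
    apply: eq_bigr => b _; rewrite eqbF_neg; case: (boolP (agree i b (s b))) => [_|nb].
      by rewrite !mul0r.
    by rewrite -/(p b) -/(q b) (noq b nb) subr0 addr0.
  move=> b _; case: (boolP (agree i b (s b))) => [_|nb]; first by rewrite mul0r.
  by rewrite (noq b nb) subr0 mul1r.
have nop b : ~~ agree i b (s b) -> p b = false.
  by move=> nb; apply: contraNF noA => pb; apply/existsP; exists b; rewrite nb.
rewrite ler0_norm ?sumr_le0 //.
  rewrite -sumrN; apply: eq_bigr => b _; rewrite eqbF_neg.
  case: (boolP (agree i b (s b))) => [_|nb]; first by rewrite !mul0r oppr0.
  by rewrite -/(p b) -/(q b) (nop b nb) sub0r mulrN opprK add0r.
move=> b _; case: (boolP (agree i b (s b))) => [_|nb]; first by rewrite mul0r.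
by rewrite (nop b nb) mul1r sub0r oppr_le0.
Qed.

Lemma sum_cells (f : Id -> R) x : \sum_u f u * (x == u)%:R = f x.
Proof.
rewrite (bigD1 x) //= eqxx mulr1 big1 ?addr0 // => u.
by rewrite eq_sym => /negPf ->; rewrite mulr0.
Qed.

Lemma tree_matching L : exists s : 'S_n,
  \sum_a D (tk true a) (tk false (s a)) <= \sum_x to_cell L x +
    \sum_(0 <= i < L) \sum_u `|mu i.+1 u| * edge_len i u.
Proof.
have [s sP] := greedy_matching L; exists s.
apply: (@le_trans _ _ (\sum_a (to_cell L (tk true a) + to_cell L (tk false (s a)) +
    \sum_(0 <= i < L) (lev i.+1 (tk true a) != lev i.+1 (tk false (s a)))%:R *
      (edge_len i (lev i.+1 (tk true a)) + edge_len i (lev i.+1 (tk false (s a))))))).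
  by apply: ler_sum => a _; exact: dist_le_path.
rewrite !big_split /= lerD //.
  rewrite sum_token.
  by rewrite [X in _ <= _ + X](reindex_inj (@perm_inj _ s)).
rewrite exchange_big /= big_seq [leRHS]big_seq; apply: ler_sum => i.
rewrite mem_index_iota => /andP[_ iL].
under [leRHS]eq_bigr => u _ do rewrite (mu_out u (fun a b => sP i.+1 a b iL)) mulr_suml.
rewrite exchange_big /=; apply: ler_sum => a _; rewrite /agree eqbF_neg.
under eq_bigr => u _ do rewrite -mulrA mulrDl [_ * edge_len _ _]mulrC
  [(_ == u)%:R * edge_len _ _]mulrC.
by rewrite -mulr_sumr big_split /= !sum_cells.
Qed.

(** The opposite direction, for an arbitrary matching: pairs that stay inside a cell cancel, so only
    separated pairs contribute to the imbalances. *)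
Lemma abs_mu_le (s : 'S_n) i (f : Id -> R) : (forall u, 0 <= f u) ->
  \sum_u `|mu i u| * f u <= \sum_a (~~ agree i a (s a))%:R *
    (f (lev i (tk true a)) + f (lev i (tk false (s a)))).
Proof.
move=> f0.
have muE u : `|mu i u| <= \sum_a (~~ agree i a (s a))%:R *
   ((lev i (tk true a) == u)%:R + (lev i (tk false (s a)) == u)%:R).
  rewrite /mu big_mkcond sum_token /side /cell /= [X in `|_ + X|](reindex_inj (@perm_inj _ s)) /=.
  rewrite -big_split /=; apply: le_trans (ler_norm_sum _ _ _) _.
  apply: ler_sum => a _; case: (boolP (agree i a (s a))) => [/eqP ->|_].
    by case: ifP => _; rewrite ?subrr ?addr0 normr0 mul0r.
  rewrite mul1r (le_trans (ler_normD _ _)) // lerD //.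
    by case: ifP => _; rewrite ?normr0 ?normr1.
  by case: ifP => _; rewrite ?normrN ?normr0 ?normr1.
apply: (@le_trans _ _ (\sum_u (\sum_a (~~ agree i a (s a))%:R *
   ((lev i (tk true a) == u)%:R + (lev i (tk false (s a)) == u)%:R)) * f u)).
  by apply: ler_sum => u _; rewrite ler_wpM2r.
under eq_bigr => u _ do rewrite mulr_suml.
rewrite exchange_big /=; apply: ler_sum => a _.
under eq_bigr => u _ do rewrite -mulrA mulrDl [_ * f _]mulrC [(_ == u)%:R * f _]mulrC.
by rewrite -mulr_sumr big_split /= !sum_cells.
Qed.

End Tree.

(** * Partitions by random cuts *)

Lemma sum_modn (R : nmodType) (f : nat -> R) q m : (0 < m)%N ->
  \sum_(0 <= u < q * m) f (u %% m)%N = (\sum_(0 <= r < m) f r) *+ q.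
Proof.
move=> m0; elim: q => [|q IH]; first by rewrite mul0n big_geq.
rewrite (@big_cat_nat _ _ _ (q * m)) //= ?leq_mul2r ?leqnSn ?orbT // IH mulrSr.
congr (_ + _); rewrite -{1}[(q * m)%N]add0n big_addn mulSn addnK.
rewrite big_nat [RHS]big_nat; apply: eq_bigr => r /andP[_ rm].
by rewrite addnC modnMDl modn_small.
Qed.

Lemma Ex_modn (R : realType) (f : nat -> R) i B : (i <= B)%N ->
  2 ^+ i * Ex (fun u : 'I_(2 ^ B) => f (u %% 2 ^ i)%N) = \sum_(0 <= r < 2 ^ i) f r.
Proof.
move=> iB; rewrite /Ex card_ord.
rewrite -(big_mkord predT (fun u => f (u %% 2 ^ i)%N)).
have -> : (2 ^ B = 2 ^ (B - i) * 2 ^ i)%N by rewrite -expnD subnK.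
rewrite sum_modn ?expn_gt0 // -[_ *+ (2 ^ (B - i))]mulr_natr natrM !natrX.
have a0 : 2 ^+ i != 0 :> R by rewrite expf_neq0 ?pnatr_eq0.
have b0 : 2 ^+ (B - i) != 0 :> R by rewrite expf_neq0 ?pnatr_eq0.
move: (2 ^+ i) (2 ^+ (B - i)) a0 b0 => a b a0 b0.
by field; rewrite a0 b0.
Qed.

(* Scale i + 1 uses a number of cuts that is uniform in [2^i, 2^(i+1)), so that
   an average over the shift u turns a sum over scales into a sum over all
   numbers of cuts. *)
Definition ncuts (u j : nat) : nat :=
  if j is i.+1 then (2 ^ i + u %% 2 ^ i)%N else 0%N.

Lemma ncuts_lt u j : (ncuts u j < 2 ^ j)%N.
Proof.
by case: j => [|j] //=; rewrite expnS mul2n -addnn ltn_add2l ltn_mod expn_gt0.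
Qed.

Lemma ncuts_ge u j : (2 ^ j <= ncuts u j.+1)%N.
Proof. exact: leq_addr. Qed.

Lemma ncuts_leS u j : (ncuts u j <= ncuts u j.+1)%N.
Proof. exact: leq_trans (ltnW (ncuts_lt u j)) (ncuts_ge u j). Qed.

Lemma ncuts_sum (R : realType) (f : nat -> R) B :
  \sum_(0 <= i < B) 2 ^+ i * Ex (fun u : 'I_(2 ^ B) => f (ncuts u i.+1)) =
  \sum_(1 <= k < 2 ^ B) f k.
Proof.
have -> : \sum_(0 <= i < B) 2 ^+ i * Ex (fun u : 'I_(2 ^ B) => f (ncuts u i.+1)) =
    \sum_(0 <= i < B) \sum_(2 ^ i <= k < 2 ^ i.+1) f k.
  rewrite big_nat [RHS]big_nat; apply: eq_bigr => i /andP[_ iB] /=.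
  rewrite (Ex_modn (fun r => f (2 ^ i + r)%N)) ?(ltnW iB) //.
  rewrite -[X in _ = \sum_(X <= _ < _) _]add0n [RHS]big_addn expnS mul2n -addnn addnK.
  by apply: eq_bigr => r _; rewrite addnC.
elim: B => [|B IH]; first by rewrite !big_geq.
rewrite big_nat_recr // IH -big_cat_nat ?expn_gt0 //.
by rewrite leq_exp2l.
Qed.

Section Potential.
Variables (R : realType) (I Cut : finType) (cv : Cut -> I -> bool).
Hypothesis Cut0 : (0 < #|Cut|)%N.

Definition cutd (x z : I) : R := Pr R (fun c => cv c x != cv c z).

Lemma cutd_ge0 x z : 0 <= cutd x z.
Proof. by apply: Ex_ge0 => c. Qed.

Definition same (s : seq Cut) (x z : I) := all (fun c => cv c x == cv c z) s.

Variable x : I.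

Definition restr (Y : pred I) c : pred I := [pred z | Y z && (cv c x == cv c z)].

(** The pool [Y] is a parameter so that the first cut can be absorbed into it, by [spread_cons];
    inductions on the number of cuts vary [Y]. *)
Definition spread (Y : pred I) (s : seq Cut) : R :=
  avg [pred z | Y z && same s x z] (cutd x).

Lemma spread_ge0 Y s : 0 <= spread Y s.
Proof. by apply: avg_ge0 => z _; exact: cutd_ge0. Qed.

Lemma spread_cons Y c s : spread Y (c :: s) = spread (restr Y c) s.
Proof. by apply: eq_avgl => z /=; rewrite andbA. Qed.

Definition espread (k : nat) (Y : pred I) : R := Eseq k (spread Y).

Lemma espread_ge0 k Y : 0 <= espread k Y.
Proof. by apply: Eseq_ge0 => s; exact: spread_ge0. Qed.

Lemma espreadS k Y : espread k.+1 Y = Ex (fun c => espread k (restr Y c)).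
Proof.
by apply: eq_Ex => c; apply: eq_Eseq => s _; rewrite spread_cons.
Qed.

Lemma restr_gt0 (Y : pred I) c : Y x -> (0 < #|restr Y c|)%N.
Proof. by move=> Yx; apply/card_gt0P; exists x; rewrite inE Yx eqxx. Qed.

Lemma restr_le (Y : pred I) c : (#|restr Y c| <= #|Y|)%N.
Proof. by apply: subset_leq_card; apply/subsetP => z /andP[]. Qed.

(* One more random cut removes in expectation a fraction of the cell equal to
   the average distance from x, and 1 - r <= - ln r. *)
Lemma espread_sum K (Y : pred I) : Y x ->
  \sum_(0 <= k < K) espread k Y <= ln (#|Y|%:R).
Proof.
elim: K Y => [|K IH] Y Yx.
  rewrite big_geq // ln_ge0 // ler1n; apply/card_gt0P; exists x; exact: Yx.
have Y0 : 0 < #|Y|%:R :> R by rewrite ltr0n; apply/card_gt0P; exists x; exact: Yx.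
rewrite big_nat_recl //.
under eq_bigr => k _ do rewrite espreadS.
rewrite -(Ex_sum_nat 0 K (fun k c => espread k (restr Y c))).
have -> : espread 0 Y = Ex (fun c => 1 - #|restr Y c|%:R / #|Y|%:R).
  rewrite /espread /= /spread (eq_avgl (Q := Y)); last by move=> z /=; rewrite andbT.
  rewrite /cutd /Pr -(Ex_avg Y (fun z c => (cv c x != cv c z)%:R)).
  apply: eq_Ex => c; rewrite /avg -[X in X - _](mulfV (lt0r_neq0 Y0)) -mulrBl.
  congr (_ / _); rewrite -!sum1_card !natr_sum [X in _ - X]big_mkcondr /= -sumrB.
  by apply: eq_bigr => z _; case: eqP; rewrite ?subrr ?subr0.
rewrite -ExD -(Ex_const (ln #|Y|%:R) Cut0); apply: ler_Ex => c.
have c0 : 0 < #|restr Y c|%:R :> R by rewrite ltr0n restr_gt0.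
have := IH (restr Y c) (introT andP (conj Yx (eqxx _))).
have : ln (1 + (#|restr Y c|%:R / #|Y|%:R - 1)) <= #|restr Y c|%:R / #|Y|%:R - 1 :> R.
  by apply: le_ln1Dx; rewrite ltrBrDl subrr divr_gt0.
rewrite addrC subrK ln_div ?posrE //; lra.
Qed.

Variable y : I.

Definition split c : R := (cv c x != cv c y)%:R.

(** One cut is required to separate [x] from [y] while [k] more refine the cell of [x]: the quantity
    that a union bound over the separating cuts produces. *)
Definition espread1 (k : nat) (Y : pred I) : R :=
  Ex (fun c => split c * espread k (restr Y c)).

Lemma espread1_ge0 k Y : 0 <= espread1 k Y.
Proof. by apply: Ex_ge0 => c; rewrite mulr_ge0 // espread_ge0. Qed.

Lemma espread1_sum K (Y : pred I) : Y x ->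
  \sum_(0 <= k < K) espread1 k Y <= cutd x y * ln (#|Y|%:R).
Proof.
move=> Yx; rewrite -(Ex_sum_nat 0 K (fun k c => split c * espread k (restr Y c))).
rewrite mulrC -ExZ; apply: ler_Ex => c; rewrite -mulr_sumr mulrC.
rewrite ler_wpM2r //; apply: le_trans (espread_sum _ _) _; first by apply/andP.
by rewrite ler_ln ?posrE ?ltr0n ?ler_nat ?restr_le ?restr_gt0 //
  (leq_trans (restr_gt0 c Yx) (restr_le _ _)).
Qed.

(** The cuts are exchangeable, so each of the [k] possible separating cuts contributes what the
    first one does; in the induction this is the exchange of [c] and [c']. *)
Lemma Eseq_split_spread k Y :
  Eseq k (fun s => (\sum_(c <- s) split c) * spread Y s) = k%:R * espread1 k.-1 Y.
Proof.
elim: k Y => [|k IH] Y; first by rewrite /= big_nil !mul0r.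
have -> : Eseq k.+1 (fun s => (\sum_(c <- s) split c) * spread Y s) =
    Ex (fun c => split c * espread k (restr Y c) + k%:R * espread1 k.-1 (restr Y c)).
  apply: eq_Ex => c; rewrite -IH -EseqZ -EseqD; apply: eq_Eseq => s _.
  by rewrite big_cons spread_cons mulrDl.
rewrite ExD ExZ -/(espread1 k Y) mulrSr mulrDl mul1r addrC; congr (_ + _).
case: k {IH} => [|k]; first by rewrite !mul0r.
congr (_ * _); rewrite /espread1 /= Ex_swap; apply: eq_Ex => c.
rewrite espreadS -ExZ; apply: eq_Ex => c'; congr (_ * _).
by apply: eq_Eseq => s _; apply: eq_avgl => z /=; rewrite -!andbA; congr (_ && _);
  rewrite andbCA.
Qed.

Lemma Eseq_cat k m (f : seq Cut -> R) :
  Eseq (k + m) f = Eseq k (fun s1 => Eseq m (fun s2 => f (s1 ++ s2))).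
Proof. by elim: k f => [|k IH] f //=; apply: eq_Ex => c; rewrite IH. Qed.

Lemma Eseq_split m : Eseq m (fun s => \sum_(c <- s) split c) = m%:R * cutd x y.
Proof.
elim: m => [|m IH] /=; first by rewrite big_nil mul0r.
rewrite -[RHS]/(_ * Ex split) mulrSr mulrDl mul1r addrC -IH.
rewrite -[X in _ + X](Ex_const _ Cut0) -ExD; apply: eq_Ex => c.
rewrite -[X in X + _](Eseq_const m _ Cut0) -EseqD.
by apply: eq_Eseq => s _; rewrite big_cons.
Qed.

Lemma not_same_le s : (~~ same s x y)%:R <= \sum_(c <- s) split c.
Proof.
elim: s => [|c s IH] /=; first by rewrite big_nil.
rewrite big_cons negb_and; case: (boolP (_ == _)) => h /=.
  by rewrite /split h add0r.
by rewrite /split h lerDl (le_trans _ IH).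
Qed.

Lemma Eseq_separated k : Eseq k (fun s => (~~ same s x y)%:R) <= k%:R * cutd x y.
Proof. by rewrite -Eseq_split; apply: ler_Eseq => s _; exact: not_same_le. Qed.

Lemma Eseq_same_le k : Eseq k (fun s => (same s x y)%:R) = (1 - cutd x y) ^+ k.
Proof.
elim: k => [|k IH] //=.
rewrite exprS -IH mulrBl mul1r -{1}[Eseq k _](Ex_const _ Cut0) mulrC -ExZ -ExB.
apply: eq_Ex => c; case: eqP => _ /=; first by rewrite mulr0 subr0.
by rewrite mulr1 subrr Eseq_const.
Qed.

(** Separation is bounded by the number of separating cuts. A cut among those defining a cell leads
    to [espread1]; a later one is independent of the coarser cell and gives [cutd x y] times its
    spread. The number of cuts is of order 2^i, so averaging over [u] turns the sum over scales into
    the sums over all k bounded by [espread1_sum] and [espread_sum]. *)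
Lemma path_spread B :
  Ex (fun u : 'I_(2 ^ B) => Eseq (2 ^ B) (fun s => \sum_(0 <= i < B)
    (~~ same (take (ncuts u i.+1) s) x y)%:R *
      (spread predT (take (ncuts u i.+1) s) + spread predT (take (ncuts u i) s)))) <=
  8 * (cutd x y * ln #|I|%:R).
Proof.
pose f k : R := espread1 k.-1 predT.
pose F k : R := espread k predT.
have f0 k : 0 <= f k by exact: espread1_ge0.
have F0 k : 0 <= F k by exact: espread_ge0.
have H0 := cutd_ge0 x y.
pose L : R := ln #|I|%:R.
have fs n : \sum_(1 <= k < n) f k <= cutd x y * L.
  case: n => [|n]; first by rewrite big_geq // mulr_ge0 // ln_ge0 // ler1n;
    apply/card_gt0P; exists x.
  by rewrite big_add1 /=; exact: espread1_sum.
have Fs n : \sum_(0 <= k < n) F k <= L by exact: espread_sum.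
have bound (u i : nat) : (i < B)%N ->
    Eseq (2 ^ B) (fun s => (~~ same (take (ncuts u i.+1) s) x y)%:R *
      (spread predT (take (ncuts u i.+1) s) + spread predT (take (ncuts u i) s))) <=
    2 * 2 ^+ i * f (ncuts u i.+1) +
    ((ncuts u i)%:R * f (ncuts u i) + 2 * 2 ^+ i * cutd x y * F (ncuts u i)).
  move=> iB; set k1 := ncuts u i.+1; set k0 := ncuts u i.
  have k1N : (k1 <= 2 ^ B)%N.
    by rewrite (leq_trans (ltnW (ncuts_lt _ _))) // leq_exp2l.
  have k1le : k1%:R <= 2 * 2 ^+ i :> R by rewrite -exprS -natrX ler_nat ltnW // ncuts_lt.
  have k01 : (k0 <= k1)%N by exact: ncuts_leS.
  have -> : Eseq (2 ^ B) (fun s => (~~ same (take k1 s) x y)%:R *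
      (spread predT (take k1 s) + spread predT (take k0 s))) =
    Eseq k1 (fun s => (~~ same s x y)%:R *
      (spread predT s + spread predT (take k0 s))).
    rewrite -(Eseq_take _ Cut0 k1N); apply: eq_Eseq => s _.
    by rewrite take_takel.
  apply: (@le_trans _ _ (Eseq k1 (fun s => (\sum_(c <- s) split c) * spread predT s) +
    Eseq k1 (fun s => (\sum_(c <- s) split c) * spread predT (take k0 s)))).
    rewrite -EseqD; apply: ler_Eseq => s _; rewrite -mulrDr ler_wpM2r //.
      by rewrite addr_ge0 // spread_ge0.
    exact: not_same_le.
  apply: lerD; first by rewrite Eseq_split_spread -/(f k1) ler_wpM2r.
  (* The first [k0] cuts define the coarser cell; the remaining [k1 - k0] are independent of it. *)
  rewrite -(subnKC k01) Eseq_cat.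
  have -> : Eseq k0 (fun s1 => Eseq (k1 - k0) (fun s2 =>
      (\sum_(c <- s1 ++ s2) split c) * spread predT (take k0 (s1 ++ s2)))) =
    Eseq k0 (fun s => (\sum_(c <- s) split c) * spread predT s +
      (k1 - k0)%:R * cutd x y * spread predT s).
    apply: eq_Eseq => s sk.
    rewrite (eq_Eseq (g := fun s2 => (\sum_(c <- s) split c) * spread predT s +
      spread predT s * \sum_(c <- s2) split c)); last first.
      by move=> s2 _; rewrite take_size_cat // big_cat mulrDl /= [X in _ + X]mulrC.
    by rewrite EseqD Eseq_const // EseqZ Eseq_split [X in _ + X]mulrC.
  rewrite EseqD Eseq_split_spread EseqZ lerD2l -/(F k0).
  apply: ler_wpM2r; first exact: F0.
  apply: ler_wpM2r => //.
  by apply: le_trans k1le; rewrite ler_nat leq_subr.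
have -> : Ex (fun u : 'I_(2 ^ B) => Eseq (2 ^ B) (fun s => \sum_(0 <= i < B)
    (~~ same (take (ncuts u i.+1) s) x y)%:R *
      (spread predT (take (ncuts u i.+1) s) + spread predT (take (ncuts u i) s)))) =
  \sum_(0 <= i < B) Ex (fun u : 'I_(2 ^ B) => Eseq (2 ^ B) (fun s =>
    (~~ same (take (ncuts u i.+1) s) x y)%:R *
      (spread predT (take (ncuts u i.+1) s) + spread predT (take (ncuts u i) s)))).
  rewrite -Ex_sum_nat; apply: eq_Ex => u.
  by rewrite Eseq_sum_nat.
apply: (@le_trans _ _ (\sum_(0 <= i < B) Ex (fun u : 'I_(2 ^ B) =>
    2 * 2 ^+ i * f (ncuts u i.+1) +
    ((ncuts u i)%:R * f (ncuts u i) + 2 * 2 ^+ i * cutd x y * F (ncuts u i))))).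
  by rewrite big_nat [leRHS]big_nat; apply: ler_sum => i /andP[_ iB];
    apply: ler_Ex => u; exact: bound.
under eq_bigr => i _ do rewrite !ExD.
rewrite !big_split /=.
have e1 : \sum_(0 <= i < B) Ex (fun u : 'I_(2 ^ B) => 2 * 2 ^+ i * f (ncuts u i.+1))
    = 2 * \sum_(1 <= k < 2 ^ B) f k.
  by rewrite -ncuts_sum mulr_sumr; apply: eq_bigr => i _; rewrite ExZ mulrA.
have U0 : (0 < #|'I_(2 ^ B)|)%N by rewrite card_ord expn_gt0.
have e2 : \sum_(0 <= i < B) Ex (fun u : 'I_(2 ^ B) => (ncuts u i)%:R * f (ncuts u i))
    <= 2 * \sum_(1 <= k < 2 ^ B) f k.
  rewrite -e1; case: (B) => [|b]; first by rewrite !big_geq.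
  rewrite big_nat_recl // [leRHS]big_nat_recr //=.
  rewrite (eq_Ex (g := fun=> 0)) => [|u]; last by rewrite mul0r.
  rewrite [X in X + _]/Ex big1 // mul0r add0r -[leLHS]addr0 lerD //.
    apply: ler_sum => i _; apply: ler_Ex => u; rewrite ler_wpM2r //.
    by rewrite -exprS -natrX ler_nat ltnW // (ncuts_lt u i.+1).
  by apply: Ex_ge0 => u; apply: mulr_ge0; [rewrite mulr_ge0 ?exprn_ge0|exact: f0].
have e3 : \sum_(0 <= i < B) Ex (fun u : 'I_(2 ^ B) => 2 * 2 ^+ i * cutd x y * F (ncuts u i))
    <= 4 * (cutd x y * \sum_(0 <= k < 2 ^ B) F k).
  have half : \sum_(0 <= i < B) 2 ^+ i * Ex (fun u : 'I_(2 ^ B) => F (ncuts u i))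
      <= F 0 + 2 * \sum_(1 <= k < 2 ^ B) F k.
    rewrite -ncuts_sum; case: (B) => [|b].
      by rewrite !big_geq // mulr0 addr0; exact: F0.
    rewrite big_nat_recl // mul1r (eq_Ex (g := fun=> F 0)) //.
    rewrite Ex_const ?card_ord ?expn_gt0 // lerD2l big_nat_recr //= mulrDr.
    rewrite -[leLHS]addr0 lerD //.
      by rewrite mulr_sumr; apply: ler_sum => i _; rewrite exprS -mulrA.
    apply: mulr_ge0 => //; apply: mulr_ge0; first exact: exprn_ge0.
    by apply: Ex_ge0 => u; exact: F0.
  have -> : \sum_(0 <= i < B) Ex (fun u : 'I_(2 ^ B) =>
        2 * 2 ^+ i * cutd x y * F (ncuts u i)) =
      2 * cutd x y * \sum_(0 <= i < B) 2 ^+ i * Ex (fun u : 'I_(2 ^ B) => F (ncuts u i)).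
    by rewrite mulr_sumr; apply: eq_bigr => i _; rewrite ExZ; ring.
  rewrite (@big_cat_nat _ _ _ 1 0 (2 ^ B)) ?expn_gt0 //= big_nat1.
  have S0 : 0 <= cutd x y * F 0 by rewrite mulr_ge0.
  have := ler_wpM2l H0 half; lra.
(* The finer cell costs 2, the coarser one 2 for its own cuts and 4 for the later ones, hence 8. *)
apply: (@le_trans _ _ (2 * (cutd x y * L) + (2 * (cutd x y * L) + 4 * (cutd x y * L)))).
  rewrite e1; apply: lerD; first by rewrite ler_wpM2l.
  apply: lerD; first by apply: le_trans e2 _; rewrite ler_wpM2l.
  by apply: le_trans e3 _; rewrite !ler_wpM2l.
by rewrite -/L; lra.
Qed.

End Potential.

(** * Sampling one cell of a partition *)

Section RealFacts.
Variable R : realType.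

(* The probability that two independent bits with means p and q differ. *)
Definition phi (p q : R) := p * (1 - q) + q * (1 - p).

Lemma phi_bounds (p q : R) : 0 <= p <= 1 -> 0 <= q <= 1 -> 0 <= phi p q <= 1.
Proof.
move=> /andP[p0 p1] /andP[q0 q1]; rewrite /phi.
have h1 : 0 <= p * (1 - q) by rewrite mulr_ge0 // subr_ge0.
have h2 : 0 <= q * (1 - p) by rewrite mulr_ge0 // subr_ge0.
have h3 : 0 <= p * q by rewrite mulr_ge0.
have h4 : 0 <= (1 - p) * (1 - q) by rewrite mulr_ge0 // subr_ge0.
by apply/andP; split; nra.
Qed.

Lemma phi_lipschitz (p q p' q' : R) : 0 <= p' <= 1 -> 0 <= q <= 1 ->
  phi p' q' <= phi p q + `|p' - p| + `|q' - q|.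
Proof.
move=> /andP[p0 p1] /andP[q0 q1].
have e : phi p' q' - phi p q = (p' - p) * (1 - 2 * q) + (q' - q) * (1 - 2 * p').
  by rewrite /phi; ring.
have b1 : (p' - p) * (1 - 2 * q) <= `|p' - p|.
  apply: le_trans (ler_norm _) _; rewrite normrM ler_piMr //.
  by rewrite ler_norml; apply/andP; split; lra.
have b2 : (q' - q) * (1 - 2 * p') <= `|q' - q|.
  apply: le_trans (ler_norm _) _; rewrite normrM ler_piMr //.
  by rewrite ler_norml; apply/andP; split; lra.
lra.
Qed.

(** Adding [m] strangers to a population of size [b] moves a proportion by at most the share of the
    strangers. *)
Lemma ratio_perturb (a b d m : R) : 0 <= a <= b -> 0 < b -> 0 <= d <= m ->
  `|(a + d) / (b + m) - a / b| <= m / (b + m).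
Proof.
move=> /andP[a0 ab] b0 /andP[d0 dm].
have bm : 0 < b + m by lra.
have -> : (a + d) / (b + m) - a / b = (d * b - a * m) / b / (b + m).
  by field; rewrite !lt0r_neq0.
rewrite normrM (ger0_norm (x := (b + m)^-1)) ?invr_ge0 ?(ltW bm) //.
rewrite ler_wpM2r ?invr_ge0 ?(ltW bm) // normrM normfV (gtr0_norm b0).
rewrite ler_pdivrMr // ler_norml.
have h1 : 0 <= (m - d) * b by rewrite mulr_ge0 ?(ltW b0) // subr_ge0.
have h2 : 0 <= m * (b - a) by rewrite mulr_ge0 ?subr_ge0 // (le_trans d0).
have h3 : 0 <= d * b by rewrite mulr_ge0 // ltW.
have h4 : 0 <= a * m by rewrite mulr_ge0 // (le_trans d0).
by apply/andP; split; nra.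
Qed.

Lemma pow2_class B (x : R) : x < 2 -> 1 <= 2 ^+ B * x ->
  exists a, (a < B.+1)%N /\ 2^-1 ^+ a <= x < 2 * 2^-1 ^+ a.
Proof.
elim: B x => [|B IH] x x2 Bx.
  by exists 0%N; rewrite expr0 in Bx *; split=> //; lra.
have [x1|x1] := leP 1 x; first by exists 0%N; rewrite expr0; split=> //; lra.
have [||a [aB /andP[h1 h2]]] := IH (2 * x); first lra.
  by rewrite mulrA -exprSr.
exists a.+1; split=> //; rewrite exprS; apply/andP; split; lra.
Qed.

(** Halving leaves a window of ratio 2^k after at most k + 1 terms; this bounds the number of rates
    at which one cell can be observed. *)
Lemma pow2_count B k (K y : R) : 0 < y ->
  \sum_(0 <= a < B) (y <= 2^-1 ^+ a * K <= 2 ^+ k * y)%R%:R <= k.+1%:R :> R.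
Proof.
move=> y0; elim: B K => [|B IH] K; first by rewrite big_geq.
have [/andP[h1 h2]|h] := boolP (y <= 2^-1 ^+ 0 * K <= 2 ^+ k * y); last first.
  rewrite big_nat_recl // (negPf h) add0r.
  apply: le_trans (IH (2^-1 * K)); apply: ler_sum => a _.
  by rewrite exprSr -mulrA.
rewrite expr0 mul1r in h1 h2.
apply: (@le_trans _ _ (\sum_(0 <= a < B.+1) (a < k.+1)%N%:R)).
  rewrite big_nat [leRHS]big_nat; apply: ler_sum => a _.
  rewrite ler_nat; case: (ltnP a k.+1) => ka; first exact: leq_b1.
  suff -> : (y <= 2^-1 ^+ a * K) = false by [].
  apply/negbTE; rewrite -ltNge; apply: (@le_lt_trans _ _ (2^-1 ^+ k.+1 * (2 ^+ k * y))).
    apply: ler_pM; rewrite ?exprn_ge0 ?invr_ge0 //; first by rewrite (le_trans _ h1) // ltW.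
    by rewrite ler_wiXn2l // ?invr_ge0 //; lra.
  rewrite exprS mulrA -[_ * 2 ^+ k]mulrA -exprMn mulVf ?pnatr_eq0 // expr1n mulr1; lra.
rewrite -natr_sum ler_nat.
suff -> : (\sum_(0 <= a < B.+1) (a < k.+1) = minn B.+1 k.+1)%N by exact: geq_minr.
elim: (B.+1) => [|b IHb]; first by rewrite big_geq // min0n.
by rewrite big_nat_recr //= IHb; case: (ltnP b k.+1) => /=; lia.
Qed.

End RealFacts.

(** * One sample, for fixed sets of sampled parents and cells *)

Section Sampling.
Variables (R : realType) (n : nat) (Id : finType).
Variables (f : token n -> Id) (g : Id -> Id) (e : pred (token n)).

Definition fib u : pred (token n) := [pred x | f x == u].
Definition pfib v : pred (token n) := [pred x | g (f x) == v].
Definition imb u : R := \sum_(x | fib u x) side R x.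

Definition frac (P : pred (token n)) : R := avg P (fun x => (e x)%:R).
Definition ephi u : R := phi (frac (pfib (g u))) (frac (fib u)).

Definition samp1 (S1 : pred Id) : pred (token n) := [pred x | S1 (g (f x))].
Definition samp2 (S1 S2 : pred Id) : pred (token n) :=
  [pred x | S1 (g (f x)) && S2 (f x)].

(* S1 samples parent cells and S2 samples cells. When the two tests succeed, the
   sample typically consists of the tokens of one cell u and of its parent, up
   to a small proportion; M is then the imbalance of u, and P1 / N1 and P2 / N2
   are the proportions of tokens satisfying e in its parent and in u. *)
Definition zval (t h N1 P1 N2 P2 M : R) : R :=
  if (t <= N1 <= 4 * t) && (h <= `|M| <= 8 * h)
  then `|M| * phi (P1 / N1) (P2 / N2) else 0.

Definition zsamp (t h : R) (S1 S2 : pred Id) : R :=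
  zval t h #|samp1 S1|%:R #|[predI samp1 S1 & e]|%:R
    #|samp2 S1 S2|%:R #|[predI samp2 S1 S2 & e]|%:R
    (\sum_(x | samp2 S1 S2 x) side R x).

Lemma frac_bounds P : (0 : R) <= frac P <= (1 : R).
Proof.
rewrite avg_ge0 //=; case: (pickP P) => [x Px|P0].
  by rewrite -(avg_const (1 : R) Px); apply: ler_avg => z _; case: (e z).
by rewrite /frac /avg big_pred0 // mul0r.
Qed.

Lemma fracE P : frac P = #|[predI P & e]|%:R / #|P|%:R.
Proof.
rewrite /frac /avg; congr (_ / _).
rewrite -sum1_card natr_sum big_mkcond [RHS]big_mkcond; apply: eq_bigr => x _.
by rewrite inE /= !unfold_in; case: (P x) => //; case: (e x).
Qed.

Lemma zsamp_ge0 t h S1 S2 : 0 <= zsamp t h S1 S2.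
Proof.
rewrite /zsamp /zval; case: ifP => // _; rewrite mulr_ge0 // -!fracE.
by have /andP[] := phi_bounds (frac_bounds (samp1 S1)) (frac_bounds (samp2 S1 S2)).
Qed.

Lemma zsamp_le t h S1 S2 : 0 <= h -> zsamp t h S1 S2 <= 8 * h.
Proof.
move=> h0; rewrite /zsamp /zval; case: ifP => [/andP[_ /andP[_ m8]]|_]; last first.
  by rewrite mulr_ge0.
apply: le_trans m8; rewrite ler_piMr // -!fracE.
by have /andP[] := phi_bounds (frac_bounds (samp1 S1)) (frac_bounds (samp2 S1 S2)).
Qed.

(** Imbalances are integers; the lower bound on the nonzero ones is what lets finitely many sampling
    rates cover all cells. *)
Lemma imb_cases u : imb u = 0 \/ 1 <= `|imb u|.
Proof.
have -> : imb u = (\sum_(x | fib u x) (if x.1 then 1 else -1 : int))%:~R.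
  rewrite (big_morph intr (rmorphD _) (rmorph0 _)); apply: eq_bigr => x _.
  by rewrite /side; case: x.1.
set z := (\sum_(x | _) _); have [->|z0] := eqVneq z 0; first by left.
by right; rewrite -intr_norm -[1]/(1%:~R) ler_int -gtz0_ge1 normr_gt0.
Qed.

Lemma norm_sum_side (P : pred (token n)) : `|\sum_(x | P x) side R x| <= #|P|%:R.
Proof.
apply: le_trans (ler_norm_sum _ _ _) _; rewrite -sum1_card natr_sum.
by apply: ler_sum => x _; rewrite /side; case: x.1; rewrite ?normrN normr1.
Qed.

Definition noise1 S1 u : pred (token n) := [pred x | samp1 S1 x && (g (f x) != g u)].
Definition noise2 S1 S2 u : pred (token n) := [pred x | samp2 S1 S2 x && (f x != u)].

Section Fixed.
Variables (t h eta : R) (S1 S2 : pred Id).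
Hypotheses (t0 : 0 < t) (h0 : 0 < h) (eta0 : 0 < eta) (eta1 : eta <= 2^-1).

Let N1 : R := #|samp1 S1|%:R.
Let N2 : R := #|samp2 S1 S2|%:R.
Let M : R := \sum_(x | samp2 S1 S2 x) side R x.
Let m1 u : R := #|noise1 S1 u|%:R.
Let m2 u : R := #|noise2 S1 S2 u|%:R.
Let nv u : R := #|pfib (g u)|%:R.
Let nu u : R := #|fib u|%:R.

Lemma card_predID (P Q : pred (token n)) :
  #|P|%:R = #|[pred x | P x && Q x]|%:R + #|[pred x | P x && ~~ Q x]|%:R :> R.
Proof.
rewrite -natrD; congr _%:R; rewrite -(cardID Q P); congr (_ + _)%N.
by apply: eq_card => x; rewrite !inE andbC.
Qed.

Section Hit.
Variable u : Id.
Hypotheses (uS1 : S1 (g u)) (uS2 : S2 u).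

Lemma N1E : N1 = nv u + m1 u.
Proof.
rewrite /N1 (card_predID _ (fun x => g (f x) == g u)); congr (_%:R + _%:R).
by apply: eq_card => x; rewrite !inE /samp1 /samp2 /pfib /fib /=; case: eqP => [->|]; rewrite ?uS1 ?andbF.
Qed.

Lemma N2E : N2 = nu u + m2 u.
Proof.
rewrite /N2 (card_predID _ (fun x => f x == u)); congr (_%:R + _%:R).
by apply: eq_card => x; rewrite !inE /samp1 /samp2 /pfib /fib /=; case: eqP => [->|]; rewrite ?uS1 ?uS2 ?andbF.
Qed.

Lemma ME : `|M - imb u| <= m2 u.
Proof.
rewrite /M (bigID (fun x => f x == u)) /= (eq_bigl (fib u)); last first.
  by move=> x; rewrite /samp2 /fib /=; case: eqP => [->|]; rewrite ?uS1 ?uS2 ?andbF.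
by rewrite -/(imb u) addrAC subrr add0r; exact: (norm_sum_side (noise2 S1 S2 u)).
Qed.

Hypothesis nu0 : 0 < nu u.

Lemma nv_gt0 : 0 < nv u.
Proof.
move: nu0; rewrite /nu /nv !ltr0n => /card_gt0P[x]; rewrite inE => /eqP xu.
by apply/card_gt0P; exists x; rewrite inE xu.
Qed.

Lemma frac_samp1 : `|frac (samp1 S1) - frac (pfib (g u))| <= m1 u / N1.
Proof.
have nvp := nv_gt0.
have P1E : #|[predI samp1 S1 & e]|%:R = #|[predI pfib (g u) & e]|%:R +
    #|[pred x | noise1 S1 u x && e x]|%:R :> R.
  rewrite (card_predID _ (fun x => g (f x) == g u)); congr (_%:R + _%:R);
  apply: eq_card => x; rewrite !inE /noise1 /samp1 /pfib /= !unfold_in;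
  by case: eqP => [->|_]; rewrite ?uS1; case: (e x); rewrite /= ?andbT ?andbF.
rewrite !fracE P1E -/N1 N1E; apply: ratio_perturb => //.
  by rewrite ler0n /= ler_nat; apply: subset_leq_card; apply/subsetP => x /andP[].
by rewrite ler0n /= ler_nat; apply: subset_leq_card; apply/subsetP => x /andP[].
Qed.

Lemma frac_samp2 : `|frac (samp2 S1 S2) - frac (fib u)| <= m2 u / N2.
Proof.
have P2E : #|[predI samp2 S1 S2 & e]|%:R = #|[predI fib u & e]|%:R +
    #|[pred x | noise2 S1 S2 u x && e x]|%:R :> R.
  rewrite (card_predID _ (fun x => f x == u)); congr (_%:R + _%:R);
  apply: eq_card => x; rewrite !inE /noise2 /samp2 /fib /= !unfold_in;
  by case: eqP => [->|_]; rewrite ?uS1 ?uS2; case: (e x); rewrite /= ?andbT ?andbF.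
rewrite !fracE P2E -/N2 N2E; apply: ratio_perturb => //.
  by rewrite ler0n /= ler_nat; apply: subset_leq_card; apply/subsetP => x /andP[].
by rewrite ler0n /= ler_nat; apply: subset_leq_card; apply/subsetP => x /andP[].
Qed.

End Hit.

Definition hit u := S1 (g u) && S2 u.
Definition quiet u := (m1 u <= eta * t) && (m2 u <= eta * h).
(** For a sampled quiet cell, where the noise is at most [t / 2] and [h / 2], these windows imply
    the tests of [zval], and the tests imply the wider windows of [near]. *)
Definition class u := (t <= nv u < 2 * t) && (2 * h <= `|imb u| < 4 * h).
Definition near u := (2^-1 * t <= nv u <= 4 * t) && (2^-1 * h <= `|imb u| <= 9 * h).
(** Linear in the noise and at least 1 when the cell is not quiet, so that first moments of the
    noise suffice. *)
Definition loss u : R := m1 u / (eta * t) + m2 u / (eta * h).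

Let et0 : 0 < eta * t. Proof. exact: mulr_gt0. Qed.
Let eh0 : 0 < eta * h. Proof. exact: mulr_gt0. Qed.

Lemma m1_ge0 u : 0 <= m1 u. Proof. exact: ler0n. Qed.

Lemma ephi_bounds u : (0 : R) <= ephi u <= (1 : R).
Proof. by apply: phi_bounds; exact: frac_bounds. Qed.

Lemma loss_ge0 u : 0 <= loss u.
Proof. by rewrite addr_ge0 // divr_ge0 ?ler0n // ltW. Qed.

Lemma not_quiet_loss u : ~~ quiet u -> (1 : R) <= loss u.
Proof.
have l1 : 0 <= m1 u / (eta * t) by rewrite divr_ge0 ?ler0n // ltW.
have l2 : 0 <= m2 u / (eta * h) by rewrite divr_ge0 ?ler0n // ltW.
rewrite negb_and -!ltNge => /orP[] lt1.
  by rewrite -[1]addr0 lerD // ler_pdivlMr // mul1r ltW.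
by rewrite -[1]add0r lerD // ler_pdivlMr // mul1r ltW.
Qed.

Lemma imb_le_nu u : `|imb u| <= nu u.
Proof. exact: norm_sum_side. Qed.

Lemma N2_ge : `|M| <= N2.
Proof. exact: norm_sum_side. Qed.

Lemma quiet_phi u : hit u -> 0 < nu u -> quiet u -> t <= N1 -> h <= N2 ->
  `|frac (samp1 S1) - frac (pfib (g u))| + `|frac (samp2 S1 S2) - frac (fib u)|
    <= 2 * eta.
Proof.
move=> /andP[h1 h2] nu0 /andP[q1 q2] tN hN.
have N1p : 0 < N1 by exact: lt_le_trans tN.
have N2p : 0 < N2 by exact: lt_le_trans hN.
have b1 : m1 u / N1 <= eta.
  by rewrite ler_pdivrMr // (le_trans q1) // ler_wpM2l // ltW.
have b2 : m2 u / N2 <= eta.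
  by rewrite ler_pdivrMr // (le_trans q2) // ler_wpM2l // ltW.
have := frac_samp1 h1 nu0; have := frac_samp2 h1 h2 nu0; lra.
Qed.

Lemma zsamp_quiet u : hit u -> class u -> quiet u ->
  `|imb u| / 2 * (ephi u - 2 * eta) <= zsamp t h S1 S2.
Proof.
move=> hu /andP[/andP[c1 c2] /andP[c3 c4]] qu; have /andP[q1 q2] := qu.
have /andP[h1 h2] := hu.
have nu0 : 0 < nu u by apply: lt_le_trans (imb_le_nu u); lra.
have M1 := ME h1 h2; have n1 := N1E h1.
have et : eta * t <= 2^-1 * t by rewrite ler_wpM2r // ltW.
have eh : eta * h <= 2^-1 * h by rewrite ler_wpM2r // ltW.
have Mlo : `|imb u| - m2 u <= `|M|.
  have := ler_normD (imb u - M) M; rewrite subrK distrC; lra.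
have Mhi : `|M| <= `|imb u| + m2 u.
  have := ler_normD (M - imb u) (imb u); rewrite subrK; lra.
have m10 := m1_ge0 u.
have tN1 : t <= N1 <= 4 * t by apply/andP; split; lra.
have hM : h <= `|M| <= 8 * h by apply/andP; split; lra.
rewrite /zsamp /zval -/N1 -/M tN1 hM /= -!fracE.
have pf1 := frac_bounds (samp1 S1); have pf2 := frac_bounds (samp2 S1 S2).
have /andP[ph0 ph1] := phi_bounds pf1 pf2.
have [neg|pos] := lerP (ephi u - 2 * eta) 0.
  by apply: (@le_trans _ _ 0); [rewrite mulr_ge0_le0 // divr_ge0|rewrite mulr_ge0].
apply: ler_pM; [by rewrite divr_ge0|exact: ltW|lra|].
have tN : t <= N1 by case/andP: tN1.
have hN : h <= N2 by apply: le_trans N2_ge; case/andP: hM.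
have := quiet_phi hu nu0 qu tN hN.
have := phi_lipschitz (frac (samp1 S1)) (frac (fib u)) (frac_bounds (pfib (g u))) pf2.
rewrite (distrC (frac (pfib _))) (distrC (frac (fib _))) /ephi; lra.
Qed.

(** A second sampled cell in the class would count as noise of at least [2 * h] tokens, against the
    [h / 2] that quietness allows. *)
Lemma quiet_unique u u' : hit u -> hit u' -> quiet u -> class u' -> u = u'.
Proof.
move=> hu /andP[h1 h2] /andP[_ q2] /andP[_ /andP[c3 _]].
apply/eqP/negPn/negP => uu'.
have : nu u' <= m2 u.
  rewrite ler_nat; apply: subset_leq_card; apply/subsetP => x.
  by rewrite !inE /samp2 /= => /eqP ->; rewrite h1 h2 eq_sym uu'.
move=> l1; have l2 := imb_le_nu u'.
have l3 : eta * h <= 2^-1 * h by rewrite ler_wpM2r // ltW.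
have l4 := le_trans c3 (le_trans l2 (le_trans l1 (le_trans q2 l3))).
suff : h <= 0 by rewrite leNgt h0.
lra.
Qed.

(** At most one sampled cell of the class is quiet, and [zsamp_quiet] covers it; for the other
    sampled cells the loss makes the term nonpositive. *)
Lemma zsamp_lower (Q : pred Id) :
  \sum_(u | class u && Q u) `|imb u| / 2 * ((hit u)%:R * (ephi u - 2 * eta - loss u))
    <= zsamp t h S1 S2.
Proof.
have term u : ~~ (hit u && quiet u) ->
    `|imb u| / 2 * ((hit u)%:R * (ephi u - 2 * eta - loss u)) <= 0.
  rewrite negb_and; case: (boolP (hit u)) => [_|_ _] /=; last by rewrite mul0r mulr0.
  move=> /not_quiet_loss l1; rewrite mul1r mulr_ge0_le0 ?divr_ge0 //.
  have /andP[_ e1] := ephi_bounds u.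
have ep := eta0; lra.

have [/existsP[u0 /and4P[c0 Q0 h0' q0]]|no] :=
    boolP [exists u, [&& class u, Q u, hit u & quiet u]]; last first.
  apply: le_trans (zsamp_ge0 _ _ _ _); apply: sumr_le0 => u /andP[cu Qu]; apply: term.
  by apply: contra no => /andP[hu qu]; apply/existsP; exists u; rewrite cu Qu hu qu.
rewrite (bigD1 u0) /= ?c0 // -[leRHS]addr0; apply: lerD.
  apply: le_trans (zsamp_quiet h0' c0 q0); rewrite h0' mul1r.
  by rewrite ler_wpM2l ?divr_ge0 // gerBl; exact: loss_ge0.
apply: sumr_le0 => u /andP[/andP[cu _] nu0]; apply: term; apply: contraNN nu0 => /andP[hu qu].
by rewrite (quiet_unique h0' hu q0 cu).
Qed.

(** The observed imbalance is at most the sum over the sampled cells. A quiet cell is near, and its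
    observed parity probability is off by at most [2 * eta]; for a noisy one the loss exceeds the
    trivial bound 1. The test on [nv] is kept because the mean of the second noise is small only
    when the parent is not too large. *)
Lemma zsamp_upper :
  zsamp t h S1 S2 <= \sum_u `|imb u| * ((hit u)%:R *
    ((near u)%:R * (ephi u + 2 * eta) +
     (m1 u / (eta * t) + (nv u <= 4 * t)%R%:R * (m2 u / (eta * h))))).
Proof.
have l1 u : 0 <= m1 u / (eta * t) by rewrite divr_ge0 ?ler0n // ltW.
have l2 u : 0 <= m2 u / (eta * h) by rewrite divr_ge0 ?ler0n // ltW.
have ne0 u : 0 <= (near u)%:R * (ephi u + 2 * eta).
  by rewrite mulr_ge0 // addr_ge0 ?mulr_ge0 ?(ltW eta0) //; have /andP[] := ephi_bounds u.
rewrite /zsamp /zval -/N1 -/M -!fracE; case: ifP => [/andP[/andP[tN N4] /andP[hM M8]]|_]; last first.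
  by apply: sumr_ge0 => u _; rewrite !mulr_ge0 // !addr_ge0 // mulr_ge0.
have pf1 := frac_bounds (samp1 S1); have pf2 := frac_bounds (samp2 S1 S2).
have /andP[ph0 ph1] := phi_bounds pf1 pf2.
apply: (@le_trans _ _ ((\sum_u `|imb u| * (hit u)%:R) *
    phi (frac (samp1 S1)) (frac (samp2 S1 S2)))).
  rewrite ler_wpM2r // /M (partition_big f predT) //=.
  apply: le_trans (ler_norm_sum _ _ _) _; apply: ler_sum => u _.
  rewrite /hit; case: (boolP (S1 (g u) && S2 u)) => hu.
    rewrite mulr1 /imb (eq_bigl (fib u)) // => x; rewrite /samp2 /fib /=.
    by case: eqP => [->|]; rewrite ?hu ?andbF.
  rewrite mulr0 big_pred0 ?normr0 // => x; rewrite /samp2 /=.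
  by case: eqP => [->|]; rewrite ?(negPf hu) ?andbF.
rewrite mulr_suml; apply: ler_sum => u _; rewrite -mulrA ler_wpM2l //.
case: (boolP (hit u)) => hu; last by rewrite !mul0r.
have /andP[h1 h2] := hu; rewrite !mul1r.
have hp := h0; have tp := t0; have ep := eta0.
have n1 := N1E h1; have m10 := m1_ge0 u.
have nv4 : nv u <= 4 * t by lra.
rewrite nv4 mul1r -/(loss u).
have [qu|nq] := boolP (quiet u); last first.
  by apply: le_trans ph1 _; apply: le_trans (not_quiet_loss nq) _; rewrite lerDr.
have /andP[q1 q2] := qu.
have et : eta * t <= 2^-1 * t by rewrite ler_wpM2r // ltW.
have eh : eta * h <= 2^-1 * h by rewrite ler_wpM2r // ltW.
have M1 := ME h1 h2.
have Mlo : `|M| <= `|imb u| + m2 u.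
  have := ler_normD (M - imb u) (imb u); rewrite subrK; lra.
have Mhi : `|imb u| - m2 u <= `|M|.
  have := ler_normD (imb u - M) M; rewrite subrK distrC; lra.
have nu0 : 0 < nu u by apply: lt_le_trans (imb_le_nu u); lra.
have hN : h <= N2 by apply: le_trans N2_ge.
have -> : near u by rewrite /near; apply/andP; split; apply/andP; split; lra.
have := quiet_phi hu nu0 qu tN hN.
have := phi_lipschitz (frac (pfib (g u))) (frac (samp2 S1 S2)) pf1 (frac_bounds (fib u)).
have := loss_ge0 u; rewrite mul1r /ephi; lra.
Qed.

End Fixed.
End Sampling.

Lemma eq_ler (R : numDomainType) (x y : R) : x = y -> x <= y.
Proof. by move=> ->. Qed.

Definition rate (R : realType) (a : nat) : R := 2^-1 ^+ a.

Lemma rate_gt0 (R : realType) a : 0 < rate R a.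
Proof. by rewrite exprn_gt0 // invr_gt0. Qed.

Lemma rate_ge0 (R : realType) a : 0 <= rate R a.
Proof. exact: ltW (rate_gt0 R a). Qed.

Lemma Ex_ord_lt (R : realType) N k : (0 < N)%N -> (k <= N)%N ->
  Ex (fun i : 'I_N => (i < k)%N%:R) = k%:R / N%:R :> R.
Proof.
move=> N0 kN; rewrite /Ex card_ord -natr_sum; congr (_%:R / _).
rewrite (eq_bigr (fun i : 'I_N => if (i < k)%N then 1%N else 0%N)) => [|i _].
  by rewrite -big_mkcond /= (big_ord_narrow kN) /= sum1_card card_ord.
by case: ifP.
Qed.

(** * Expected noise under independent sampling tables *)

Section ExpectedSample.
Variables (R : realType) (n : nat) (Id : finType).
Variables (f : token n -> Id) (g : Id -> Id) (e : pred (token n)).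
Variable B : nat.

Definition table : finType := {ffun Id -> 'I_(2 ^ B)}.
(** One uniform table realises every rate 2^-a with [a <= B], with full independence between
    cells. *)
Definition chosen (a : nat) (h : table) : pred Id := fun v => (h v < 2 ^ (B - a))%N.

Local Notation q := (rate R).

Lemma Ex_chosen a : (a <= B)%N ->
  Ex (fun k : 'I_(2 ^ B) => (k < 2 ^ (B - a))%N%:R) = q a.
Proof.
move=> aB; rewrite Ex_ord_lt ?expn_gt0 ?leq_pexp2l ?leq_subr //.
rewrite -{2}(subnK aB) expnD natrM !natrX /rate invfM mulrA mulfV ?mul1r ?exprVn //.
by rewrite expf_neq0 ?pnatr_eq0.
Qed.

Let I0 : (0 < #|'I_(2 ^ B)|)%N. Proof. by rewrite card_ord expn_gt0. Qed.

Lemma Ex_chosen1 a v : (a <= B)%N ->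
  Ex (fun h : table => (chosen a h v)%:R) = q a.
Proof.
move=> aB; rewrite (Ex_ffun1 v (fun k : 'I_(2 ^ B) => (k < 2 ^ (B - a))%N%:R)) //.
exact: Ex_chosen.
Qed.

Lemma Ex_chosen2 a v w : (a <= B)%N ->
  Ex (fun h : table => (chosen a h v)%:R * (chosen a h w)%:R) =
  if v == w then q a else q a ^+ 2.
Proof.
move=> aB; have [<-|vw] := eqVneq v w.
  rewrite -(Ex_chosen1 v aB); apply: eq_Ex => h.
  by case: (chosen a h v); rewrite ?mulr1 ?mulr0.
pose F (k : 'I_(2 ^ B)) : R := (k < 2 ^ (B - a))%N%:R.
by rewrite (Ex_ffun2 F F) // expr2 /F Ex_chosen.
Qed.

Definition Ex2 (F : table -> table -> R) := Ex (fun h1 => Ex (fun h2 => F h1 h2)).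

Lemma ler_Ex2 F F' : (forall h1 h2, F h1 h2 <= F' h1 h2) -> Ex2 F <= Ex2 F'.
Proof. by move=> FF; apply: ler_Ex => h1; apply: ler_Ex => h2. Qed.

Lemma eq_Ex2 F F' : (forall h1 h2, F h1 h2 = F' h1 h2) -> Ex2 F = Ex2 F'.
Proof. by move=> FF; apply: eq_Ex => h1; apply: eq_Ex => h2. Qed.

Lemma Ex2_sum (I : finType) (P : pred I) (F : I -> table -> table -> R) :
  Ex2 (fun h1 h2 => \sum_(i | P i) F i h1 h2) = \sum_(i | P i) Ex2 (F i).
Proof. by rewrite -Ex_sum; apply: eq_Ex => h1; rewrite Ex_sum. Qed.

Lemma Ex2_prod (F1 F2 : table -> R) :
  Ex2 (fun h1 h2 => F1 h1 * F2 h2) = Ex F1 * Ex F2.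
Proof. by rewrite mulrC -ExZ; apply: eq_Ex => h1; rewrite ExZ mulrC. Qed.

Lemma Ex2D F F' : Ex2 (fun h1 h2 => F h1 h2 + F' h1 h2) = Ex2 F + Ex2 F'.
Proof. by rewrite -ExD; apply: eq_Ex => h1; rewrite ExD. Qed.

Lemma Ex2Z c F : Ex2 (fun h1 h2 => c * F h1 h2) = c * Ex2 F.
Proof. by rewrite -ExZ; apply: eq_Ex => h1; rewrite ExZ. Qed.

Section Rates.
Variables a b : nat.
Hypotheses (aB : (a <= B)%N) (bB : (b <= B)%N).

Local Notation hitr h1 h2 u := ((hit g (chosen a h1) (chosen b h2) u)%:R : R).

Lemma Ex2_hit u : Ex2 (fun h1 h2 => hitr h1 h2 u) = q a * q b.
Proof.
rewrite -(Ex_chosen1 (g u) aB) -(Ex_chosen1 u bB) -Ex2_prod.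
by apply: eq_Ex2 => h1 h2; rewrite -natrM mulnb.
Qed.

Lemma Ex2_noise1 u :
  Ex2 (fun h1 h2 => hitr h1 h2 u * #|noise1 f g (chosen a h1) u|%:R) <=
  q a * q b * (q a * #|token n|%:R).
Proof.
have -> : Ex2 (fun h1 h2 => hitr h1 h2 u * #|noise1 f g (chosen a h1) u|%:R) =
    \sum_x (g (f x) != g u)%:R * (q a ^+ 2 * q b).
  transitivity (Ex2 (fun h1 h2 => \sum_x (g (f x) != g u)%:R *
      (((chosen a h1 (g u))%:R * (chosen a h1 (g (f x)))%:R) * (chosen b h2 u)%:R))).
    apply: eq_Ex2 => h1 h2; rewrite -sum1_card natr_sum big_mkcond mulr_sumr.
    apply: eq_bigr => x _; rewrite unfold_in /noise1 /samp1 /hit /=.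
    by case: (chosen a h1 (g u)); case: (chosen b h2 u);
      case: (chosen a h1 (g (f x))); case: (g (f x) != g u);
      rewrite /= ?(mulr0, mul0r, mulr1, mul1r).
  rewrite Ex2_sum; apply: eq_bigr => x _; rewrite Ex2Z Ex2_prod Ex_chosen1 //.
  have [->|ne] := eqVneq (g (f x)) (g u); first by rewrite !mul0r.
  by rewrite Ex_chosen2 // eq_sym (negPf ne).
have qa0 : 0 <= q a by exact: rate_ge0.
have qb0 : 0 <= q b by exact: rate_ge0.
rewrite -mulr_suml -natr_sum.
apply: (@le_trans _ _ (#|token n|%:R * (q a ^+ 2 * q b))); last by apply: eq_ler; ring.
apply: ler_wpM2r; first by apply: mulr_ge0 => //; exact: exprn_ge0.
rewrite ler_nat -sum1_card; apply: leq_sum => x _; exact: leq_b1.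
Qed.

(** Once [u] and its parent are sampled, other cells of the same parent cost only a factor [q b],
    and cells of other parents cost [q a * q b]. *)
Lemma Ex2_noise2 u :
  Ex2 (fun h1 h2 => hitr h1 h2 u *
    #|noise2 f g (chosen a h1) (chosen b h2) u|%:R) <=
  q a * q b * (q b * (#|pfib f g (g u)|%:R + q a * #|token n|%:R)).
Proof.
have qa0 : 0 <= q a by exact: rate_ge0.
have qb0 : 0 <= q b by exact: rate_ge0.
have -> : Ex2 (fun h1 h2 => hitr h1 h2 u *
    #|noise2 f g (chosen a h1) (chosen b h2) u|%:R) =
    \sum_x (f x != u)%:R * ((if g u == g (f x) then q a else q a ^+ 2) * q b ^+ 2).
  transitivity (Ex2 (fun h1 h2 => \sum_x (f x != u)%:R *
      (((chosen a h1 (g u))%:R * (chosen a h1 (g (f x)))%:R) *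
       ((chosen b h2 u)%:R * (chosen b h2 (f x))%:R)))).
    apply: eq_Ex2 => h1 h2; rewrite -sum1_card natr_sum big_mkcond mulr_sumr.
    apply: eq_bigr => x _; rewrite unfold_in /noise2 /samp2 /hit /=.
    by case: (chosen a h1 (g u)); case: (chosen b h2 u); case: (chosen b h2 (f x));
      case: (chosen a h1 (g (f x))); case: (f x != u);
      rewrite /= ?(mulr0, mul0r, mulr1, mul1r).
  rewrite Ex2_sum; apply: eq_bigr => x _; rewrite Ex2Z Ex2_prod Ex_chosen2 //.
  have [->|ne] := eqVneq (f x) u; first by rewrite !mul0r.
  by rewrite Ex_chosen2 // [u == _]eq_sym (negPf ne).
apply: (@le_trans _ _ (\sum_x ((g (f x) == g u)%:R * (q a * q b ^+ 2) +
    q a ^+ 2 * q b ^+ 2))).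
  apply: ler_sum => x _; rewrite [g u == _]eq_sym.
  have c0 : 0 <= q a * q b ^+ 2 by apply: mulr_ge0 => //; exact: exprn_ge0.
  have d0 : 0 <= q a ^+ 2 * q b ^+ 2 by apply: mulr_ge0; exact: exprn_ge0.
  by case: eqP => _; case: eqP => _; rewrite ?mul0r ?mul1r ?add0r ?addr0 ?lerDl //
    addr_ge0.
rewrite big_split /= -mulr_suml -natr_sum sumr_const -[_ *+ #|_|]mulr_natr.
have -> : (\sum_x (g (f x) == g u) = #|pfib f g (g u)|)%N.
  by rewrite -sum1_card [RHS]big_mkcond; apply: eq_bigr => x _; rewrite inE; case: eqP.
apply: eq_ler; ring.
Qed.

End Rates.
End ExpectedSample.

(** * Summation over the pairs of sampling rates *)

Section Classes.
Variables (R : realType) (n : nat) (Id : finType).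
Variables (f : token n -> Id) (g : Id -> Id) (e : pred (token n)).
Variables (B : nat) (G eta : R).
Hypotheses (n0 : (0 < n)%N) (G1 : 1 <= G) (eta0 : 0 < eta) (eta1 : eta <= 2^-1).

Local Notation q := (rate R).
(** The thresholds exceed the expected noise by the factor [G] up to constants: about [q a * n]
    foreign tokens survive the first sampling, and about [q b * tau a] survive the second below a
    parent of size [tau a]. *)
Definition tau a : R := q a * n%:R * G.
Definition theta a b : R := q a * q b * n%:R * G ^+ 2.

Definition esamp a b : R :=
  Ex2 (fun h1 h2 : table Id B =>
    zsamp f g e (tau a) (theta a b) (chosen a h1) (chosen b h2)) / (q a * q b).

Lemma tau_gt0 a : 0 < tau a.
Proof. by rewrite !mulr_gt0 ?rate_gt0 ?ltr0n // (lt_le_trans _ G1). Qed.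

Lemma theta_gt0 a b : 0 < theta a b.
Proof. by rewrite !mulr_gt0 ?rate_gt0 ?ltr0n ?exprn_gt0 // (lt_le_trans _ G1). Qed.

Lemma tokens : #|token n|%:R = 2 * n%:R :> R.
Proof. by rewrite card_prod card_bool card_ord natrM. Qed.

Section Pair.
Variables a b : nat.
Hypotheses (aB : (a <= B)%N) (bB : (b <= B)%N).

Let hitr (h1 h2 : table Id B) u : R := (hit g (chosen a h1) (chosen b h2) u)%:R.

Let E1 u := Ex2 (fun h1 h2 => hitr h1 h2 u * #|noise1 f g (chosen a h1) u|%:R).
Let E2 u := Ex2 (fun h1 h2 => hitr h1 h2 u *
    #|noise2 f g (chosen a h1) (chosen b h2) u|%:R).

Lemma noise1_bound u : E1 u / (eta * tau a) <= q a * q b * (2 / (eta * G)).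
Proof.
have qa := rate_gt0 R a; have qb := rate_gt0 R b.
have nR : 0 < n%:R :> R by rewrite ltr0n.
have Gp : 0 < G by exact: lt_le_trans G1.
rewrite ler_pdivrMr ?mulr_gt0 ?tau_gt0 //.
apply: le_trans (Ex2_noise1 R f g aB bB u) _; rewrite tokens.
by apply: eq_ler; rewrite /tau; field; rewrite !lt0r_neq0.
Qed.

Lemma noise2_bound u : #|pfib f g (g u)|%:R <= 4 * tau a ->
  E2 u / (eta * theta a b) <= q a * q b * (6 / (eta * G)).
Proof.
move=> nv; have qa := rate_gt0 R a; have qb := rate_gt0 R b.
have nR : 0 < n%:R :> R by rewrite ltr0n.
have Gp : 0 < G by exact: lt_le_trans G1.
have ep := eta0; have gp := G1.
rewrite ler_pdivrMr ?mulr_gt0 ?theta_gt0 //.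
apply: le_trans (Ex2_noise2 R f g aB bB u) _; rewrite tokens.
apply: (@le_trans _ _ (q a * q b * (q b * (4 * tau a + q a * (2 * n%:R))))).
  by rewrite ler_pM2l ?mulr_gt0 // ler_pM2l // lerD2r.
rewrite -[leRHS]mulrA ler_pM2l ?mulr_gt0 //.
have -> : 6 / (eta * G) * (eta * theta a b) = q b * (6 * (q a * n%:R * G)).
  by rewrite /theta; field; rewrite !lt0r_neq0.
rewrite ler_pM2l // /tau.
have : 0 <= q a * n%:R * (G - 1) by rewrite !mulr_ge0 ?subr_ge0 // ltW.
lra.
Qed.

(** [Q] will select the nonnegative terms, so that it is enough to exhibit one class for each
    cell. *)
Lemma esamp_lower (Q : pred Id) :
  \sum_(u | class f g (tau a) (theta a b) u && Q u)
    `|imb R f u| / 2 * (ephi R f g e u - 2 * eta - 8 / (eta * G)) <= esamp a b.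
Proof.
have qa := rate_gt0 R a; have qb := rate_gt0 R b.
rewrite /esamp ler_pdivlMr ?mulr_gt0 //.
apply: (@le_trans _ _ (Ex2 (fun h1 h2 : table Id B =>
  \sum_(u | class f g (tau a) (theta a b) u && Q u) `|imb R f u| / 2 *
   (hitr h1 h2 u * (ephi R f g e u - 2 * eta -
      loss f g (tau a) (theta a b) eta (chosen a h1) (chosen b h2) u))))); last first.
  by apply: ler_Ex2 => h1 h2; apply: zsamp_lower => //; rewrite ?tau_gt0 ?theta_gt0.
rewrite Ex2_sum mulr_suml; apply: ler_sum => u /andP[/andP[/andP[_ c2] _] _].
rewrite Ex2Z -[leLHS]mulrA; apply: ler_wpM2l; first by rewrite divr_ge0.
have -> : Ex2 (fun h1 h2 => hitr h1 h2 u * (ephi R f g e u - 2 * eta -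
      loss f g (tau a) (theta a b) eta (chosen a h1) (chosen b h2) u)) =
    (ephi R f g e u - 2 * eta) * (q a * q b) -
    (E1 u / (eta * tau a) + E2 u / (eta * theta a b)).
  rewrite -(Ex2_hit R g aB bB u) -Ex2Z !(mulrC (Ex2 _)) -!Ex2Z -Ex2D.
  rewrite -[- Ex2 _]mulN1r -Ex2Z -Ex2D.
  by apply: eq_Ex2 => h1 h2; rewrite /loss -/(hitr h1 h2 u); ring.
have := noise1_bound u; have := noise2_bound (u := u).
have tp := tau_gt0 a.
have -> : #|pfib f g (g u)|%:R <= 4 * tau a by lra.
move=> /(_ isT) b2 b1.
have -> : (ephi R f g e u - 2 * eta - 8 / (eta * G)) * (q a * q b) =
   (ephi R f g e u - 2 * eta) * (q a * q b) - (q a * q b * (2 / (eta * G)) +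
   q a * q b * (6 / (eta * G))).
  by set x := (eta * G)^-1; ring.
by rewrite lerD2l lerN2 lerD.
Qed.

Lemma esamp_upper :
  esamp a b <= \sum_u `|imb R f u| *
    ((near f g (tau a) (theta a b) u)%:R * (ephi R f g e u + 2 * eta) + 8 / (eta * G)).
Proof.
have qa := rate_gt0 R a; have qb := rate_gt0 R b.
rewrite /esamp ler_pdivrMr ?mulr_gt0 //.
apply: (@le_trans _ _ (Ex2 (fun h1 h2 : table Id B =>
  \sum_u `|imb R f u| * (hitr h1 h2 u *
    ((near f g (tau a) (theta a b) u)%:R * (ephi R f g e u + 2 * eta) +
     (#|noise1 f g (chosen a h1) u|%:R / (eta * tau a) +
      (#|pfib f g (g u)|%:R <= 4 * tau a)%R%:R *
      (#|noise2 f g (chosen a h1) (chosen b h2) u|%:R / (eta * theta a b)))))))).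
  by apply: ler_Ex2 => h1 h2; apply: zsamp_upper => //; rewrite ?tau_gt0 ?theta_gt0.
rewrite Ex2_sum mulr_suml; apply: ler_sum => u _.
rewrite Ex2Z -[leRHS]mulrA; apply: ler_wpM2l => //.
set c := (near f g (tau a) (theta a b) u)%:R * _.
set d : R := (_ <= _)%R%:R.
have -> : Ex2 (fun h1 h2 => hitr h1 h2 u * (c +
     (#|noise1 f g (chosen a h1) u|%:R / (eta * tau a) +
      d * (#|noise2 f g (chosen a h1) (chosen b h2) u|%:R / (eta * theta a b))))) =
    c * (q a * q b) + (E1 u / (eta * tau a) + d * (E2 u / (eta * theta a b))).
  have -> : c * (q a * q b) = Ex2 (fun h1 h2 => c * hitr h1 h2 u).
    by rewrite Ex2Z Ex2_hit.
  have -> : E1 u / (eta * tau a) = Ex2 (fun h1 h2 => (eta * tau a)^-1 *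
      (hitr h1 h2 u * #|noise1 f g (chosen a h1) u|%:R)) by rewrite Ex2Z mulrC.
  have -> : d * (E2 u / (eta * theta a b)) = Ex2 (fun h1 h2 => d *
      ((eta * theta a b)^-1 * (hitr h1 h2 u *
        #|noise2 f g (chosen a h1) (chosen b h2) u|%:R))).
    by rewrite !Ex2Z [E2 u / _]mulrC.
  by rewrite -!Ex2D; apply: eq_Ex2 => h1 h2; ring.
have -> : (c + 8 / (eta * G)) * (q a * q b) =
   c * (q a * q b) + (q a * q b * (2 / (eta * G)) + q a * q b * (6 / (eta * G))).
  by set x := (eta * G)^-1; ring.
rewrite lerD2l lerD //; first exact: noise1_bound.
rewrite /d; case: (boolP (#|pfib f g (g u)|%:R <= 4 * tau a)) => h /=; first by rewrite mul1r noise2_bound.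
have Gp : 0 < G by exact: lt_le_trans G1.
by rewrite mul0r !mulr_ge0 ?invr_ge0 ?mulr_ge0 ?rate_ge0 // ltW.
Qed.

End Pair.

Lemma fib_pfib u : (#|fib f u| <= #|pfib f g (g u)|)%N.
Proof.
by apply: subset_leq_card; apply/subsetP => x; rewrite !inE => /eqP ->.
Qed.

Lemma imb_le_pfib u : `|imb R f u| <= #|pfib f g (g u)|%:R.
Proof. by apply: le_trans (norm_sum_side R _) _; rewrite ler_nat fib_pfib. Qed.

Lemma esamp_sum_lower : 1 < G -> 4 * n%:R * G <= 2 ^+ B ->
  2^-1 * \sum_u `|imb R f u| * (ephi R f g e u - 2 * eta - 8 / (eta * G)) <=
  \sum_(0 <= a < B.+1) \sum_(0 <= b < B.+1) esamp a b.
Proof.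
move=> G2 GB; have nR : 0 < n%:R :> R by rewrite ltr0n.
have Gp : 0 < G by exact: lt_le_trans G1.
pose x u : R := `|imb R f u| / 2 * (ephi R f g e u - 2 * eta - 8 / (eta * G)).
pose c a b u := class f g (tau a) (theta a b) u.
apply: (@le_trans _ _ (\sum_(0 <= a < B.+1) \sum_(0 <= b < B.+1)
    \sum_(u | c a b u && (0 <= x u)) x u)); last first.
  rewrite big_nat [leRHS]big_nat; apply: ler_sum => a /andP[_ aB].
  rewrite big_nat [leRHS]big_nat; apply: ler_sum => b /andP[_ bB].
  exact: (esamp_lower aB bB (fun u => 0 <= x u)).
have -> : \sum_(0 <= a < B.+1) \sum_(0 <= b < B.+1) \sum_(u | c a b u && (0 <= x u)) x u =
    \sum_u \sum_(0 <= a < B.+1) \sum_(0 <= b < B.+1)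
      (if c a b u && (0 <= x u) then x u else 0).
  rewrite [RHS]exchange_big; apply: eq_bigr => a _; rewrite [RHS]exchange_big.
  by apply: eq_bigr => b _; rewrite [LHS]big_mkcond.
rewrite mulr_sumr; apply: ler_sum => u _.
have -> : 2^-1 * (`|imb R f u| * (ephi R f g e u - 2 * eta - 8 / (eta * G))) = x u.
  by rewrite /x mulrA [2^-1 * _]mulrC.
have t0 a b : 0 <= (if c a b u && (0 <= x u) then x u else 0).
  by case: ifP => // /andP[].
have [x0|xp] := leP (x u) 0; first by apply: le_trans x0 _; do 2!apply: sumr_ge0 => ? _.
have i0 : imb R f u != 0.
  by apply: contraTneq xp => i0; rewrite /x i0 normr0 !mul0r ltxx.
have i1 : 1 <= `|imb R f u|.
  by case: (imb_cases R f u) => // i1; rewrite i1 eqxx in i0.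
pose nv : R := #|pfib f g (g u)|%:R.
have inv : `|imb R f u| <= nv by exact: imb_le_pfib.
have nv2 : nv <= 2 * n%:R by rewrite -tokens ler_nat max_card.
(* The size of the parent relative to [n * G] selects [a], and then the imbalance relative to
   [2 * tau a * G] selects [b]; integrality and the assumption on [2 ^+ B] put both ratios within
   reach of the available rates. *)
have [||a [aB /andP[a1 a2]]] := @pow2_class R B (nv / (n%:R * G)).
- rewrite ltr_pdivrMr ?mulr_gt0 //; apply: le_lt_trans nv2 _.
  by rewrite ltr_pM2l // ltr_pMr.
- rewrite mulrA ler_pdivlMr ?mulr_gt0 // mul1r.
  apply: (@le_trans _ _ (4 * n%:R * G)); first by rewrite ler_pM2r // ler_peMl // ?ltW //; lra.
  apply: le_trans GB _; rewrite ler_peMr ?exprn_ge0 //; exact: le_trans inv.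
rewrite ler_pdivlMr ?mulr_gt0 // in a1; rewrite ltr_pdivrMr ?mulr_gt0 // in a2.
have ta : tau a <= nv < 2 * tau a.
  by rewrite /tau /rate; apply/andP; split; lra.
have /andP[ta1 ta2] := ta; have tp := tau_gt0 a.
have tG : 0 < 2 * tau a * G by apply: mulr_gt0 => //; apply: mulr_gt0.
have [||b [bB /andP[b1 b2]]] := @pow2_class R B (`|imb R f u| / (2 * tau a * G)).
- rewrite ltr_pdivrMr //; apply: le_lt_trans inv _; apply: lt_trans ta2 _.
  have : 0 < tau a * (G - 1) by rewrite mulr_gt0 // subr_gt0.
  lra.
- rewrite mulrA ler_pdivlMr // mul1r.
  apply: (@le_trans _ _ (4 * n%:R * G)).
    rewrite ler_pM2r //; lra.
  by apply: le_trans GB _; rewrite ler_peMr ?exprn_ge0.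
rewrite ler_pdivlMr // in b1; rewrite ltr_pdivrMr // in b2.
have thE : 2 * theta a b = rate R b * (2 * tau a * G) by rewrite /theta /tau; ring.
have cab : c a b u.
  rewrite /c /class ta /= thE (_ : 4 * theta a b = 2 * (rate R b * (2 * tau a * G))).
    by rewrite /rate; apply/andP; split; lra.
  by rewrite -thE; ring.
rewrite big_mkord (bigD1 (Ordinal aB)) //= -[leLHS]addr0; apply: lerD; last first.
  by do 2!apply: sumr_ge0 => ? _.
rewrite big_mkord (bigD1 (Ordinal bB)) //= -[leLHS]addr0; apply: lerD; last first.
  by apply: sumr_ge0 => ? _.
by rewrite cab (ltW xp).
Qed.

(** 24 = 4 * 6: [near] confines the parent size to a window of ratio 8 = 2^3 and the imbalance to
    one of ratio 18 <= 2^5, hence at most 4 rates [a] and 6 rates [b] per cell. *)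
Lemma esamp_sum_upper :
  \sum_(0 <= a < B.+1) \sum_(0 <= b < B.+1) esamp a b <=
  \sum_u `|imb R f u| *
    (24 * (ephi R f g e u + 2 * eta) + B.+1%:R ^+ 2 * (8 / (eta * G))).
Proof.
have nR : 0 < n%:R :> R by rewrite ltr0n.
have Gp : 0 < G by exact: lt_le_trans G1.
pose c a b u := near f g (tau a) (theta a b) u.
pose y u : R := ephi R f g e u + 2 * eta.
pose k : R := 8 / (eta * G).
apply: (@le_trans _ _ (\sum_(0 <= a < B.+1) \sum_(0 <= b < B.+1)
    \sum_u `|imb R f u| * ((c a b u)%:R * y u + k))).
  rewrite big_nat [leRHS]big_nat; apply: ler_sum => a /andP[_ aB].
  rewrite big_nat [leRHS]big_nat; apply: ler_sum => b /andP[_ bB].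
  exact: esamp_upper.
have -> : \sum_(0 <= a < B.+1) \sum_(0 <= b < B.+1)
    \sum_u `|imb R f u| * ((c a b u)%:R * y u + k) =
  \sum_u `|imb R f u| * \sum_(0 <= a < B.+1) \sum_(0 <= b < B.+1) ((c a b u)%:R * y u + k).
  under [RHS]eq_bigr => u _ do rewrite mulr_sumr.
  rewrite [RHS]exchange_big; apply: eq_bigr => a _.
  under [RHS]eq_bigr => u _ do rewrite mulr_sumr.
  by rewrite [RHS]exchange_big.
apply: ler_sum => u _; have [i0|i1] := imb_cases R f u.
  by rewrite i0 normr0 !mul0r.
apply: ler_wpM2l => //.
have -> : \sum_(0 <= a < B.+1) \sum_(0 <= b < B.+1) ((c a b u)%:R * y u + k) =
    (\sum_(0 <= a < B.+1) \sum_(0 <= b < B.+1) (c a b u)%:R) * y u + B.+1%:R ^+ 2 * k.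
  rewrite mulr_suml; under eq_bigr => a _ do rewrite big_split /= -mulr_suml.
  rewrite big_split /= !sumr_const_nat subn0 -mulrnA -[k *+ _]mulr_natr.
  by rewrite natrM -expr2 [k * _]mulrC.
rewrite lerD2r; apply: ler_wpM2r.
  rewrite addr_ge0 ?mulr_ge0 ?(ltW eta0) //.
  by have /andP[] := @ephi_bounds R n Id f g e u.
pose nv : R := #|pfib f g (g u)|%:R.
have inv : `|imb R f u| <= nv by exact: imb_le_pfib.
have nv0 : 0 < nv by lra.
apply: (@le_trans _ _ (\sum_(0 <= a < B.+1)
    (4^-1 * nv <= 2^-1 ^+ a * (n%:R * G) <= 2 ^+ 3 * (4^-1 * nv))%R%:R * 6%:R)).
  apply: ler_sum => a _; have tp := tau_gt0 a.
  have [/andP[h1 h2]|h] := boolP (4^-1 * nv <= 2^-1 ^+ a * (n%:R * G) <= 2 ^+ 3 * (4^-1 * nv)).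
    rewrite mul1r; apply: le_trans (@pow2_count R B.+1 5 (tau a * G) (9^-1 * `|imb R f u|) _);
      last by rewrite mulr_gt0 ?invr_gt0 //; lra.
    apply: ler_sum => b _; rewrite ler_nat; case: (boolP (c a b u)) => //.
    rewrite /c /near => /andP[_ /andP[m1 m2]].
    have thE : theta a b = 2^-1 ^+ b * (tau a * G) by rewrite /theta /tau /rate; ring.
    rewrite -thE (_ : (_ && _) = true) //; apply/andP; split; lra.
  rewrite mul0r big1 // => b _; rewrite (_ : c a b u = false) //.
  apply: contraNF h; rewrite /c /near => /andP[/andP[m1 m2] _].
  have tE : tau a = 2^-1 ^+ a * (n%:R * G) by rewrite /tau /rate mulrA.
  rewrite -tE -/nv; apply/andP; split; rewrite -/nv in m1 m2; lra.
rewrite -mulr_suml.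
have := @pow2_count R B.+1 3 (n%:R * G) (4^-1 * nv).
move=> /(_ _); rewrite mulr_gt0 ?invr_gt0 // => /(_ isT); lra.
Qed.

End Classes.

(** * Trials *)

Lemma exp_le_inv (R : realType) (x : R) k : 0 <= x <= 1 ->
  (1 - x) ^+ k <= (1 + k%:R * x)^-1.
Proof.
move=> /andP[x0 x1]; elim: k => [|k IH]; first by rewrite expr0 mul0r addr0 invr1.
have k0 : 0 <= k%:R * x by rewrite mulr_ge0.
have a0 : 0 < 1 + k%:R * x by lra.
have b0 : 0 < 1 + k.+1%:R * x by rewrite mulrSr; lra.
rewrite exprS; apply: (@le_trans _ _ ((1 - x) / (1 + k%:R * x))).
  by rewrite ler_wpM2l // subr_ge0.
rewrite ler_pdivrMr // mulrC ler_pdivlMr // mulrSr.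
have : 0 <= k%:R * x * x by rewrite mulr_ge0.
have : 0 <= x * x by rewrite mulr_ge0.
lra.
Qed.

Lemma exp_le_half (R : realType) (x : R) k b : 0 <= x <= 1 -> 1 <= k%:R * x ->
  (1 - x) ^+ (k * b) <= 2^-1 ^+ b.
Proof.
move=> x01 kx; rewrite exprM; apply: lerXn2r; rewrite ?nnegrE.
- by rewrite exprn_ge0 // subr_ge0; case/andP: x01.
- by rewrite invr_ge0.
- apply: le_trans (exp_le_inv k x01) _; rewrite lef_pV2 ?posrE; lra.
Qed.

(** * Parities of independent cuts as truncated distances *)

Section Parity.
Variables (R : realType) (I Cut : finType) (cv : Cut -> I -> bool).
Hypothesis Cut0 : (0 < #|Cut|)%N.

Definition parity (s : seq Cut) (x : I) := foldr addb false [seq cv c x | c <- s].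

Definition pard k x y : R := Eseq k (fun s => (parity s x != parity s y)%:R).

(** The bias 1 - 2 Pr of the exclusive or of independent bits is the product of their biases. *)
Lemma pardE k x y : 1 - 2 * pard k x y = (1 - 2 * cutd R cv x y) ^+ k.
Proof.
elim: k => [|k IH]; first by rewrite /pard /= mulr0 subr0.
have step c : Eseq k (fun s => (parity (c :: s) x != parity (c :: s) y)%:R) =
    (1 - 2 * pard k x y) * (cv c x != cv c y)%:R + pard k x y.
  case: (boolP (cv c x == cv c y)) => [/eqP e|ne] /=.
    rewrite mulr0 add0r; apply: eq_Eseq => s _; rewrite /parity /= e.
    by case: (cv c y); rewrite //= (inj_eq negb_inj).
  rewrite (eq_Eseq (g := fun s => 1 + -1 * (parity s x != parity s y)%:R)).
    by rewrite EseqD Eseq_const // EseqZ -/(pard k x y); ring.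
  move=> s _; rewrite /parity /=; move: ne.
  by case: (cv c x) (cv c y) (foldr _ _ _) (foldr _ _ _) => [] [] [] [] //= _; ring.
have -> : pard k.+1 x y = (1 - 2 * pard k x y) * cutd R cv x y + pard k x y.
  rewrite /pard [LHS]/= (eq_Ex step) ExD ExZ; congr (_ + _); exact: Ex_const.
by rewrite exprS -IH; ring.
Qed.

Lemma pard_le k x y : pard k x y <= k%:R * cutd R cv x y.
Proof.
apply: le_trans (Eseq_separated R _ _ x y k) => //.
apply: ler_Eseq => s _; rewrite ler_nat.
suff : same cv s x y -> parity s x = parity s y.
  by case: (same cv s x y) => [->//|_]; rewrite ?eqxx ?leq_b1.
by rewrite /parity; elim: s => //= c s IH /andP[/eqP -> /IH ->].
Qed.

(** With [cutd] at most 1/2 the bias is nonnegative, and as long as at most one separating cut is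
    expected the parity probability is linear in that expectation up to a constant. *)
Lemma pard_ge k x y : cutd R cv x y <= 2^-1 -> k%:R * cutd R cv x y <= 1 ->
  k%:R * cutd R cv x y / 3 <= pard k x y.
Proof.
move=> d2 kd; have d0 := cutd_ge0 R cv x y; have E := pardE k x y.
have d01 : 0 <= 2 * cutd R cv x y <= 1 by apply/andP; split; lra.
have := exp_le_inv k d01; rewrite -E.
set d := k%:R * _ in kd *; have dp : 0 <= d by rewrite mulr_ge0.
rewrite (_ : k%:R * (2 * _) = 2 * d); last by rewrite /d; ring.
move=> h; have h2 : (1 + 2 * d)^-1 <= 1 - 2 * (d / 3).
  rewrite -div1r ler_pdivrMr; last lra.
  have : 0 <= d * (1 - d) by rewrite mulr_ge0 // subr_ge0.
  nra.
lra.
Qed.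

Lemma cutd_sym x y : cutd R cv x y = cutd R cv y x.
Proof. by apply: eq_Ex => c; rewrite eq_sym. Qed.

Lemma cutd_tri x y z : cutd R cv x z <= cutd R cv x y + cutd R cv y z.
Proof.
rewrite -ExD; apply: ler_Ex => c; rewrite -natrD ler_nat.
by case: (cv c x) (cv c y) (cv c z) => [] [] [].
Qed.

End Parity.

Section Levels.
Variables (P Cut : finType) (cut : Cut -> P -> bool) (N : nat).

Definition cell_id : finType := {ffun 'I_N -> bool}.

Definition mask (k : nat) (v : cell_id) : cell_id :=
  [ffun l : 'I_N => (l < k)%N && v l].

(** The answers of the first [k] cuts padded with [false]: cells of all levels share one finite
    type, and the parent is obtained by masking. *)
Definition cid (s : seq Cut) (k : nat) (x : P) : cell_id :=
  [ffun l : 'I_N => (l < k)%N && nth false [seq cut c x | c <- s] l].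

Lemma mask_cid s k k' x : (k <= k')%N -> cid s k x = mask k (cid s k' x).
Proof.
move=> kk; apply/ffunP => l; rewrite !ffunE; case: (ltnP l k) => //= lk.
by rewrite (leq_trans lk kk).
Qed.

Lemma cid0 s x y : cid s 0 x = cid s 0 y.
Proof. by apply/ffunP => l; rewrite !ffunE. Qed.

Lemma cid_same (s : seq Cut) k x y : size s = N -> (k <= N)%N ->
  (cid s k x == cid s k y) = same cut (take k s) x y.
Proof.
move=> sN kN; have st : size (take k s) = k by rewrite size_takel // sN.
apply/eqP/idP => [e|].
  apply/allP => c; case/(nthP c) => j; rewrite st => jk <-.
  have jN : (j < N)%N by exact: leq_trans kN.
  have := congr1 (fun v : cell_id => v (Ordinal jN)) e.
  rewrite !ffunE /= jk /= !(nth_map c) ?sN // nth_take // => ->.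
  by rewrite eqxx.
move=> al; apply/ffunP => l; rewrite !ffunE; case: (ltnP l k) => //= lk.
have c : Cut by move: lk; rewrite -st; case: (take k s) => // c.
rewrite !(nth_map c) ?sN // -(nth_take c lk).
by apply/eqP; apply: (allP al); rewrite mem_nth // st.
Qed.

End Levels.


(** * Tree cost with edge lengths measured by parities *)

Section Trial.
Variables (R : realType) (P Cut : finType) (cut : Cut -> P -> bool).
Variables (n e0 k0 : nat) (M : R).
Hypotheses (Cut0 : (0 < #|Cut|)%N) (k00 : (0 < k0)%N) (M0 : 0 < M).

(** A power of two, so that levels and sampling rates can be drawn from random bits. *)
Definition nlev := (2 ^ e0)%N.
Local Notation B := nlev.
Definition ncut := (2 ^ B)%N.
Local Notation N := ncut.

(* wt i * (probability that the parity of kq i cuts separates x and y) is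
   min(cut_dist x y, wt i) up to a constant: parities measure distances up to
   wt i. By the choice of kq, distances beyond wt i are negligible at level i:
   a cell at level i + 1 is cut out by at least 2 ^ i cuts, that is, by about
   B times more cuts than M / wt i. *)
Definition kq i := maxn k0 (2 ^ (i - e0.+1)).
Definition wt i : R := M / (kq i)%:R.

Definition par u j : cell_id N -> cell_id N := @mask N (ncuts u j).

Lemma kq_gt0 i : (0 < kq i)%N.
Proof. by rewrite leq_max k00. Qed.

Lemma wt_gt0 i : 0 < wt i.
Proof. by rewrite divr_gt0 // ltr0n kq_gt0. Qed.

Lemma wt_kq i : wt i * (kq i)%:R = M.
Proof. by rewrite /wt divfK // pnatr_eq0 -lt0n kq_gt0. Qed.

Variable pt : token n -> P.

Let cv (c : Cut) (x : token n) := cut c (pt x).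

Definition lev u (t : seq Cut) j x := cid cut N t (ncuts u j) (pt x).

Local Notation d := (cutd R cv).
Definition cut_dist x y : R := M * d x y.

Lemma D_ge0 x y : 0 <= cut_dist x y.
Proof. by rewrite mulr_ge0 ?cutd_ge0 // ltW. Qed.

Lemma D_sym x y : cut_dist x y = cut_dist y x.
Proof. by rewrite /cut_dist cutd_sym. Qed.

Lemma D_tri x y z : cut_dist x z <= cut_dist x y + cut_dist y z.
Proof. by rewrite /cut_dist -mulrDr ler_wpM2l ?(ltW M0) ?cutd_tri. Qed.

Definition avgP u t i v : R := avg (fib (lev u t i.+1) v)
  (fun x => avg (pfib (lev u t i.+1) (par u i) (par u i v)) (pard R cv (kq i) x)).

Definition imbal u t i v : R := `|mu R (lev u t) i.+1 v|.

Lemma lev0 u t x y : lev u t 0 x = lev u t 0 y.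
Proof. exact: cid0. Qed.

Lemma levS u t i x : lev u t i x = par u i (lev u t i.+1 x).
Proof. exact: mask_cid (ncuts_leS u i). Qed.

Lemma ncuts_leN u j : (j <= B)%N -> (ncuts u j <= N)%N.
Proof. by move=> jB; rewrite ltnW // (leq_trans (ncuts_lt u j)) // leq_exp2l. Qed.

Lemma lev_same u (t : N.-tuple Cut) j x y : (j <= B)%N ->
  (lev u t j x == lev u t j y) = same cv (take (ncuts u j) t) x y.
Proof. by move=> jB; rewrite /lev cid_same ?size_tuple ?ncuts_leN. Qed.

Definition par_bit (s : seq Cut) i : pred P := fun y => parity cut (take (kq i) s) y.
Definition npar := maxn k0 (2 ^ B).

Lemma kq_le i : (i < B)%N -> (kq i <= npar)%N.
Proof.
move=> iB; rewrite geq_max leq_maxl /= leq_max leq_exp2l // orbC.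
by rewrite (leq_trans (leq_subr _ _)) // ltnW.
Qed.

Lemma pfibE u t i v : pfib (lev u t i.+1) (par u i) v =1 cell (lev u t) i v.
Proof. by move=> x; rewrite /pfib /cell /= -levS. Qed.

(** [phi] of two proportions is the probability that random tokens of the cell and of its parent
    have different bits, so its mean is an average of [pard]. The factor [imbal] disposes of the
    empty cells. *)
Lemma Ex_ephi u (t : N.-tuple Cut) i v : (i < B)%N ->
  imbal u t i v * Ex (fun s : npar.-tuple Cut =>
    ephi R (lev u t i.+1) (par u i) (fun x => par_bit s i (pt x)) v) =
  imbal u t i v * avgP u t i v.
Proof.
move=> iB; case: (pickP (fib (lev u t i.+1) v)) => [y yv|nov]; last first.
  by rewrite /imbal /mu big_pred0 // normr0 !mul0r.
congr (_ * _).
have yp : pfib (lev u t i.+1) (par u i) (par u i v) y.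
  by rewrite /pfib /=; move/eqP: yv => /= ->.
rewrite (eq_Ex (g := fun s : npar.-tuple Cut => avg (fib (lev u t i.+1) v) (fun x =>
   avg (pfib (lev u t i.+1) (par u i) (par u i v)) (fun z =>
     (par_bit s i (pt x) != par_bit s i (pt z))%:R)))); last first.
  move=> s; rewrite /ephi /phi /frac.
  set e := (fun x => par_bit s i (pt x)); set F := fib _ _; set Q := pfib _ _ _.
  rewrite [RHS](eq_avg (f' := fun x => (e x)%:R * (1 - avg Q (fun z => (e z)%:R)) +
      avg Q (fun z => (e z)%:R) * (1 - (e x)%:R))); last first.
    move=> x _; rewrite [LHS](eq_avg (f' := fun z => (e x)%:R + (1 - 2 * (e x)%:R) * (e z)%:R)).
      by rewrite avgD avgZ (avg_const _ yp); ring.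
    by move=> z _; rewrite -/(e x) -/(e z); case: (e x); case: (e z) => /=; ring.
  set q := avg Q _; set p := avg F _.
  rewrite [RHS](eq_avg (f' := fun x => q + (1 - 2 * q) * (e x)%:R)).
    by rewrite avgD (avgZ F _ (fun x => (e x)%:R)) (avg_const _ yv) -/p; ring.
  by move=> x _; ring.
rewrite (Ex_avg _ (fun x (s : npar.-tuple Cut) => avg _ (fun z => _))).
apply: eq_avg => x _.
rewrite (Ex_avg _ (fun z (s : npar.-tuple Cut) => (par_bit s i (pt x) != par_bit s i (pt z))%:R)).
apply: eq_avg => z _.
exact: (@Ex_tuple_take R Cut (kq i) npar (fun s => (parity cut s (pt x) != parity cut s (pt z))%:R) Cut0 (kq_le iB)).
Qed.

Section Samples.
Variables (G eta : R).
Hypotheses (n0 : (0 < n)%N) (G1 : 1 < G) (eta0 : 0 < eta) (eta1 : eta <= 2^-1).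
Hypothesis GB : 4 * n%:R * G <= 2 ^+ B.-1.

Let BpS : (B.-1).+1 = B. Proof. by rewrite prednK // expn_gt0. Qed.

(** The tables have range 2^(B - 1), so that the rates 0, ..., B - 1 number exactly [B], a power of
    two. *)
Definition sampled u (t : seq Cut) i : R :=
  Ex (fun s : npar.-tuple Cut => \sum_(0 <= a < B) \sum_(0 <= b < B)
    esamp (lev u t i.+1) (par u i) (fun x => par_bit s i (pt x)) B.-1 G a b).

(** Errors relative to the imbalance: [2 * eta] comes from perturbed proportions and [8 / (eta * G)]
    from the expected loss, which the upper bound incurs at each of the B^2 pairs of rates. *)
Definition kappa1 : R := 2 * eta + 8 / (eta * G).
Definition kappa2 : R := 48 * eta + B%:R ^+ 2 * (8 / (eta * G)).

Lemma sampled_lower u (t : N.-tuple Cut) i : (i < B)%N ->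
  2^-1 * (\sum_v imbal u t i v * avgP u t i v - kappa1 * \sum_v imbal u t i v) <=
  sampled u t i.
Proof.
move=> iB; have ep := eta0; have Gp : 0 < G by exact: lt_trans G1.
have Npar0 : (0 < #|{: npar.-tuple Cut}|)%N by rewrite card_tuple expn_gt0 Cut0.
apply: (@le_trans _ _ (Ex (fun s : npar.-tuple Cut => 2^-1 * \sum_v imbal u t i v *
   (ephi R (lev u t i.+1) (par u i) (fun x => par_bit s i (pt x)) v - 2 * eta
    - 8 / (eta * G))))); last first.
  apply: ler_Ex => s; have := esamp_sum_lower (lev u t i.+1) (par u i)
    (fun x => par_bit s i (pt x)) n0 (ltW G1) eta0 eta1 G1 GB.
  by rewrite BpS.
rewrite ExZ ler_wpM2l ?invr_ge0 // Ex_sum mulr_sumr -sumrB.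
apply: ler_sum => v _; rewrite ExZ !ExB !Ex_const //.
rewrite !mulrBr Ex_ephi // /kappa1; lra.
Qed.

Lemma sampled_upper u (t : N.-tuple Cut) i : (i < B)%N ->
  sampled u t i <=
  24 * (\sum_v imbal u t i v * avgP u t i v) + kappa2 * \sum_v imbal u t i v.
Proof.
move=> iB; have ep := eta0.
have Npar0 : (0 < #|{: npar.-tuple Cut}|)%N by rewrite card_tuple expn_gt0 Cut0.
apply: (@le_trans _ _ (Ex (fun s : npar.-tuple Cut => \sum_v imbal u t i v *
   (24 * (ephi R (lev u t i.+1) (par u i) (fun x => par_bit s i (pt x)) v + 2 * eta)
    + B%:R ^+ 2 * (8 / (eta * G)))))).
  apply: ler_Ex => s; have := esamp_sum_upper (lev u t i.+1) (par u i)
    (fun x => par_bit s i (pt x)) B.-1 n0 (ltW G1) eta0 eta1.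
  by rewrite BpS.
rewrite Ex_sum !mulr_sumr -big_split; apply: ler_sum => v _ /=.
rewrite ExZ ExD ExZ ExD !Ex_const // -Ex_ephi // /kappa2; lra.
Qed.

End Samples.

Definition bound_imb u t : R := \sum_(0 <= i < B) wt i * \sum_v imbal u t i v.
Definition bound_avg u t : R :=
  \sum_(0 <= i < B) wt i * \sum_v imbal u t i v * avgP u t i v.

Definition Eut (F : nat -> N.-tuple Cut -> R) : R :=
  Ex (fun u : 'I_(2 ^ B) => Ex (fun t : N.-tuple Cut => F u t)).

Lemma ler_Eut F F' : (forall u t, F u t <= F' u t) -> Eut F <= Eut F'.
Proof. by move=> FF; apply: ler_Ex => u; apply: ler_Ex => t. Qed.

Lemma EutD F F' : Eut (fun u t => F u t + F' u t) = Eut F + Eut F'.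
Proof. by rewrite -ExD; apply: eq_Ex => u; rewrite ExD. Qed.

Lemma EutZ c F : Eut (fun u t => c * F u t) = c * Eut F.
Proof. by rewrite -ExZ; apply: eq_Ex => u; rewrite ExZ. Qed.

Lemma Eut_sum (I : finType) (Q : pred I) (F : I -> nat -> N.-tuple Cut -> R) :
  Eut (fun u t => \sum_(i | Q i) F i u t) = \sum_(i | Q i) Eut (F i).
Proof. by rewrite -Ex_sum; apply: eq_Ex => u; rewrite Ex_sum. Qed.

Lemma Eut_sum_nat m k (F : nat -> nat -> N.-tuple Cut -> R) :
  Eut (fun u t => \sum_(m <= i < k) F i u t) = \sum_(m <= i < k) Eut (F i).
Proof. by rewrite -Ex_sum_nat; apply: eq_Ex => u; rewrite Ex_sum_nat. Qed.

Let U0 : (0 < #|'I_(2 ^ B)|)%N. Proof. by rewrite card_ord expn_gt0. Qed.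
Let T0 : (0 < #|{: N.-tuple Cut}|)%N. Proof. by rewrite card_tuple expn_gt0 Cut0. Qed.

Lemma Eut_const c : Eut (fun _ _ => c) = c.
Proof. by rewrite /Eut !Ex_const. Qed.

Definition cut_cost (s : 'S_n) : R := \sum_a cut_dist (tk true a) (tk false (s a)).

Lemma wt_split i x y : (i < B)%N ->
  wt i * Eut (fun u t => (lev u t i.+1 x != lev u t i.+1 y)%:R) <= 4 * B%:R * cut_dist x y.
Proof.
move=> iB; have d0 := cutd_ge0 R cv x y.
have key : Eut (fun u t => (lev u t i.+1 x != lev u t i.+1 y)%:R) <= 2 ^+ i.+1 * d x y.
  rewrite -(Eut_const (2 ^+ i.+1 * d x y)); apply: ler_Ex => u; rewrite Ex_const //.
  rewrite (eq_Ex (g := fun t : N.-tuple Cut =>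
    (~~ same cv (take (ncuts u i.+1) t) x y)%:R)); last by move=> t; rewrite lev_same.
  rewrite (@Ex_tuple_take R Cut (ncuts u i.+1) N (fun s => (~~ same cv s x y)%:R)) //;
    last exact: ncuts_leN.
  apply: le_trans (Eseq_separated R _ _ _ _ _) _ => //.
  by rewrite ler_wpM2r // -natrX ler_nat ltnW // ncuts_lt.
(* If the exponent in [kq] is cut off at 0, then [i <= e0.+1] and [2 ^ i.+1] is at most [4 * B] by
   itself. *)
have k2 : 2 ^+ i.+1 <= 4 * B%:R * (kq i)%:R :> R.
  rewrite -natrX -!natrM ler_nat.
  apply: leq_trans (leq_mul (leqnn _) (leq_maxr k0 _)).
  by rewrite -[4%N]/(2 ^ 2)%N -!expnD leq_exp2l //; lia.
apply: (@le_trans _ _ (wt i * (2 ^+ i.+1 * d x y))).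
  by rewrite ler_wpM2l // ltW // wt_gt0.
have -> : 4 * B%:R * cut_dist x y = wt i * (4 * B%:R * (kq i)%:R * d x y).
  by rewrite /cut_dist -{1}(wt_kq i); ring.
by apply: ler_wpM2l; [exact: ltW (wt_gt0 i)|exact: ler_wpM2r].
Qed.

(** Adding the separation bound over all [B] levels is wasteful, but this sum only ever appears
    multiplied by [kappa1] or [kappa2]. *)
Lemma Eut_bound_imb s : Eut bound_imb <= 8 * B%:R ^+ 2 * cut_cost s.
Proof.
rewrite /bound_imb Eut_sum_nat.
apply: (@le_trans _ _ (\sum_(0 <= i < B) 8 * B%:R * cut_cost s)); last first.
  by rewrite sumr_const_nat subn0 -[_ *+ B]mulr_natr; apply: eq_ler; ring.
rewrite big_nat [leRHS]big_nat; apply: ler_sum => i /andP[_ iB].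
apply: (@le_trans _ _ (Eut (fun u t => \sum_a 2 * (wt i *
    (lev u t i.+1 (tk true a) != lev u t i.+1 (tk false (s a)))%:R)))).
  apply: ler_Eut => u t.
  have := @abs_mu_le R n _ (lev u t) s i.+1 (fun=> 1) (fun=> ler01).
  under eq_bigr => v _ do rewrite mulr1.
  move=> h; apply: le_trans (ler_wpM2l (ltW (wt_gt0 i)) h) _.
  rewrite mulr_sumr; apply: ler_sum => a _; rewrite /agree; apply: eq_ler; ring.
rewrite Eut_sum /cut_cost mulr_sumr; apply: ler_sum => a _.
rewrite !EutZ; have := wt_split (tk true a) (tk false (s a)) iB; lra.
Qed.

Lemma wt_pard i x y : wt i * pard R cv (kq i) x y <= cut_dist x y.
Proof.
rewrite /cut_dist -(wt_kq i) -mulrA ler_wpM2l ?(ltW (wt_gt0 i)) //.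
exact: pard_le.
Qed.

Lemma wt_avgP u t i v : wt i * avgP u t i v <= edge_len (lev u t) (par u) cut_dist i v.
Proof.
rewrite /avgP -avgZ /edge_len /avg_dist; apply: ler_avg => x _.
rewrite -avgZ (eq_avgl _ (pfibE u t i _)); apply: ler_avg => z _; exact: wt_pard.
Qed.

Lemma edge_le_cells u t i x :
  edge_len (lev u t) (par u) cut_dist i (lev u t i.+1 x) <=
  to_cell (lev u t) cut_dist i.+1 x + to_cell (lev u t) cut_dist i x.
Proof.
have cx : cell (lev u t) i.+1 (lev u t i.+1 x) x by rewrite /cell /=.
have cx' : cell (lev u t) i (lev u t i x) x by rewrite /cell /=.
rewrite /edge_len -levS /avg_dist /to_cell.
rewrite -[X in _ <= _ + X](avg_const _ cx) -avgD; apply: ler_avg => y _.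
rewrite -[X in _ <= X + _](avg_const _ cx') -avgD; apply: ler_avg => z _.
by rewrite (D_sym x y); exact: D_tri.
Qed.

Lemma to_cell_spread u (t : N.-tuple Cut) j x : (j <= B)%N ->
  to_cell (lev u t) cut_dist j x = M * spread R cv x predT (take (ncuts u j) t).
Proof.
move=> jB; rewrite /to_cell /spread -avgZ; apply: eq_avgl => z.
by rewrite /cell /= lev_same // /same; apply: eq_all => c; rewrite eq_sym.
Qed.

(** Nothing is lost in [B] here: parities only underestimate edges, the edge above [x] is at most
    the sum of the mean distances from [x] to its two cells, and [path_spread] adds these up along
    the tree. The two ends of a pair give 8 + 8 = 16. *)
Lemma Eut_bound_avg s : Eut bound_avg <= 16 * ln (2 * n%:R) * cut_cost s.
Proof.
have step : Eut bound_avg <= Eut (fun u t => \sum_a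
   (M * (\sum_(0 <= i < B) (~~ same cv (take (ncuts u i.+1) t) (tk true a) (tk false (s a)))%:R *
      (spread R cv (tk true a) predT (take (ncuts u i.+1) t) +
       spread R cv (tk true a) predT (take (ncuts u i) t))) +
    M * (\sum_(0 <= i < B) (~~ same cv (take (ncuts u i.+1) t) (tk false (s a)) (tk true a))%:R *
      (spread R cv (tk false (s a)) predT (take (ncuts u i.+1) t) +
       spread R cv (tk false (s a)) predT (take (ncuts u i) t))))).
  apply: ler_Eut => u t; rewrite /bound_avg.
  under [leRHS]eq_bigr => a _ do rewrite !mulr_sumr -big_split /=.
  rewrite [leRHS]exchange_big /= big_nat [leRHS]big_nat.
  apply: ler_sum => i /andP[_ iB].
  apply: (@le_trans _ _ (\sum_v imbal u t i v * edge_len (lev u t) (par u) cut_dist i v)).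
    rewrite mulr_sumr; apply: ler_sum => v _.
    rewrite mulrCA; apply: ler_wpM2l; [exact: normr_ge0|exact: wt_avgP].
  have edge0 v : 0 <= edge_len (lev u t) (par u) cut_dist i v.
    by apply: avg_ge0 => *; apply: avg_ge0 => *; exact: D_ge0.
  apply: le_trans (@abs_mu_le R n _ (lev u t) s i.+1 _ edge0) _.
  apply: ler_sum => a _; rewrite /agree lev_same //.
  set h := same _ _ _ _; have -> : same cv (take (ncuts u i.+1) t) (tk false (s a)) (tk true a) = h.
    by apply: eq_all => c; rewrite eq_sym.
  apply: (@le_trans _ _ ((~~ h)%:R *
      ((to_cell (lev u t) cut_dist i.+1 (tk true a) + to_cell (lev u t) cut_dist i (tk true a)) +
       (to_cell (lev u t) cut_dist i.+1 (tk false (s a)) + to_cell (lev u t) cut_dist i (tk false (s a)))))).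
    by apply: ler_wpM2l => //; apply: lerD; exact: edge_le_cells.
  by rewrite !to_cell_spread // ?(ltnW iB) //; apply: eq_ler; ring.
apply: le_trans step _; rewrite Eut_sum /cut_cost mulr_sumr; apply: ler_sum => a _.
rewrite EutD !EutZ.
have card2 : #|token n|%:R = 2 * n%:R :> R by rewrite card_prod card_bool card_ord natrM.
have one x y : Eut (fun u t => \sum_(0 <= i < B)
    (~~ same cv (take (ncuts u i.+1) t) x y)%:R *
      (spread R cv x predT (take (ncuts u i.+1) t) + spread R cv x predT (take (ncuts u i) t)))
    <= 8 * (d x y * ln (2 * n%:R)).
  rewrite -card2; apply: le_trans (@path_spread R _ Cut cv Cut0 x y B).
  apply: ler_Ex => u; rewrite (@Ex_tuple R Cut N (fun s => \sum_(0 <= i < B)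
    (~~ same cv (take (ncuts u i.+1) s) x y)%:R *
      (spread R cv x predT (take (ncuts u i.+1) s) + spread R cv x predT (take (ncuts u i) s)))).
  by [].
have h1 := ler_wpM2l (ltW M0) (one (tk true a) (tk false (s a))).
have h2 := ler_wpM2l (ltW M0) (one (tk false (s a)) (tk true a)).
rewrite cutd_sym in h2; apply: le_trans (lerD h1 h2) _.
by apply: eq_ler; rewrite /cut_dist; ring.
Qed.

(** * Distances beyond the range of the parities *)

Section Dominate.
Hypothesis d_half : forall x y, d x y <= 2^-1.
Hypothesis d_k0 : forall x y, d x y * k0%:R <= 1.
Hypothesis D_ge1 : forall x y, cut_dist x y = 0 \/ 1 <= cut_dist x y.
Hypothesis M_small : M <= 2 ^+ (B.-1 - e0).
Variable Dm : R.
Hypothesis D_le : forall x y, cut_dist x y <= Dm.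

Definition far i x z : R := cut_dist x z * (wt i < cut_dist x z)%R%:R.

Lemma far_ge0 i x z : 0 <= far i x z.
Proof. by rewrite mulr_ge0 // D_ge0. Qed.

Lemma D_le_pard i x z : cut_dist x z <= 3 * (wt i * pard R cv (kq i) x z) + far i x z.
Proof.
have p0 : 0 <= pard R cv (kq i) x z by apply: Eseq_ge0 => s; case: (_ != _).
have w0 := wt_gt0 i; have D0 := D_ge0 x z.
rewrite /far; case: (ltP (wt i) (cut_dist x z)) => h.
  by rewrite mulr1 lerDr mulr_ge0 // mulr_ge0 // ltW.
rewrite mulr0 addr0.
have kd : (kq i)%:R * d x z <= 1.
  move: h; rewrite /cut_dist -{1}(wt_kq i) -mulrA -{2}[wt i]mulr1.
  by rewrite (ler_pM2l w0).
have := pard_ge Cut0 (d_half x z) kd => h'.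
have := ler_wpM2l (ltW w0) h'.
have -> : wt i * ((kq i)%:R * d x z / 3) = cut_dist x z / 3.
  by rewrite /cut_dist -(wt_kq i); ring.
lra.
Qed.

(** A distance beyond [wt i] has more than one expected separating cut among [kq i], whereas [k0]
    cuts give at most one. So [kq i] is the power of two, and [B] blocks of [kq i] cuts fit into
    those of level [i]; each block halves the probability of agreement. *)
Lemma far_rare u (t : N.-tuple Cut) i x z : (i < B)%N ->
  (1 - d x z) ^+ ncuts u i * far i x z <= 2^-1 ^+ B * Dm.
Proof.
move=> iB; have d0 := cutd_ge0 R cv x z; have d1 := d_half x z.
have Dm0 : 0 <= Dm by apply: le_trans (D_le x z); exact: D_ge0.
have w0 := wt_gt0 i; rewrite /far; case: (ltP (wt i) (cut_dist x z)) => h; last first.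
  by rewrite !mulr0 mulr_ge0 // exprn_ge0 // invr_ge0.
rewrite mulr1.
have kd : 1 < (kq i)%:R * d x z.
  move: h; rewrite /cut_dist -{1}(wt_kq i) -mulrA -{1}[wt i]mulr1.
  by rewrite (ltr_pM2l w0).
have k0d := d_k0 x z.
have k0lt : (k0 < 2 ^ (i - e0.+1))%N.
  rewrite ltnNge; apply/negP => le; move: kd.
  by rewrite /kq (maxn_idPl le) mulrC ltNge k0d.
have ie : (e0.+1 < i)%N.
  rewrite ltnNge; apply/negP => le; move: k0lt.
  by rewrite (eqP (le : (i - e0.+1 == 0)%N)) ltnS leqNgt k00.
have kqE : kq i = (2 ^ (i - e0.+1))%N by rewrite /kq (maxn_idPr (ltnW k0lt)).
have ki : (kq i * B <= ncuts u i)%N.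
  case: i iB {h kd k0lt w0} ie kqE => [|i] iB ie kqE //.
  apply: leq_trans (ncuts_ge u i); rewrite kqE /nlev -expnD leq_exp2l //; lia.
apply: ler_pM; rewrite ?D_ge0 ?exprn_ge0 ?subr_ge0 //; first lra.
apply: le_trans (exp_le_half B (k := kq i) _ (ltW kd)); last by apply/andP; split; lra.
by apply: ler_wiXn2l => //; lra.
Qed.

(** At the last level the bound on [M] gives the same for any two tokens at distance at least 1. *)
Lemma leaf_rare u x z : (1 - d x z) ^+ ncuts u B * cut_dist x z <= 2^-1 ^+ B * Dm.
Proof.
have d0 := cutd_ge0 R cv x z; have d1 := d_half x z.
have Dm0 : 0 <= Dm by apply: le_trans (D_le x z); exact: D_ge0.
case: (D_ge1 x z) => [->|D1]; first by rewrite mulr0 mulr_ge0 // exprn_ge0 // invr_ge0.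
have kd : 1 <= (2 ^ (B.-1 - e0))%:R * d x z.
  by apply: le_trans D1 _; rewrite /cut_dist ler_wpM2r // natrX.
have B0 : (0 < B)%N by rewrite expn_gt0.
have eB : (e0 < B)%N by exact: ltn_expl.
have ki : (2 ^ (B.-1 - e0) * B <= ncuts u B)%N.
  rewrite -{3}(prednK B0); apply: leq_trans (ncuts_ge u _).
  by rewrite {2}/nlev -expnD leq_exp2l //; lia.
apply: ler_pM; rewrite ?D_ge0 ?exprn_ge0 ?subr_ge0 //; first lra.
apply: le_trans (exp_le_half B (k := 2 ^ (B.-1 - e0)) _ kd); last by apply/andP; split; lra.
by apply: ler_wiXn2l => //; lra.
Qed.

Definition tail u t : R :=
  \sum_x \sum_z (lev u t B x == lev u t B z)%:R * cut_dist x z +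
  \sum_(0 <= i < B) \sum_x \sum_z (lev u t i x == lev u t i z)%:R * far i x z.

Lemma Ex_same u j x z : (j <= B)%N ->
  Ex (fun t : N.-tuple Cut => (lev u t j x == lev u t j z)%:R) = (1 - d x z) ^+ ncuts u j.
Proof.
move=> jB; rewrite -(Eseq_same_le R _ Cut0).
rewrite -(@Ex_tuple_take R Cut (ncuts u j) N (fun s => (same cv s x z)%:R)) ?ncuts_leN //.
by apply: eq_Ex => t; rewrite lev_same.
Qed.

Lemma Eut_tail : Eut tail <= B.+1%:R * (2 * n%:R) ^+ 2 * (2^-1 ^+ B * Dm).
Proof.
have card2 : #|token n|%:R = 2 * n%:R :> R by rewrite card_prod card_bool card_ord natrM.
have pairs c : \sum_(x : token n) \sum_(z : token n) c = (2 * n%:R) ^+ 2 * c :> R.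
  by rewrite !sumr_const -mulrnA -[c *+ _]mulr_natr natrM -card2 mulrC expr2.
have leaf : Eut (fun u t => \sum_x \sum_z (lev u t B x == lev u t B z)%:R * cut_dist x z)
    <= (2 * n%:R) ^+ 2 * (2^-1 ^+ B * Dm).
  rewrite -pairs Eut_sum; apply: ler_sum => x _; rewrite Eut_sum; apply: ler_sum => z _.
  rewrite -(Eut_const (2^-1 ^+ B * Dm)); apply: ler_Ex => u; rewrite Ex_const //.
  rewrite (eq_Ex (g := fun t : N.-tuple Cut => cut_dist x z * (lev u t B x == lev u t B z)%:R)).
    by rewrite ExZ Ex_same // mulrC leaf_rare.
  by move=> t; rewrite mulrC.
have inner i : (i < B)%N ->
    Eut (fun u t => \sum_x \sum_z (lev u t i x == lev u t i z)%:R * far i x z)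
    <= (2 * n%:R) ^+ 2 * (2^-1 ^+ B * Dm).
  move=> iB.
  rewrite -pairs Eut_sum; apply: ler_sum => x _; rewrite Eut_sum; apply: ler_sum => z _.
  rewrite -(Eut_const (2^-1 ^+ B * Dm)); apply: ler_Ex => u; rewrite Ex_const //.
  have /card_gt0P[t0 _] := T0.
  rewrite (eq_Ex (g := fun t : N.-tuple Cut => far i x z * (lev u t i x == lev u t i z)%:R)).
    by rewrite ExZ Ex_same ?(ltnW iB) // mulrC (far_rare _ t0).
  by move=> t; rewrite mulrC.
rewrite /tail EutD Eut_sum_nat -[leRHS]mulrA.
set X : R := (2 * n%:R) ^+ 2 * _ in leaf inner *.
rewrite mulrSr mulrDl mul1r addrC lerD //.
have -> : B%:R * X = \sum_(0 <= i < B) X by rewrite sumr_const_nat subn0 mulr_natl.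
by rewrite big_nat [leRHS]big_nat; apply: ler_sum => i /andP[_ iB]; exact: inner.
Qed.

Lemma imbal_le u t i v : imbal u t i v <= #|fib (lev u t i.+1) v|%:R.
Proof. exact: (norm_sum_side R (fib (lev u t i.+1) v)). Qed.

Lemma imbal_edge u t i v :
  imbal u t i v * edge_len (lev u t) (par u) cut_dist i v <=
  3 * (wt i * (imbal u t i v * avgP u t i v)) +
  \sum_(x | lev u t i.+1 x == v) \sum_z (lev u t i x == lev u t i z)%:R * far i x z.
Proof.
have sum0 : 0 <= \sum_(x | lev u t i.+1 x == v)
    \sum_z (lev u t i x == lev u t i z)%:R * far i x z.
  by apply: sumr_ge0 => x _; apply: sumr_ge0 => z _; rewrite mulr_ge0 // far_ge0.
case: (pickP (fib (lev u t i.+1) v)) => [y yv|nov]; last first.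
  by rewrite /imbal /mu big_pred0 // normr0 !(mul0r, mulr0) add0r.
have yp : cell (lev u t) i (par u i v) y.
  by rewrite /cell /= (levS u t i); move/eqP: yv => /= ->.
have edge : edge_len (lev u t) (par u) cut_dist i v <= 3 * (wt i * avgP u t i v) +
    avg (fib (lev u t i.+1) v) (fun x => avg (cell (lev u t) i (par u i v)) (far i x)).
  rewrite /edge_len /avg_dist /avgP -!avgZ -avgD; apply: ler_avg => x _.
  rewrite (eq_avgl _ (pfibE u t i _)) -!avgZ -avgD; apply: ler_avg => z _.
  exact: D_le_pard.
apply: le_trans (ler_wpM2l (normr_ge0 _) edge) _; rewrite mulrDr; apply: lerD.
  by apply: eq_ler; rewrite -/(imbal u t i v); ring.
set F := fun x => avg _ _.
have F0 x : 0 <= F x by apply: avg_ge0 => z _; exact: far_ge0.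
have c0 : 0 < #|fib (lev u t i.+1) v|%:R :> R.
  by rewrite ltr0n; apply/card_gt0P; exists y.
(* The imbalance is at most the size of the cell and cancels the denominator of the average. *)
apply: (@le_trans _ _ (\sum_(x | lev u t i.+1 x == v) F x)).
  rewrite /avg mulrA ler_pdivrMr // mulrC; apply: ler_wpM2l; last exact: imbal_le.
  by apply: sumr_ge0.
apply: ler_sum => x /eqP xv; rewrite /F.
apply: le_trans (avg_le_sum yp _) _; first by move=> z _; exact: far_ge0.
rewrite big_mkcond; apply: ler_sum => z _; rewrite /cell /= eq_sym -xv -levS.
by case: eqP => _; rewrite ?mul1r ?mul0r.
Qed.

Lemma emd_le_tree u t (E : R) : (forall s, E <= cut_cost s) -> E <= 3 * bound_avg u t + tail u t.
Proof.
move=> Eopt.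
have [s sP] := tree_matching (lev0 u t) (levS u t) D_tri D_sym D_ge0 B.
apply: le_trans (Eopt s) _; apply: le_trans sP _; rewrite /tail addrCA; apply: lerD.
  apply: ler_sum => x _; apply: le_trans (avg_le_sum (x := x) _ _) _ => //.
  - by rewrite /cell /=.
  - by move=> z _; exact: D_ge0.
  rewrite big_mkcond; apply: ler_sum => z _; rewrite /cell /= eq_sym.
  by case: eqP => _; rewrite ?mul1r ?mul0r.
rewrite /bound_avg mulr_sumr -big_split; apply: ler_sum => i _ /=.
apply: (@le_trans _ _ (\sum_v (3 * (wt i * (imbal u t i v * avgP u t i v)) +
  \sum_(x | lev u t i.+1 x == v) \sum_z (lev u t i x == lev u t i z)%:R * far i x z))).
  by apply: ler_sum => v _; exact: imbal_edge.
rewrite big_split /= -!mulr_sumr lerD2l.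
by rewrite [leRHS](partition_big (lev u t i.+1) predT).
Qed.

Lemma emd_le (E : R) : (forall s, E <= cut_cost s) ->
  E <= 3 * Eut bound_avg + B.+1%:R * (2 * n%:R) ^+ 2 * (2^-1 ^+ B * Dm).
Proof.
move=> Eopt; rewrite -(Eut_const E) -EutZ.
apply: le_trans (lerD (lexx _) Eut_tail); rewrite -EutD.
by apply: ler_Eut => u t; exact: emd_le_tree.
Qed.

End Dominate.

End Trial.

(** * A trial computed from eight counters *)

Section TokenCounts.
Variables (R : realType) (P : finType) (n : nat) (A A' : n.-tuple P).

Definition pts (x : token n) : P := tnth (if x.1 then A else A') x.2.

Lemma sum_count (Q : pred P) (S : n.-tuple P) :
  \sum_i (Q (tnth S i))%:R = (count Q S)%:R :> R.
Proof.
rewrite -natr_sum -sum1_count big_tuple; congr _%:R.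
by rewrite [RHS]big_mkcond; apply: eq_bigr => i _; case: (Q _).
Qed.

Lemma card_pts (Q : pred P) :
  #|[pred x | Q (pts x)]|%:R = (count Q A)%:R + (count Q A')%:R :> R.
Proof.
rewrite -!sum_count -sum1_card natr_sum big_mkcond sum_token.
by congr (_ + _); apply: eq_bigr => i _; rewrite inE /=; case: (Q _).
Qed.

Lemma sum_side (Q : pred P) :
  \sum_(x | Q (pts x)) side R x = (count Q A)%:R - (count Q A')%:R.
Proof.
rewrite -!sum_count big_mkcond sum_token -sumrN.
by congr (_ + _); apply: eq_bigr => i _; rewrite /side /=; case: (Q _); rewrite ?oppr0.
Qed.

End TokenCounts.

Section TrialSpace.
Variables (R : realType) (P Cut : finType) (cut : Cut -> P -> bool).
Variables (n e0 k0 : nat) (M G : R).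
Hypothesis Cut_dyadic : dyadic Cut.

Local Notation B := (nlev e0).
Local Notation N := (ncut e0).
Local Notation Id := (cell_id N).

Definition tables : finType := (table Id B.-1 * table Id B.-1)%type.

(* A trial: the scale i, the shift u of the numbers of cuts, the cuts t of the
   tree, the cuts s of the parity bit, the sampling classes a and b and the
   tables deciding which cells are sampled. *)
Definition trial : finType :=
  ('I_B * ('I_(2 ^ B) * (N.-tuple Cut * ((npar e0 k0).-tuple Cut *
    ('I_B * ('I_B * tables))))))%type.

Lemma trial_dyadic : dyadic trial.
Proof.
have tab : dyadic (table Id B.-1) by apply/dyadic_ffun/dyadic_ord.
apply/dyadic_prod; first exact: dyadic_ord.
apply/dyadic_prod; first exact: dyadic_ord.
apply/dyadic_prod; first exact: dyadic_tuple.
apply/dyadic_prod; first exact: dyadic_tuple.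
apply/dyadic_prod; first exact: dyadic_ord.
apply/dyadic_prod; first exact: dyadic_ord.
exact: dyadic_prod.
Qed.

(** [j.1] passes from sampled parents to sampled cells and [j.2] restricts to odd parity; four
    predicates on two sides make the eight counters. *)
Definition trial_pred (w : trial) (j : bool * bool) : pred P := fun x =>
  let: (i, (u, (t, (s, (a, (b, (h1, h2))))))) := w in
  let v := cid cut N t (ncuts u i.+1) x in
  [&& chosen a h1 (par u i v), j.1 ==> chosen b h2 v & j.2 ==> par_bit cut e0 k0 s i x].

(** [B%:R ^+ 3] compensates for drawing the level and both rates uniformly instead of summing over
    them. *)
Definition trial_val (w : trial) (c : bool * bool -> bool -> R) : R :=
  let: (i, (u, (t, (s, (a, (b, (h1, h2))))))) := w in
  let tot j := c j true + c j false in
  B%:R ^+ 3 * (wt e0 k0 M i * (zval (tau n G a) (theta n G a b)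
    (tot (false, false)) (tot (false, true)) (tot (true, false)) (tot (true, true))
    (c (true, false) true - c (true, false) false) / (rate R a * rate R b))).

Variables (A A' : n.-tuple P).
Local Notation pt := (pts A A').

Definition trial_out (w : trial) : R :=
  trial_val w (fun j b => (count (trial_pred w j) (if b then A else A'))%:R).

Lemma trial_outE i u (t : N.-tuple Cut) s a b h1 h2 :
  trial_out (i, (u, (t, (s, (a, (b, (h1, h2))))))) =
  B%:R ^+ 3 * (wt e0 k0 M i *
    (zsamp (lev cut e0 pt u t i.+1) (par u i) (fun x => par_bit cut e0 k0 s i (pt x))
      (tau n G a) (theta n G a b) (chosen a h1) (chosen b h2)
      / (rate R a * rate R b))).
Proof.
rewrite /trial_out /trial_val; congr (_ * (_ * (_ / _))).
rewrite /zsamp -!card_pts; congr zval.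
- by congr _%:R; apply: eq_card => x; rewrite !inE /samp1 /= andbT.
- by congr _%:R; apply: eq_card => x; rewrite !inE /samp2 /= andbT.
- congr _%:R; apply: eq_card => x; rewrite !inE /samp2 /= ?unfold_in.
  by rewrite -!andbA.
- by rewrite -sum_side; apply: eq_bigl => x; rewrite /samp2 /= andbT.
Qed.

Let B0 : (0 < B)%N. Proof. by rewrite expn_gt0. Qed.

Lemma Ex_trial : Ex trial_out = Eut (fun u (t : N.-tuple Cut) =>
  \sum_(0 <= i < B) wt e0 k0 M i * sampled cut e0 k0 pt G u t i).
Proof.
have Bn0 : B%:R != 0 :> R by rewrite pnatr_eq0 -lt0n.
pose es u t (s : (npar e0 k0).-tuple Cut) i a b := esamp (lev cut e0 pt u t i.+1)
  (par u i) (fun x => par_bit cut e0 k0 s i (pt x)) B.-1 G a b.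
rewrite Ex_pair (eq_Ex (g := fun i : 'I_B => B%:R * Ex (fun u : 'I_(2 ^ B) =>
    Ex (fun t : N.-tuple Cut => wt e0 k0 M i * sampled cut e0 k0 pt G u t i)))).
  rewrite (Ex_ord_scale (fun i => Ex (fun u : 'I_(2 ^ B) => Ex (fun t : N.-tuple Cut =>
    wt e0 k0 M i * sampled cut e0 k0 pt G u t i))) B0).
  rewrite -Ex_sum_nat; apply: eq_Ex => u; rewrite -Ex_sum_nat.
  by apply: eq_Ex => t.
move=> i; rewrite Ex_pair -ExZ; apply: eq_Ex => u.
rewrite Ex_pair -ExZ; apply: eq_Ex => t.
rewrite Ex_pair /sampled -!ExZ; apply: eq_Ex => s.
rewrite Ex_pair (eq_Ex (g := fun a : 'I_B => B%:R * (B%:R * (wt e0 k0 M i *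
   \sum_(0 <= b < B) es u t s i a b)))).
  rewrite (Ex_ord_scale (fun a => B%:R * (wt e0 k0 M i * \sum_(0 <= b < B) es u t s i a b)) B0).
  by rewrite -!mulr_sumr.
move=> a; rewrite Ex_pair (eq_Ex (g := fun b : 'I_B => B%:R * (B%:R * (B%:R *
   (wt e0 k0 M i * es u t s i a b))))).
  rewrite (Ex_ord_scale (fun b => B%:R * (B%:R * (wt e0 k0 M i * es u t s i a b))) B0).
  by rewrite -!mulr_sumr.
move=> b; rewrite /es /esamp /Ex2 (Ex_pair (fun h : tables => _)).
rewrite [Ex _ / _]mulrC -!ExZ; apply: eq_Ex => h1; rewrite -!ExZ; apply: eq_Ex => h2.
by rewrite trial_outE [zsamp _ _ _ _ _ _ _ / _]mulrC; ring.
Qed.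

Hypotheses (k00 : (0 < k0)%N) (M0 : 0 < M) (G0 : 0 < G).

(** Division by the rates turns [theta] into [n * G ^ 2] for every class, and no weight exceeds
    [M / k0], so one range serves all rates and levels. *)
Lemma trial_out_bounds w :
  0 <= trial_out w <= B%:R ^+ 3 * (M / k0%:R * (8 * n%:R * G ^+ 2)).
Proof.
case: w => i [u [t [s [a [b [h1 h2]]]]]]; rewrite trial_outE.
have qa := rate_gt0 R a; have qb := rate_gt0 R b.
have k0R : 0 < k0%:R :> R by rewrite ltr0n.
have w0 := wt_gt0 e0 k00 M0 i.
have z0 := @zsamp_ge0 R n _ (lev cut e0 pt u t i.+1) (par u i)
  (fun x => par_bit cut e0 k0 s i (pt x)) (tau n G a) (theta n G a b)
  (chosen a h1) (chosen b h2).
have th0 : 0 <= theta n G a b.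
  by apply: mulr_ge0 (sqr_ge0 _); rewrite !mulr_ge0 ?rate_ge0.
have z1 := @zsamp_le R n _ (lev cut e0 pt u t i.+1) (par u i)
  (fun x => par_bit cut e0 k0 s i (pt x)) (tau n G a) _
  (chosen a h1) (chosen b h2) th0.
apply/andP; split.
  by rewrite mulr_ge0 ?exprn_ge0 // mulr_ge0 ?(ltW w0) // divr_ge0 // mulr_ge0 ?ltW.
rewrite ler_wpM2l ?exprn_ge0 //; apply: ler_pM; rewrite ?(ltW w0) //.
- by rewrite divr_ge0 // mulr_ge0 ?ltW.
- rewrite ler_pM2l // lef_pV2 ?posrE ?ltr0n ?kq_gt0 //.
  by rewrite ler_nat leq_maxl.
rewrite ler_pdivrMr ?mulr_gt0 //; apply: le_trans z1 _.
by apply: eq_ler; rewrite /theta; ring.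
Qed.

Section Bounds.
Variables (eta Dm C : R).
Hypotheses (n0 : (0 < n)%N) (G1 : 1 < G) (eta0 : 0 < eta) (eta1 : eta <= 2^-1).
Hypothesis GB : 4 * n%:R * G <= 2 ^+ B.-1.
Hypothesis d_half : forall x y, cutd R cut x y <= 2^-1.
Hypothesis d_k0 : forall x y, cutd R cut x y * k0%:R <= 1.
Hypothesis D_ge1 : forall x y, M * cutd R cut x y = 0 \/ 1 <= M * cutd R cut x y.
Hypothesis M_small : M <= 2 ^+ (B.-1 - e0).
Hypothesis D_le : forall x y, M * cutd R cut x y <= Dm.
Hypothesis Dm_small : B.+1%:R * (2 * n%:R) ^+ 2 * (2^-1 ^+ B * Dm) <= 4^-1.
Hypothesis kappa_small : 24 * B%:R ^+ 2 * kappa1 G eta * C <= 4^-1.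

Lemma trial_bounds (E : R) : (forall s, E <= cut_cost cut M pt s) ->
  (exists s, cut_cost cut M pt s <= C * E) -> E = 0 \/ 1 <= E ->
  E <= 12 * Ex trial_out /\
  Ex trial_out <=
    (384 * ln (2 * n%:R) + 8 * B%:R ^+ 2 * kappa2 e0 G eta) * (C * E).
Proof.
move=> Emin [s sE] E01.
have Cut0 := dyadic_gt0 Cut_dyadic.
pose S := Eut (fun u (t : N.-tuple Cut) => bound_avg cut e0 k0 M pt u t).
pose T := Eut (fun u (t : N.-tuple Cut) => bound_imb cut e0 k0 M pt u t).
have Gp := G0; have ep := eta0; have ln0 : 0 <= ln (2 * n%:R) :> R.
  by rewrite ln_ge0 // -natrM ler1n muln_gt0.
have k1 : 0 <= kappa1 G eta by rewrite addr_ge0 ?mulr_ge0 ?invr_ge0 ?mulr_ge0 // ltW.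
have k2 : 0 <= kappa2 e0 G eta.
  by rewrite addr_ge0 ?mulr_ge0 ?exprn_ge0 ?invr_ge0 ?mulr_ge0 // ltW.
have lo : 2^-1 * (S - kappa1 G eta * T) <= Ex trial_out.
  rewrite Ex_trial -mulN1r mulrA /S /T -EutZ -EutD -EutZ; apply: ler_Eut => u t.
  rewrite /bound_avg /bound_imb !mulr_sumr -big_split mulr_sumr.
  rewrite [leLHS]big_nat [leRHS]big_nat; apply: ler_sum => i /andP[_ iB].
  have := ler_wpM2l (ltW (wt_gt0 e0 k00 M0 i))
    (sampled_lower cut k0 Cut0 pt n0 G1 eta0 eta1 GB u t iB).
  apply: le_trans; apply: eq_ler => /=; ring.
have hi : Ex trial_out <= 24 * S + kappa2 e0 G eta * T.
  rewrite Ex_trial /S /T -!EutZ -EutD; apply: ler_Eut => u t.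
  rewrite /bound_avg /bound_imb !mulr_sumr -big_split.
  rewrite [leLHS]big_nat [leRHS]big_nat; apply: ler_sum => i /andP[_ iB].
  have := ler_wpM2l (ltW (wt_gt0 e0 k00 M0 i))
    (sampled_upper cut k0 Cut0 pt n0 G1 eta0 eta1 u t iB).
  move=> h; apply: le_trans h _; apply: eq_ler => /=; ring.
have Tb : T <= 8 * B%:R ^+ 2 * (C * E).
  apply: le_trans (Eut_bound_imb cut e0 Cut0 k00 M0 pt s) _.
  by rewrite ler_wpM2l // mulr_ge0 // exprn_ge0.
have Sb : S <= 16 * ln (2 * n%:R) * (C * E).
  apply: le_trans (Eut_bound_avg cut e0 Cut0 k00 M0 pt s) _.
  by rewrite ler_wpM2l // mulr_ge0.
have El : E <= 3 * S + 4^-1.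
  apply: le_trans (lerD (lexx _) Dm_small).
  apply: emd_le => // x y; [exact: d_half|exact: d_k0|exact: D_ge1|exact: D_le].
split; last first.
  have := ler_wpM2l k2 Tb; lra.
case: E01 => [E0|E1].
  rewrite E0 mulr_ge0 // Ex_ge0 // => w.
  by have /andP[] := trial_out_bounds w.
have E0 : 0 <= E by lra.
(* As E >= 1, [El] gives 3 S >= 3/4 E, while 3 [kappa1] T <= E/4; so S - [kappa1] T >= E/6, and the
   half in [lo] makes this E/12. *)
have h1 := ler_wpM2l k1 Tb.
have h2 := ler_wpM2r E0 kappa_small.
have h3 : kappa1 G eta * (8 * B%:R ^+ 2 * (C * E)) * 3 = 24 * B%:R ^+ 2 * kappa1 G eta * C * E by ring.
lra.
Qed.

End Bounds.
End TrialSpace.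

(** * Embedding l_p into cut metrics *)

Section SignedSums.
Variables (R : realType) (Lv : finType).
Hypothesis Lv0 : (0 < #|Lv|)%N.
Implicit Types (f : R -> Lv -> R) (zs : seq R).

Definition sgb (b : bool) : R := if b then 1 else -1.

(** Each coordinate receives a random sign and a random level; a general [f] lets truncated weights
    be treated in the same way. *)
Fixpoint signed_sum f (s : seq (bool * Lv)) zs : R :=
  match s, zs with
  | c :: s', z :: zs' => sgb c.1 * f z c.2 + signed_sum f s' zs'
  | _, _ => 0
  end.

Lemma Ex_bool (F : bool -> R) : Ex F = (F true + F false) / 2.
Proof. by rewrite /Ex big_bool card_bool. Qed.

Lemma signed_sum_sq f zs :
  Eseq (size zs) (fun s => signed_sum f s zs ^+ 2) =
  \sum_(z <- zs) Ex (fun r => f z r ^+ 2).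
Proof.
elim: zs => [|z zs IH] /=; first by rewrite big_nil expr0n.
rewrite big_cons -IH Ex_pair Ex_bool !Ex_Eseq.
rewrite -EseqD mulrC -EseqZ -[X in _ = X + _](Eseq_const (size zs) _ (T := bool * Lv)%type);
  last by rewrite card_prod card_bool muln_gt0.
rewrite -EseqD; apply: eq_Eseq => s _ /=.
rewrite -ExD -ExZ -[X in _ = _ + X](Ex_const _ Lv0) -ExD.
by apply: eq_Ex => r; rewrite /sgb; field.
Qed.

Lemma signed_sum_abs f zs :
  Eseq (size zs) (fun s => `|signed_sum f s zs|) <=
  \sum_(z <- zs) Ex (fun r => `|f z r|).
Proof.
elim: zs => [|z zs IH] /=; first by rewrite big_nil normr0.
rewrite big_cons; apply: le_trans (lerD (lexx _) IH).
have T0 : (0 < #|{: bool * Lv}|)%N by rewrite card_prod card_bool muln_gt0.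
have -> : Ex (fun r => `|f z r|) = Ex (fun c : bool * Lv => `|f z c.2|).
  by rewrite Ex_pair Ex_bool /=; field.
rewrite -[X in _ <= _ + X](Ex_const _ T0) -ExD; apply: ler_Ex => c.
rewrite -[X in _ <= X + _](Eseq_const (size zs) _ T0) -EseqD.
apply: ler_Eseq => s _; apply: le_trans (ler_normD _ _) _.
by rewrite normrM /sgb; case: c.1; rewrite ?normrN normr1 mul1r.
Qed.

(* Averaging over one sign dominates both the term carrying that sign and the
   rest of the sum. *)
Lemma signed_sum_lower f zs lam : 0 <= lam ->
  lam * (1 - \prod_(z <- zs) (1 - Pr R (fun r => lam <= `|f z r|))) <=
  Eseq (size zs) (fun s => `|signed_sum f s zs|).
Proof.
move=> lam0; elim: zs => [|z zs IH] /=; first by rewrite big_nil subrr mulr0 normr0.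
have T0 : (0 < #|{: bool * Lv}|)%N by rewrite card_prod card_bool muln_gt0.
set E := Eseq _ _ in IH; set pi := \prod_(z <- zs) _ in IH.
rewrite big_cons -/pi; set q := Pr R _.
rewrite Ex_pair Ex_bool -ExD.
pose I r : R := (lam <= `|f z r|)%R%:R.
have E0 : 0 <= E by apply: Eseq_ge0.
apply: (@le_trans _ _ (Ex (fun r => lam * I r + (1 - I r) * E))).
  have -> : Ex (fun r => lam * I r + (1 - I r) * E) = lam * q + (1 - q) * E.
    rewrite ExD ExZ; congr (_ + _); rewrite [RHS]mulrC.
    have -> : 1 - q = Ex (fun r => 1 - I r) by rewrite ExB Ex_const.
    by rewrite -ExZ; apply: eq_Ex => r; rewrite mulrC.
  have q1 : q <= 1.
    by rewrite -(Ex_const (1 : R) Lv0); apply: ler_Ex => r; rewrite lern1 leq_b1.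
  have := ler_wpM2r (_ : 0 <= 1 - q) IH; rewrite subr_ge0 => /(_ q1); lra.
rewrite mulrC -ExZ; apply: ler_Ex => r; rewrite -EseqD -EseqZ.
have pt (s : seq (bool * Lv)) : `|f z r| <= 2^-1 * (`|sgb true * f z r + signed_sum f s zs| +
     `|sgb false * f z r + signed_sum f s zs|) /\
   `|signed_sum f s zs| <= 2^-1 * (`|sgb true * f z r + signed_sum f s zs| +
     `|sgb false * f z r + signed_sum f s zs|).
  move: (signed_sum f s zs) (f z r) => a b; rewrite /sgb mul1r mulN1r.
  have h1 := ler_normB (b + a) (- b + a); have h2 := ler_normD (b + a) (- b + a).
  have e1 : (b + a) - (- b + a) = 2 * b by ring.
  have e2 : (b + a) + (- b + a) = 2 * a by ring.
  rewrite e1 normrM gtr0_norm // in h1; rewrite e2 normrM gtr0_norm // in h2.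
  by split; lra.
rewrite /I; case: (boolP (lam <= `|f z r|)) => h /=.
  rewrite mulr1 subrr mul0r addr0; apply: le_trans h _.
  rewrite -(Eseq_const (size zs) `|f z r| T0); apply: ler_Eseq => s _.
  by have [] := pt s.
rewrite mulr0 add0r subr0 mul1r; apply: ler_Eseq => s _.
by have [] := pt s.
Qed.

Lemma signed_sum_fourth zs :
  Eseq (size zs) (fun s => signed_sum (fun z _ => z) s zs ^+ 4) <=
  3 * (\sum_(z <- zs) z ^+ 2) ^+ 2.
Proof.
have T0 : (0 < #|{: bool * Lv}|)%N by rewrite card_prod card_bool muln_gt0.
elim: zs => [|z zs IH] /=; first by rewrite big_nil !expr0n mulr0.
have sq := signed_sum_sq (fun z _ => z) zs.
rewrite (eq_bigr (fun z => z ^+ 2)) in sq; last by move=> y _; rewrite Ex_const.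
rewrite big_cons; set Q := \sum_(z <- zs) _ in IH sq *.
rewrite Ex_pair Ex_bool /= !Ex_const // -EseqD mulrC -EseqZ.
rewrite (eq_Eseq (g := fun s => signed_sum (fun z _ => z) s zs ^+ 4 +
  (6 * z ^+ 2 * signed_sum (fun z _ => z) s zs ^+ 2 + z ^+ 4))); last first.
  by move=> s _; rewrite /sgb /=; field.
rewrite EseqD EseqD EseqZ Eseq_const // sq.
apply: le_trans (lerD IH (lexx _)) _.
have : 0 <= z ^+ 4 by rewrite -[4%N]/(2 * 2)%N exprM sqr_ge0.
have -> : 3 * (z ^+ 2 + Q) ^+ 2 = 3 * z ^+ 4 + 6 * z ^+ 2 * Q + 3 * Q ^+ 2 by ring.
lra.
Qed.

Lemma abs_ge_quartic (t : R) : t ^+ 2 - t ^+ 4 / 4 <= `|t|.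
Proof.
wlog t0 : t / 0 <= t.
  move=> H; have [/H //|/ltW t0] := leP 0 t.
  have := H (- t); rewrite oppr_ge0 t0 normrN sqrrN.
  by rewrite -[4%N]/(2 * 2)%N !exprM sqrrN => /(_ isT).
rewrite ger0_norm //.
have e : t - (t ^+ 2 - t ^+ 4 / 4) = t * (1 - t + t ^+ 3 / 4) by field.
rewrite -subr_ge0 e mulr_ge0 //.
(* 1 - t + t^3/4 lies above its tangent at 6/5 *)
have : 0 <= (t - 6 / 5) ^+ 2 * (t + 12 / 5).
  by rewrite mulr_ge0 ?sqr_ge0 //; lra.
have -> : (t - 6 / 5) ^+ 2 * (t + 12 / 5) = t ^+ 3 - (108 / 25) * t + 432 / 125 by field.
lra.
Qed.

(** The quartic minorant of the absolute value reduces the first moment to the second and the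
    fourth. *)
Lemma khintchine_lower zs (L : R) : 0 < L -> \sum_(z <- zs) z ^+ 2 = L ^+ 2 ->
  L / 4 <= Eseq (size zs) (fun s => `|signed_sum (fun z _ => z) s zs|).
Proof.
move=> L0 zL.
have sq := signed_sum_sq (fun z _ => z) zs.
rewrite (eq_bigr (fun z => z ^+ 2)) in sq; last by move=> y _; rewrite Ex_const.
have four := signed_sum_fourth zs; rewrite zL in sq four.
(* The scale that maximises the resulting bound, 4/9 L. *)
pose k := 3 / 2 * L; have k0 : 0 < k by rewrite /k; lra.
apply: (@le_trans _ _ (Eseq (size zs) (fun s => k *
  (k ^- 2 * signed_sum (fun z _ => z) s zs ^+ 2 +
   (- (k ^- 4 / 4)) * signed_sum (fun z _ => z) s zs ^+ 4)))).
  rewrite EseqZ EseqD !EseqZ sq.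
  apply: (@le_trans _ _ (k * (k ^- 2 * L ^+ 2 - k ^- 4 / 4 * (3 * (L ^+ 2) ^+ 2)))).
    have -> : k * (k ^- 2 * L ^+ 2 - k ^- 4 / 4 * (3 * (L ^+ 2) ^+ 2)) = 4 / 9 * L.
      by rewrite /k; field; rewrite lt0r_neq0.
    lra.
  rewrite ler_pM2l // mulNr lerD2l lerN2; apply: ler_wpM2l four.
  by rewrite divr_ge0 // invr_ge0 exprn_ge0 // ltW.
apply: ler_Eseq => s _; set S := signed_sum _ _ _.
have h := abs_ge_quartic (S / k).
rewrite normrM normfV (gtr0_norm k0) ler_pdivlMr // in h.
apply: le_trans h; rewrite !expr_div_n; apply: eq_ler; ring.
Qed.

End SignedSums.

Section GeometricSums.
Variable R : realType.

Lemma geo_sum_le_top (b X : R) n : 1 < b -> 0 <= X ->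
  \sum_(0 <= j < n) b ^+ j * (b ^+ j <= X)%R%:R <= X * (b / (b - 1)).
Proof.
move=> b1 X0; have b10 : 0 < b - 1 by lra.
have b0 : 0 <= b by lra.
elim: n => [|n IH]; first by rewrite big_geq // mulr_ge0 // divr_ge0 // ltW.
have [le|gt] := boolP (b ^+ n <= X); last first.
  by rewrite big_nat_recr //= (negbTE gt) mulr0 addr0.
apply: (@le_trans _ _ (\sum_(0 <= j < n.+1) b ^+ j)).
  apply: ler_sum => j _; rewrite ler_piMr ?exprn_ge0 // lern1 leq_b1 //.
rewrite big_mkord mulrA ler_pdivlMr // mulrC -subrX1 exprS mulrC.
have := ler_wpM2r b0 le; lra.
Qed.

Lemma geo_sum_le_bottom (g Y : R) n : 0 < g < 1 -> 0 <= Y ->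
  \sum_(0 <= j < n) g ^+ j * (g ^+ j <= Y)%R%:R <= Y / (1 - g).
Proof.
move=> /andP[g0 g1]; have g10 : 0 < 1 - g by lra.
elim: n Y => [|n IH] Y Y0; first by rewrite big_geq // divr_ge0 // ltW.
have [le|gt] := leP 1 Y.
  apply: (@le_trans _ _ (\sum_(0 <= j < n.+1) g ^+ j)).
    by apply: ler_sum => j _; rewrite ler_piMr ?exprn_ge0 ?lern1 ?leq_b1 // ltW.
  rewrite big_mkord ler_pdivlMr //.
  have := subrX1 g n.+1; have := exprn_gt0 n.+1 g0; lra.
rewrite big_nat_recl // expr0 [1 <= Y]leNgt gt mulr0 add0r.
have := ler_wpM2l (ltW g0) (IH (Y / g) (divr_ge0 Y0 (ltW g0))).
have -> : g * (Y / g / (1 - g)) = Y / (1 - g) by field; lra.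
apply: le_trans; rewrite mulr_sumr; apply: ler_sum => j _.
by rewrite exprS -mulrA ler_pM2l // [(_ <= Y / g)]ler_pdivlMr // [g * _]mulrC.
Qed.

End GeometricSums.

Lemma signed_sumD (R : realType) (Lv : finType) (f1 f2 : R -> Lv -> R) s zs :
  signed_sum (fun z r => f1 z r + f2 z r) s zs =
  signed_sum f1 s zs + signed_sum f2 s zs.
Proof.
elim: zs s => [|z zs IH] [|c s] /=; rewrite ?addr0 // IH mulrDr; ring.
Qed.

Lemma eq_signed_sum (R : realType) (Lv : finType) (f1 f2 : R -> Lv -> R) s zs :
  (forall z r, f1 z r = f2 z r) -> signed_sum f1 s zs = signed_sum f2 s zs.
Proof. by move=> f12; elim: zs s => [|z zs IH] [|c s] //=; rewrite IH f12. Qed.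

(** * Discrete p-stable combinations for 1 < p < 2 *)

Section Weights.
Variables (R : realType) (p : R) (J : nat).
Hypothesis p12 : 1 < p < 2.
Let p0 : 0 < p. Proof. by case/andP: p12 => /(lt_trans ltr01). Qed.
Let pn0 : p != 0. Proof. by rewrite gt_eqF. Qed.

(** For uniform [r] the level is at least [j] with probability exactly 2^-j, for every [j <= J]. *)
Definition lvl (r : 'I_(2 ^ J)) : nat := (J - up_log 2 r.+1)%N.
(* [weight j] has probability about [weight j ^ (- p)], so the weights are a
   discrete substitute for p-stable variables. *)
Definition weight (j : nat) : R := 2 `^ (j%:R / p).
(** Rounded to an integer because cuts threshold natural numbers; at least half of the weight
    survives. *)
Definition mult (r : 'I_(2 ^ J)) : nat := Num.truncn (weight (lvl r)).

Lemma le_lvl (r : 'I_(2 ^ J)) j : (j <= J)%N -> (r < 2 ^ (J - j))%N = (j <= lvl r)%N.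
Proof.
move=> jJ; rewrite /lvl.
have rJ : (up_log 2 r.+1 <= J)%N by rewrite up_log_min.
rewrite leq_subRL // addnC -leq_subRL //.
apply/idP/idP => [h|h]; first by rewrite up_log_min.
by apply: leq_trans (up_logP r.+1 (isT : (1 < 2)%N)) _; rewrite leq_exp2l.
Qed.

Lemma lvl_le r : (lvl r <= J)%N. Proof. exact: leq_subr. Qed.

Lemma Ex_lvl_le (F : nat -> R) : (forall j, 0 <= F j) ->
  Ex (fun r => F (lvl r)) <= \sum_(0 <= j < J.+1) rate R j * F j.
Proof.
move=> F0.
apply: (@le_trans _ _ (Ex (fun r : 'I_(2 ^ J) => \sum_(0 <= j < J.+1)
    F j * (r < 2 ^ (J - j))%N%:R))).
  apply: ler_Ex => r; rewrite big_mkord (bigD1 (inord (lvl r))) //=.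
  rewrite inordK ?ltnS ?lvl_le // le_lvl ?lvl_le // leqnn mulr1 lerDl.
  by apply: sumr_ge0 => j _; rewrite mulr_ge0.
rewrite Ex_sum_nat; apply: eq_ler; apply: eq_big_nat => j /andP[_ jJ].
by rewrite ExZ Ex_chosen // mulrC.
Qed.

Lemma weight_gt0 j : 0 < weight j. Proof. exact: powR_gt0. Qed.

Lemma weight_ge1 j : 1 <= weight j.
Proof.
by rewrite -[leLHS](powRr0 2) /weight ler_powR ?ler1n // divr_ge0 // ltW.
Qed.

Lemma weight_pow j a : weight j `^ a = (2 `^ (a / p)) ^+ j.
Proof.
rewrite /weight -powRrM -powR_mulrn ?powR_ge0 // -powRrM; congr (_ `^ _); ring.
Qed.

Lemma weight_p j : weight j `^ p = 2 ^+ j.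
Proof. by rewrite weight_pow divff // powRr1. Qed.

Lemma mult_le r : (mult r)%:R <= weight (lvl r).
Proof. by rewrite truncn_le // ltW // weight_gt0. Qed.

Lemma mult_ge r : weight (lvl r) <= 2 * (mult r)%:R.
Proof.
have h1 := weight_ge1 (lvl r).
have : weight (lvl r) < (mult r).+1%:R by rewrite truncnS_gt.
have : 1 <= (mult r)%:R :> R by rewrite ler1n truncn_gt0.
rewrite -natr1; lra.
Qed.

Definition wf (z : R) (r : 'I_(2 ^ J)) : R := (mult r)%:R * z.

Section Norm.
Variables (L : R).
Hypothesis L0 : 0 < L.


Let b : R := 2 `^ ((2 - p) / p).
Let g : R := 2 `^ ((1 - p) / p).

Lemma small_base : 1 < b.
Proof.
case/andP: (p12) => p1 p2; rewrite -[ltLHS](_ : 1 `^ ((2 - p) / p) = 1); last by rewrite powR1.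
rewrite gt0_ltr_powR ?nnegrE ?ltr1n // divr_gt0 //; lra.
Qed.

Lemma large_base : 0 < g < 1.
Proof.
case/andP: (p12) => p1 p2; rewrite powR_gt0 //= /g.
have -> : (1 - p) / p = - ((p - 1) / p) by rewrite -mulNr opprB.
rewrite powRN invf_lt1 ?powR_gt0 //.
rewrite -[ltLHS](_ : 1 `^ ((p - 1) / p) = 1); last by rewrite powR1.
rewrite gt0_ltr_powR ?nnegrE ?ltr1n // divr_gt0 //; lra.
Qed.

Lemma rate_weight j : rate R j = weight j `^ (- p).
Proof. by rewrite powRN weight_p /rate exprVn. Qed.

Lemma powRD_gt0 (x y y' : R) : 0 < x -> x `^ (y + y') = x `^ y * x `^ y'.
Proof. by move=> x0; rewrite powRD // (gt_eqF x0) implybT. Qed.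

(** Below the truncation the second moment is a geometric sum of ratio [b > 1], as p < 2, hence
    dominated by its last term. *)
Lemma small_part z :
  Ex (fun r => (wf z r * (weight (lvl r) * `|z| <= L)%R%:R) ^+ 2) <=
  L `^ (2 - p) * `|z| `^ p * (b / (b - 1)).
Proof.
case/andP: (p12) => p1 p2.
have [->|z0] := eqVneq z 0.
  rewrite (eq_Ex (g := fun=> 0)) => [|r]; last by rewrite /wf mulr0 mul0r expr0n.
  by rewrite Ex_const ?card_ord ?expn_gt0 // normr0 powR0 // mulr0 mul0r.
have nz : 0 < `|z| by rewrite normr_gt0.
pose X := L `^ (2 - p) * `|z| `^ (p - 2).
have X0 : 0 <= X by rewrite mulr_ge0 ?powR_ge0.
pose F j : R := weight j ^+ 2 * `|z| ^+ 2 * (weight j * `|z| <= L)%R%:R.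
apply: (@le_trans _ _ (Ex (fun r => F (lvl r)))).
  apply: ler_Ex => r; rewrite /F.
  case: (weight (lvl r) * _ <= L); last by rewrite !mulr0 expr0n.
  rewrite !mulr1 /wf exprMn real_normK ?num_real // ler_wpM2r ?sqr_ge0 //.
  by rewrite lerXn2r ?nnegrE ?ler0n ?mult_le // ltW ?weight_gt0.
have F0 j : 0 <= F j by rewrite !mulr_ge0 ?exprn_ge0 // ltW ?weight_gt0.
apply: le_trans (Ex_lvl_le F0) _.
have -> : L `^ (2 - p) * `|z| `^ p * (b / (b - 1)) = `|z| ^+ 2 * (X * (b / (b - 1))).
  have -> : `|z| `^ p = `|z| ^+ 2 * `|z| `^ (p - 2).
    by rewrite -powR_mulrn ?normr_ge0 // -powRD_gt0 //; congr (_ `^ _); ring.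
  by rewrite /X; ring.
apply: (@le_trans _ _ (`|z| ^+ 2 * \sum_(0 <= j < J.+1) b ^+ j * (b ^+ j <= X)%R%:R)); last first.
  by rewrite ler_pM2l ?exprn_gt0 // geo_sum_le_top ?small_base.
rewrite mulr_sumr; apply: ler_sum => j _.
have bj : b ^+ j = rate R j * weight j ^+ 2.
  rewrite rate_weight -weight_pow -powR_mulrn ?ltW ?weight_gt0 //.
  by rewrite -powRD_gt0 ?weight_gt0 // addrC.
rewrite /F; have -> : rate R j * (weight j ^+ 2 * `|z| ^+ 2 * (weight j * `|z| <= L)%R%:R) =
  `|z| ^+ 2 * (b ^+ j * (weight j * `|z| <= L)%R%:R) by rewrite bj; ring.
rewrite ler_pM2l ?exprn_gt0 // ler_pM2l ?exprn_gt0 ?powR_gt0 // ler_nat.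
case: (boolP (weight j * _ <= L)) => // le; rewrite lt0b.
have -> : b ^+ j = (weight j * `|z|) `^ (2 - p) * `|z| `^ (p - 2).
  rewrite powRM ?normr_ge0 // ?ltW ?weight_gt0 // -mulrA -powRD_gt0 //.
  by rewrite (_ : 2 - p + (p - 2) = 0) ?powRr0 ?mulr1 ?weight_pow //; ring.
rewrite ler_pM2r ?powR_gt0 // ge0_ler_powR ?nnegrE ?mulr_ge0 ?normr_ge0 //; last 2 first.
- by rewrite ltW ?weight_gt0.
- exact: ltW.
lra.
Qed.

(** Beyond the truncation the first moment is a geometric sum of ratio [g < 1], as p > 1, hence
    dominated by its first term. *)
Lemma large_part z :
  Ex (fun r => `|wf z r * (L < weight (lvl r) * `|z|)%R%:R|) <=
  L `^ (1 - p) * `|z| `^ p / (1 - g).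
Proof.
case/andP: (p12) => p1 p2.
have [->|z0] := eqVneq z 0.
  rewrite (eq_Ex (g := fun=> 0)) => [|r]; last by rewrite /wf mulr0 mul0r normr0.
  by rewrite Ex_const ?card_ord ?expn_gt0 // normr0 powR0 // mulr0 mul0r.
have nz : 0 < `|z| by rewrite normr_gt0.
pose Y := L `^ (1 - p) * `|z| `^ (p - 1).
have Y0 : 0 <= Y by rewrite mulr_ge0 ?powR_ge0.
pose F j : R := weight j * `|z| * (L < weight j * `|z|)%R%:R.
apply: (@le_trans _ _ (Ex (fun r => F (lvl r)))).
  apply: ler_Ex => r; rewrite /F normrM normr_nat ler_wpM2r ?ler0n //.
  by rewrite normrM normr_nat ler_wpM2r // mult_le.
have F0 j : 0 <= F j by rewrite !mulr_ge0 // ltW ?weight_gt0.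
apply: le_trans (Ex_lvl_le F0) _.
have -> : L `^ (1 - p) * `|z| `^ p / (1 - g) = `|z| * (Y / (1 - g)).
  have -> : `|z| `^ p = `|z| * `|z| `^ (p - 1).
    rewrite -[X in X * _](powRr1 (normr_ge0 z)) -powRD_gt0 //; congr (_ `^ _); ring.
  by rewrite /Y; ring.
apply: (@le_trans _ _ (`|z| * \sum_(0 <= j < J.+1) g ^+ j * (g ^+ j <= Y)%R%:R)); last first.
  by rewrite ler_pM2l // geo_sum_le_bottom ?large_base.
rewrite mulr_sumr; apply: ler_sum => j _.
have gj : g ^+ j = rate R j * weight j.
  rewrite rate_weight -weight_pow -[X in _ * X]powRr1 ?ltW ?weight_gt0 //.
  by rewrite -powRD_gt0 ?weight_gt0 // addrC.
rewrite /F; have -> : rate R j * (weight j * `|z| * (L < weight j * `|z|)%R%:R) =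
  `|z| * (g ^+ j * (L < weight j * `|z|)%R%:R) by rewrite gj; ring.
rewrite ler_pM2l // ler_pM2l ?exprn_gt0 ?powR_gt0 // ler_nat.
case: (boolP (L < _)) => // lt; rewrite lt0b.
have -> : g ^+ j = (weight j * `|z|) `^ (1 - p) * `|z| `^ (p - 1).
  rewrite powRM ?normr_ge0 // ?ltW ?weight_gt0 // -mulrA -powRD_gt0 //.
  by rewrite (_ : 1 - p + (p - 1) = 0) ?powRr0 ?mulr1 ?weight_pow //; ring.
rewrite ler_pM2r ?powR_gt0 // -[1 - p]opprB !powRN lef_pV2 ?posrE ?powR_gt0 //; last first.
  by rewrite mulr_gt0 ?weight_gt0.
rewrite ge0_ler_powR ?nnegrE ?mulr_ge0 ?normr_ge0 //; last 3 first.
- exact: ltW.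
- by rewrite ltW ?weight_gt0.
- exact: ltW.
lra.
Qed.

End Norm.
End Weights.

Section StableBounds.
Variables (R : realType) (p : R) (J : nat) (zs : seq R) (L : R).
Hypotheses (p12 : 1 < p < 2) (L0 : 0 < L).
Hypothesis sumL : \sum_(z <- zs) `|z| `^ p = L `^ p.
Let p0 : 0 < p. Proof. by case/andP: p12 => /(lt_trans ltr01). Qed.
Let b : R := 2 `^ ((2 - p) / p).
Let g : R := 2 `^ ((1 - p) / p).
Let Lv0 : (0 < #|'I_(2 ^ J)|)%N. Proof. by rewrite card_ord expn_gt0. Qed.

(** The full second moment grows with [J], so the weights are truncated at the scale [L]: second
    moments control the small part, through |a| <= a^2 / (2 L) + L / 2, and first moments the large
    one. *)
Lemma stable_upper :
  Eseq (size zs) (fun s => `|signed_sum (wf p (J := J)) s zs|) <=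
  ((b / (b - 1) + 1) / 2 + (1 - g)^-1) * L.
Proof.
have Lpos := L0.
pose f1 z (r : 'I_(2 ^ J)) := wf p z r * (weight p (lvl r) * `|z| <= L)%R%:R.
pose f2 z (r : 'I_(2 ^ J)) := wf p z r * (L < weight p (lvl r) * `|z|)%R%:R.
have T0 : (0 < #|{: bool * 'I_(2 ^ J)}|)%N by rewrite card_prod card_bool muln_gt0.
apply: (@le_trans _ _ (Eseq (size zs) (fun s => (2 * L)^-1 * signed_sum f1 s zs ^+ 2 +
   (L / 2 + `|signed_sum f2 s zs|)))).
  apply: ler_Eseq => s _.
  rewrite (eq_signed_sum (f2 := fun z r => f1 z r + f2 z r)); last first.
    move=> z r; rewrite /f1 /f2 -mulrDr ltNge.
    by case: (_ <= L); rewrite ?addr0 ?add0r mulr1.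
  rewrite signed_sumD addrA; apply: le_trans (ler_normD _ _) _; rewrite lerD2r.
  move: (signed_sum f1 s zs) => a; rewrite -real_normK ?num_real //.
  have : 0 <= (2 * L)^-1 * (`|a| - L) ^+ 2 by rewrite mulr_ge0 ?sqr_ge0 // invr_ge0; lra.
  have -> : (2 * L)^-1 * (`|a| - L) ^+ 2 = (2 * L)^-1 * `|a| ^+ 2 + L / 2 - `|a|.
    by field; lra.
  lra.
rewrite EseqD EseqZ EseqD Eseq_const // signed_sum_sq //.
have h1 : \sum_(z <- zs) Ex (fun r => f1 z r ^+ 2) <= L ^+ 2 * (b / (b - 1)).
  apply: (@le_trans _ _ (\sum_(z <- zs) L `^ (2 - p) * `|z| `^ p * (b / (b - 1)))).
    by apply: ler_sum => z _; apply: small_part.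
  rewrite -mulr_suml -mulr_sumr sumL -powRD_gt0 // subrK.
  by rewrite powR_mulrn // ltW.
have h2 : Eseq (size zs) (fun s => `|signed_sum f2 s zs|) <= L * (1 - g)^-1.
  apply: le_trans (signed_sum_abs _ _ _) _ => //.
  apply: (@le_trans _ _ (\sum_(z <- zs) L `^ (1 - p) * `|z| `^ p / (1 - g))).
    by apply: ler_sum => z _; apply: large_part.
  rewrite -mulr_suml -mulr_sumr sumL -powRD_gt0 // subrK.
  by rewrite powRr1 // ltW.
have h3 := ler_wpM2l (_ : 0 <= (2 * L)^-1) h1.
apply: le_trans (lerD (h3 _) (lerD (lexx _) h2)) _; first by rewrite invr_ge0; lra.
have b1 := small_base p12; have g1 := large_base p12.
by apply: eq_ler; field; rewrite -/b -/g in b1 g1; lra.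
Qed.

Hypothesis sumJ : L `^ p <= 2 ^+ J.
Hypothesis zs1 : forall z, z \in zs -> z = 0 \/ 1 <= `|z|.

Lemma stable_prob z : z \in zs ->
  `|z| `^ p / (2 * L `^ p) <= Pr R (fun r => L / 2 <= `|wf p (J := J) z r|).
Proof.
have Lpos := L0; move=> zin; have [->|z1] := zs1 zin.
  by rewrite normr0 powR0 ?gt_eqF // mul0r; apply: Ex_ge0 => r; rewrite ler0n.
have nz : 0 < `|z| by lra.
have zL : `|z| `^ p <= L `^ p.
  rewrite -sumL (big_rem z) //= lerDl; apply: sumr_ge0 => y _; exact: powR_ge0.
have zp : 1 <= `|z| `^ p.
  by rewrite -[leLHS](powRr0 `|z|) ler_powR // ltW.
have Lp : 0 < L `^ p by rewrite powR_gt0.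
pose X := L `^ p / `|z| `^ p.
have X1 : 1 <= X by rewrite ler_pdivlMr ?mul1r; lra.
have XJ : X <= 2 ^+ J.
  apply: le_trans sumJ; rewrite ler_pdivrMr; last lra.
  by rewrite -[leLHS]mulr1 ler_pM2l.
(* The first level whose weight times [|z|] reaches [L]; rounding up loses at most a factor 2 in
   probability, and [sumJ] keeps the level within [J]. *)
have [j jJ /andP[Xj jX]] : exists2 j, (j <= J)%N & X <= 2 ^+ j < 2 * X.
  have ex : exists j, X <= 2 ^+ j by exists J.
  case: (ex_minnP ex) => j Xj jmin; exists j; first exact: jmin.
  rewrite Xj /=; case: j Xj jmin => [|j] Xj jmin; first by rewrite expr0; lra.
  rewrite exprS ltr_pM2l // ltNge; apply/negP => /jmin; by rewrite ltnn.
apply: (@le_trans _ _ (rate R j)).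
  have -> : `|z| `^ p / (2 * L `^ p) = (2 * X)^-1.
    by rewrite /X; field; rewrite !gt_eqF //; lra.
  rewrite /rate exprVn lef_pV2 ?posrE ?exprn_gt0 //; lra.
rewrite -(Ex_chosen R jJ); apply: ler_Ex => r; rewrite ler_nat.
have [|//] := boolP (r < _)%N; rewrite le_lvl // => jl; rewrite lt0b.
have wj : L / `|z| <= weight p j.
  rewrite leNgt; apply/negP => lt.
  have := gt0_ltr_powR p0 _ _ lt; rewrite !nnegrE weight_p // powRM ?invr_ge0 ?ltW //.
  rewrite -powR_inv1 ?ltW // -powRrM mulN1r powRN -/X => h.
  - have := h isT isT; lra.
  - by rewrite divr_gt0.
  - exact: weight_gt0.
have wl : weight p j <= weight p (lvl r).
  by rewrite /weight ler_powR ?ler1n // ler_pM2r ?invr_gt0 // ler_nat.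
have := mult_ge p12 r; rewrite /wf normrM normr_nat.
have := wj; rewrite ler_pdivrMr // => wz mw.
have := ler_wpM2r (normr_ge0 z) wl; have := ler_wpM2r (normr_ge0 z) mw; lra.
Qed.

(** The probabilities that single terms reach L/2 add up to at least 1/2, so some term does with
    probability at least 1 - exp(-1/2) >= 1/4. *)
Lemma stable_lower :
  L / 8 <= Eseq (size zs) (fun s => `|signed_sum (wf p (J := J)) s zs|).
Proof.
have Lpos := L0.
apply: le_trans (signed_sum_lower Lv0 _ _ (_ : 0 <= L / 2)); last by lra.
have Lp : 0 < L `^ p by rewrite powR_gt0.
suff : \prod_(z <- zs) (1 - Pr R (fun r => L / 2 <= `|wf p (J := J) z r|)) <= 3 / 4.
  move=> h; have := ler_wpM2l (ltW L0) h; set P := \prod_(z <- zs) _; lra.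
apply: (@le_trans _ _ (expR (- 2^-1))); last first.
  have := @expRN_le R 2^-1; rewrite invr_ge0 ler0n invf_le1 // ler1n => /(_ isT); lra.
have -> : - 2^-1 = \sum_(z <- zs) - (`|z| `^ p / (2 * L `^ p)).
  by rewrite sumrN -mulr_suml sumL; congr (- _); field; rewrite gt_eqF.
rewrite expR_sum big_seq [leRHS]big_seq; apply: ler_prod => z zin; apply/andP; split.
  rewrite subr_ge0 -(Ex_const (1 : R) Lv0); apply: ler_Ex => r.
  by rewrite lern1 leq_b1.
apply: le_trans (expR_ge1Dx _); rewrite lerD2l lerN2; exact: stable_prob.
Qed.

End StableBounds.

(** A uniform threshold separates two values with probability proportional to their difference; its
    range is twice that of the values to keep [cutd] at most 1/2. *)
Lemma threshold_cuts (R : realType) (P Gt : finType) (h : Gt -> P -> nat) m :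
  dyadic Gt -> (forall c x, (h c x <= 2 ^ m)%N) ->
  exists (Cut : finType) (cut : Cut -> P -> bool),
    [/\ dyadic Cut, forall x y, cutd R cut x y <= 2^-1 &
        forall x y, 2 ^+ m.+1 * cutd R cut x y =
          Ex (fun c => `|(h c x)%:R - (h c y)%:R|)].
Proof.
move=> dG hm; pose cut (c : Gt * 'I_(2 ^ m.+1)) x := (c.2 < h c.1 x)%N.
have hm1 c x : (h c x <= 2 ^ m.+1)%N.
  by apply: leq_trans (hm c x) _; rewrite leq_exp2l.
have N0 : (0 < 2 ^ m.+1)%N by rewrite expn_gt0.
have key x y : 2 ^+ m.+1 * cutd R cut x y = Ex (fun c => `|(h c x)%:R - (h c y)%:R|).
  rewrite /cutd /Pr Ex_pair -ExZ; apply: eq_Ex => c; rewrite /cut /=.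
  have := hm1 c x; have := hm1 c y; move: (h c x) (h c y) => a b.
  wlog ab : a b / (a <= b)%N.
    move=> H; have [ab|/ltnW ab] := leqP a b; first exact: H.
    move=> hb ha; rewrite distrC -H //; congr (_ * _).
    by apply: eq_Ex => k; rewrite eq_sym.
  move=> hb ha; rewrite (eq_Ex (g := fun k : 'I_(2 ^ m.+1) => (k < b)%N%:R - (k < a)%N%:R)).
    rewrite ExB !Ex_ord_lt // natrX distrC ger0_norm ?subr_ge0 ?ler_nat //.
    by field; rewrite expf_neq0 ?pnatr_eq0.
  move=> k; have [ka|ka] := ltnP k a; last by case: (k < b)%N; rewrite subr0.
  by rewrite (leq_trans ka ab) subrr.
exists (Gt * 'I_(2 ^ m.+1))%type, cut; split=> //.
  exact: dyadic_prod dG (dyadic_ord _).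
move=> x y; rewrite -(ler_pM2l (exprn_gt0 m.+1 (ltr0Sn R 1))) key.
rewrite exprS mulrAC mulfV ?mul1r // ?pnatr_eq0 // -[leRHS](Ex_const (2 ^+ m : R) (dyadic_gt0 dG)).
apply: ler_Ex => c; rewrite ler_distl.
have := hm c x; have := hm c y; rewrite -!(ler_nat R) !natrX => hy hx.
have := ler0n R (h c x); have := ler0n R (h c y).
by move: hx hy; set a := (h c x)%:R; set a' := (h c y)%:R; lra.
Qed.

Lemma up_log_bound n : (0 < n)%N -> (2 ^ up_log 2 n <= 2 * n)%N.
Proof.
move=> n0; have [n1|n1] := leqP n 1; first by have -> : n = 1%N by lia.
have /andP[] := up_log_bounds (isT : 1 < 2)%N n1.
have : (0 < up_log 2 n)%N by rewrite up_log_gt0 n1.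
by case: (up_log 2 n) => // k _ /= h _; rewrite expnS; lia.
Qed.

Section LpEmbedding.
Variables (R : realType) (p : R).

Definition embeds (d Delta : nat) (C Mmax : R) :=
  exists (Cut : finType) (cut : Cut -> point d Delta -> bool) (M : R),
    [/\ dyadic Cut, 0 < M <= Mmax, forall x y, cutd R cut x y <= 2^-1 &
        forall x y, lp_dist p x y <= M * cutd R cut x y <= C * lp_dist p x y].

Lemma embeds_le d Delta C C' Mm Mm' : C <= C' -> Mm <= Mm' ->
  embeds d Delta C Mm -> embeds d Delta C' Mm'.
Proof.
move=> CC MM [Cut [cut [M [dC /andP[M0 M1] d2 Dp]]]]; exists Cut, cut, M; split=> //.
  by rewrite M0 (le_trans M1 MM).
move=> x y; have /andP[-> h] := Dp x y; apply: le_trans h _.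
by rewrite ler_wpM2r // powR_ge0.
Qed.

Variables (d Delta : nat).
Implicit Types x y : point d Delta.

Definition diffs x y : seq R := [seq Defs.coord R x i - Defs.coord R y i | i <- enum 'I_d].

Lemma size_diffs x y : size (diffs x y) = d.
Proof. by rewrite size_map size_enum_ord. Qed.

Lemma sum_diffs x y (F : R -> R) :
  \sum_(z <- diffs x y) F z = \sum_i F (Defs.coord R x i - Defs.coord R y i).
Proof. by rewrite big_map big_enum. Qed.

Lemma diffs_int x y z : z \in diffs x y -> z = 0 \/ 1 <= `|z| <= Delta%:R.
Proof.
case/mapP => i _ ->; rewrite /Defs.coord -!natr1 opprD addrACA subrr addr0.
have := ltn_ord (x i); have := ltn_ord (y i).
move: (x i : nat) (y i : nat) => a b bD aD.
wlog ab : a b aD bD / (a <= b)%N.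
  move=> H; have [ab|/ltnW ab] := leqP a b; first exact: H.
  by rewrite distrC -opprB; have [->|->] := H _ _ bD aD ab; [left; rewrite oppr0|right].
move: ab; rewrite leq_eqVlt => /orP[/eqP->|ab]; first by left; rewrite subrr.
right; rewrite distrC -natrB ?(ltnW ab) // normr_nat ler1n ler_nat; lia.
Qed.

Lemma signed_sum_tuple (Lv : finType) (f : R -> Lv -> R) (t : d.-tuple (bool * Lv)) x y :
  signed_sum f t (diffs x y) =
  \sum_i sgb R (tnth t i).1 * f (Defs.coord R x i - Defs.coord R y i) (tnth t i).2.
Proof.
rewrite /diffs; have -> : (t : seq _) = [seq tnth t i | i <- enum 'I_d].
  by rewrite map_tnth_enum.
by rewrite -big_enum /=; elim: (enum 'I_d) => [|i s IH]; rewrite ?big_nil // big_cons /= IH.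
Qed.

Lemma lp_dist_pow x y : 0 < p ->
  \sum_(z <- diffs x y) `|z| `^ p = (lp_dist p x y) `^ p.
Proof.
move=> p0; rewrite /lp_dist -powRrM mulVf ?gt_eqF // powRr1.
  exact: (sum_diffs x y (fun z => `|z| `^ p)).
by apply: sumr_ge0 => i _; apply: powR_ge0.
Qed.

Lemma lp_dist0 x y : 0 < p -> lp_dist p x y = 0 -> forall z, z \in diffs x y -> z = 0.
Proof.
move=> p0 l0 z; have := lp_dist_pow x y p0; rewrite l0 powR0 ?gt_eqF // => s0.
have := psumr_eq0P (I := 'I_d) (P := predT) (F := fun i => `|Defs.coord R x i - Defs.coord R y i| `^ p).
rewrite -(sum_diffs x y (fun z => `|z| `^ p)) => /(_ (fun i _ => powR_ge0 _ _) s0) e.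
by case/mapP => i _ ->; have := e i isT; move/powR_eq0_eq0/eqP; rewrite normr_eq0 => /eqP.
Qed.

Lemma signed_sum0 (Lv : finType) (f : R -> Lv -> R) s zs :
  (forall z, z \in zs -> z = 0) -> (forall r, f 0 r = 0) -> signed_sum f s zs = 0.
Proof.
move=> z0 f0; elim: zs s z0 => [|z zs IH] [|c s] //= z0.
rewrite (z0 z) ?mem_head // f0 mulr0 add0r IH // => y yz.
by apply: z0; rewrite inE yz orbT.
Qed.

Lemma lp_dist_01 x y : 1 <= p -> lp_dist p x y = 0 \/ 1 <= lp_dist p x y.
Proof.
move=> p1; have p0 : 0 < p by lra.
have [z0|/allPn[z zin z0]] := boolP (all (fun z => z == 0) (diffs x y)).
  left; rewrite /lp_dist -(sum_diffs x y (fun z => `|z| `^ p)) big_seq big1.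
    by rewrite powR0 // invr_eq0 gt_eqF.
  by move=> z /(allP z0)/eqP->; rewrite normr0 powR0 // gt_eqF.
right; case: (diffs_int zin) z0 => [->|/andP[z1 _] z0]; first by rewrite eqxx.
have : 1 <= lp_dist p x y `^ p.
  rewrite -lp_dist_pow // (big_rem z) //=.
  have h : 1 <= `|z| `^ p by rewrite -[leLHS](powRr0 `|z|) ler_powR // ltW.
  by apply: le_trans h _; rewrite lerDl; apply: sumr_ge0 => w _; apply: powR_ge0.
rewrite !leNgt; apply: contra => lt; rewrite -[ltRHS](_ : 1 `^ p = 1); last by rewrite powR1.
by rewrite gt0_ltr_powR ?nnegrE ?powR_ge0.
Qed.

Hypotheses (d0 : (0 < d)%N) (Delta0 : (0 < Delta)%N).

(* In the proof, the coordinates with a negative sign are subtracted from Delta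
   so that the sums are natural numbers; this does not change differences. *)
Lemma signed_cuts (Lv : finType) (m : Lv -> nat) (mm : nat) : dyadic Lv ->
  (0 < mm)%N -> (forall r, (m r <= mm)%N) ->
  exists (Cut : finType) (cut : Cut -> point d Delta -> bool) (M : R),
    [/\ dyadic Cut, 0 < M <= 4 * (d * mm * Delta)%:R, forall x y, cutd R cut x y <= 2^-1 &
      forall x y, M * cutd R cut x y =
        Eseq d (fun s => `|signed_sum (fun z r => (m r)%:R * z) s (diffs x y)|)].
Proof.
move=> dL mm0 mle.
pose h (t : d.-tuple (bool * Lv)) x : nat := (\sum_(i < d)
  m (tnth t i).2 * (if (tnth t i).1 then (x i).+1 else Delta - (x i).+1))%N.
have hle t x : (h t x <= d * mm * Delta)%N.
  rewrite -mulnA -[X in (_ <= X * _)%N](card_ord d) -sum_nat_const.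
  by apply: leq_sum => i _; apply: leq_mul => //; case: ifP => _ //; apply: leq_subr.
pose e := up_log 2 (d * mm * Delta).
have h2 t x : (h t x <= 2 ^ e)%N by apply: leq_trans (hle t x) (up_logP _ _).
have dT : dyadic (d.-tuple (bool * Lv)).
  by apply: dyadic_tuple; apply: dyadic_prod dyadic_bool dL.
have [Cut [cut [dC d2 hc]]] := threshold_cuts R dT h2.
exists Cut, cut, (2 ^+ e.+1); split=> //.
  rewrite exprn_gt0 //= -natrX -natrM ler_nat expnS -[4%N]/(2 * 2)%N -mulnA leq_mul2l /=.
  by rewrite up_log_bound // !muln_gt0 d0 mm0.
move=> x y; rewrite hc.
rewrite -(Ex_tuple d (fun s => `|signed_sum (fun z r => (m r)%:R * z) s (diffs x y)|)).
apply: eq_Ex => t; rewrite signed_sum_tuple /h !natr_sum -sumrB; congr (`|_|).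
apply: eq_bigr => i _; rewrite /sgb /Defs.coord !natrM; case: (tnth t i).1.
  by rewrite mul1r mulrBr.
by rewrite !natrB ?ltn_ord //; ring.
Qed.

Lemma sum_pow_diffs_le x y : 0 < p ->
  \sum_(z <- diffs x y) `|z| `^ p <= d%:R * Delta%:R `^ p.
Proof.
move=> p0; rewrite mulr_natl -[d in leRHS]card_ord -sumr_const sum_diffs.
apply: ler_sum => i _.
have zi : Defs.coord R x i - Defs.coord R y i \in diffs x y.
  by apply/mapP; exists i; rewrite ?mem_enum.
case: (diffs_int zi) => [->|/andP[_ h]].
  by rewrite normr0 powR0 ?gt_eqF // powR_ge0.
by rewrite ge0_ler_powR ?nnegrE ?normr_ge0 ?ler0n // ltW.
Qed.

Lemma lp_dist_le x y : 1 <= p -> lp_dist p x y <= d%:R * Delta%:R.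
Proof.
move=> p1; have p0 : 0 < p by lra.
have h : \sum_(z <- diffs x y) `|z| `^ p <= (d%:R * Delta%:R) `^ p.
  apply: le_trans (sum_pow_diffs_le x y p0) _.
  by rewrite powRM ?ler0n // ler_wpM2r ?powR_ge0 // le1r_powR // ler1n.
have p1' : 0 <= p^-1 by rewrite invr_ge0 ltW.
have := ge0_ler_powR p1' _ _ h; rewrite !nnegrE powR_ge0 sumr_ge0 => [/(_ isT isT)|z _]; last first.
  exact: powR_ge0.
rewrite lp_dist_pow //; have l0 : 0 <= lp_dist p x y := powR_ge0 _ _.
move: (lp_dist p x y) l0 => l l0.
by rewrite -!powRrM mulfV ?gt_eqF // !powRr1 ?mulr_ge0.
Qed.

Lemma l1_embedding : p = 1 -> embeds d Delta 1 (8 * (d * Delta)%:R).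
Proof.
move=> p1; pose m := up_log 2 d; pose e := up_log 2 Delta.
have dm : (d <= 2 ^ m)%N by apply: up_logP.
(* Indices from [d] on give the constant 0, so that the random coordinate has a dyadic range. *)
pose h (c : 'I_(2 ^ m)) (x : point d Delta) : nat :=
  if insub (val c) is Some i then (x i).+1 else 0%N.
have hle c x : (h c x <= 2 ^ e)%N.
  apply: (@leq_trans Delta); last exact: up_logP.
  by rewrite /h; case: insub => // i.
have [Cut [cut [dC d2 hc]]] := threshold_cuts R (dyadic_ord m) hle.
have two0 k : 0 < 2 ^+ k :> R by rewrite exprn_gt0.
exists Cut, cut, (2 ^+ m * 2 ^+ e.+1); split=> //.
  rewrite mulr_gt0 //= -!natrX -!natrM ler_nat expnS.
  apply: (@leq_trans ((2 * d) * (2 * (2 * Delta)))); last lia.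
  by rewrite !(leq_mul, up_log_bound).
move=> x y; suff -> : 2 ^+ m * 2 ^+ e.+1 * cutd R cut x y = lp_dist p x y.
  by rewrite mul1r lexx.
rewrite -mulrA hc /lp_dist p1 invr1 powRr1; last first.
  by apply: sumr_ge0 => i _; apply: powR_ge0.
rewrite /Ex card_ord natrX mulrC divfK ?gt_eqF //.
rewrite (eq_bigr (fun c : 'I_(2 ^ m) => if (c < d)%N then `|(h c x)%:R - (h c y)%:R| else 0)).
  rewrite -big_mkcond /= (big_ord_narrow dm) /=; apply: eq_bigr => i _.
  by rewrite powRr1 ?normr_ge0 // /h /= valK.
move=> c _; case: ltnP => // dc.
by rewrite /h insubF ?subrr ?normr0 //; apply/negbTE; rewrite -leqNgt.
Qed.

Lemma l2_embedding : p = 2 -> embeds d Delta 4 (16 * (d * Delta)%:R).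
Proof.
move=> p2; have p0 : 0 < p by rewrite p2.
have [Cut [cut [M [dC /andP[M0 Mle] d2 hc]]]] :=
  @signed_cuts 'I_(2 ^ 0) (fun=> 1%N) 1 (dyadic_ord 0) isT (fun=> leqnn _).
have Lv0 : (0 < #|'I_(2 ^ 0)|)%N by rewrite card_ord.
exists Cut, cut, (4 * M); split=> //.
  by rewrite mulr_gt0 //= (_ : 16 = 4 * 4) ?natrM -?mulrA ?ler_pM2l // -natrM; [move: Mle; rewrite muln1|].
move=> x y; rewrite -mulrA hc.
have [l0|l0] := eqVneq (lp_dist p x y) 0.
  rewrite l0 (eq_Eseq (g := fun=> 0)) => [|s _]; last first.
    rewrite signed_sum0 ?normr0 // => [z|r]; first exact: (lp_dist0 p0 l0).
    by rewrite mulr0.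
  by rewrite Eseq_const ?card_prod ?card_bool ?muln_gt0 // !mulr0 lexx.
have Lp : 0 < lp_dist p x y by rewrite lt_neqAle eq_sym l0 powR_ge0.
have sq : \sum_(z <- diffs x y) z ^+ 2 = lp_dist p x y ^+ 2.
  transitivity (lp_dist p x y `^ p); last by rewrite [X in _ `^ X = _]p2 powR_mulrn ?powR_ge0.
  rewrite -lp_dist_pow //; apply: eq_bigr => z _.
  by rewrite p2 powR_mulrn ?normr_ge0 // real_normK ?num_real.
set L := lp_dist p x y in Lp sq *.
have e1 (s : seq (bool * 'I_(2 ^ 0))) :
    signed_sum (fun z _ => 1%:R * z) s (diffs x y) = signed_sum (fun z _ => z) s (diffs x y).
  by apply: eq_signed_sum => z r; rewrite mul1r.
rewrite (eq_Eseq (g := fun s => `|signed_sum (fun z _ => z) s (diffs x y)|)) => [|s _]; last by rewrite e1.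
rewrite -[d in Eseq d](size_diffs x y); apply/andP; split.
  have := khintchine_lower Lv0 Lp sq; lra.
rewrite ler_pM2l //.
have := signed_sum_sq Lv0 (fun z _ => z) (diffs x y).
rewrite (eq_bigr (fun z => z ^+ 2)) ?sq => [sqE|z _]; last by rewrite Ex_const.
have T0 : (0 < #|{: bool * 'I_(2 ^ 0)}|)%N by rewrite card_prod card_bool card_ord.
apply: (@le_trans _ _ (Eseq (size (diffs x y)) (fun s => (2 * L)^-1 *
    signed_sum (fun z (_ : 'I_(2 ^ 0)) => z) s (diffs x y) ^+ 2 + L / 2))).
  apply: ler_Eseq => s _; move: (signed_sum _ _ _) => a.
  rewrite -[a ^+ 2]real_normK ?num_real //.
  have : 0 <= (2 * L)^-1 * (`|a| - L) ^+ 2 by rewrite mulr_ge0 ?sqr_ge0 // invr_ge0; lra.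
  have -> : (2 * L)^-1 * (`|a| - L) ^+ 2 = (2 * L)^-1 * `|a| ^+ 2 + L / 2 - `|a|.
    by field; lra.
  lra.
rewrite EseqD Eseq_const // EseqZ sqE; apply: eq_ler; field; lra.
Qed.

Lemma stable_embedding : 1 < p < 2 ->
  embeds d Delta (8 * ((2 `^ ((2 - p) / p) / (2 `^ ((2 - p) / p) - 1) + 1) / 2 +
                       (1 - 2 `^ ((1 - p) / p))^-1)) (64 * (d * Delta)%:R ^+ 3).
Proof.
move=> p12; have [p1 p2] := andP p12; have p0 : 0 < p by lra.
(* [d * Delta ^ 2] bounds the p-th power of every distance, as p < 2, and multiplicities up to
   [2 ^ J] stay polynomial. *)
pose J := up_log 2 (d * Delta ^ 2).
have dD0 : (0 < d * Delta ^ 2)%N by rewrite muln_gt0 d0 expn_gt0 Delta0.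
have mle (r : 'I_(2 ^ J)) : (mult p r <= 2 ^ J)%N.
  rewrite -(ler_nat R); apply: le_trans (mult_le p r) _.
  rewrite natrX -powR_mulrn // /weight ler_powR ?ler1n //.
  apply: (@le_trans _ _ (lvl r)%:R); last by rewrite ler_nat lvl_le.
  by rewrite ler_pdivrMr // ler_peMr // ltW.
have [Cut [cut [M [dC /andP[M0 Mle] d2 hc]]]] :=
  signed_cuts (dyadic_ord J) (expn_gt0 2 J) mle.
exists Cut, cut, (8 * M); split=> //.
  rewrite mulr_gt0 //=; apply: le_trans (ler_wpM2l _ Mle) _ => //.
  rewrite -!natrX -!natrM ler_nat.
  apply: (@leq_trans (8 * (4 * (d * (2 * (d * Delta ^ 2)) * Delta)))%N).
    by rewrite !leq_mul // up_log_bound.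
  have -> : (8 * (4 * (d * (2 * (d * Delta ^ 2)) * Delta)) = 64 * (d * d * 1 * (Delta ^ 3)))%N.
    by rewrite !expnS; ring.
  have d3 : (d ^ 3 = d * d * d)%N by rewrite !expnS expn0 muln1 mulnA.
  by rewrite expnMn d3 muln1 leq_mul2l leq_mul2r leq_pmulr // !orbT.
move=> x y; rewrite -mulrA hc.
have [l0|l0] := eqVneq (lp_dist p x y) 0.
  rewrite l0 (eq_Eseq (g := fun=> 0)) => [|s _]; last first.
    rewrite signed_sum0 ?normr0 // => [z|r]; first exact: (lp_dist0 p0 l0).
    by rewrite mulr0.
  by rewrite Eseq_const ?card_prod ?card_bool ?muln_gt0 // ?card_ord ?expn_gt0 // !mulr0 lexx.
have Lp : 0 < lp_dist p x y by rewrite lt_neqAle eq_sym l0 powR_ge0.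
have sumL := lp_dist_pow x y p0.
have zs1 z : z \in diffs x y -> z = 0 \/ 1 <= `|z|.
  by move=> /diffs_int[->|/andP[h _]]; [left|right].
have sumJ : lp_dist p x y `^ p <= 2 ^+ J.
  rewrite -sumL; apply: le_trans (sum_pow_diffs_le x y p0) _.
  rewrite -natrX; apply: (@le_trans _ _ (d * Delta ^ 2)%:R); last by rewrite ler_nat up_logP.
  rewrite natrM ler_wpM2l // natrX -powR_mulrn // ler_powR ?ler1n //; exact: ltW.
have lo := stable_lower p12 Lp sumL sumJ zs1.
have up := stable_upper J p12 Lp sumL.
rewrite size_diffs in lo up; rewrite /wf in lo up.
by apply/andP; split; [lra | rewrite -mulrA ler_pM2l].
Qed.

End LpEmbedding.

(** At p = 1 and p = 2 one of the two geometric ratios becomes 1 and the stable constant blows up,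
    so the endpoints use a random coordinate and plain random signs. *)
Lemma lp_embedding (R : realType) (p : R) : 1 <= p <= 2 ->
  exists2 C : R, 1 <= C & forall d Delta, (0 < d)%N -> (0 < Delta)%N ->
    embeds p d Delta C (64 * (d * Delta)%:R ^+ 3).
Proof.
move=> /andP[p1 p2].
have dD d Delta : (0 < d)%N -> (0 < Delta)%N -> 1 <= (d * Delta)%:R :> R.
  by move=> d0 D0; rewrite ler1n muln_gt0 d0.
have cube (t : R) : 1 <= t -> t <= t ^+ 3.
  by move=> t1; rewrite -[leLHS]expr1 ler_weXn2l.
have [e1|n1] := eqVneq p 1.
  exists 1 => // d Delta d0 D0; apply: embeds_le (l1_embedding d0 D0 e1) => //.
  have := cube _ (dD _ _ d0 D0); have := dD _ _ d0 D0; lra.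
have [e2|n2] := eqVneq p 2.
  exists 4; first by rewrite ler1n.
  move=> d Delta d0 D0; apply: embeds_le (l2_embedding d0 D0 e2) => //.
  have := cube _ (dD _ _ d0 D0); have := dD _ _ d0 D0; lra.
have p12 : 1 < p < 2 by rewrite !lt_neqAle eq_sym n1 n2 p1 p2.
eexists; last by move=> d Delta d0 D0; exact: stable_embedding d0 D0 p12.
have b1 := small_base p12; have /andP[g0 g1] := large_base p12.
set b := 2 `^ ((2 - p) / p) in b1 *; set g := 2 `^ ((1 - p) / p) in g0 g1 *.
have : 0 <= b / (b - 1) by rewrite divr_ge0; lra.
have : 0 <= (1 - g)^-1 by rewrite invr_ge0; lra.
lra.
Qed.

(** * Choice of the parameters *)

Section Sizes.
Variable R : realType.

Lemma ln_le_rlog n : (0 < n)%N -> ln n%:R + 1 <= rlog n%:R :> R.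
Proof.
move=> n0; rewrite /rlog addrC lerD2l ler_ln ?posrE ?ltr0n //; last by rewrite ltr_wpDr.
by rewrite lerDr.
Qed.

Lemma rlog_ge1 n : 1 <= rlog n%:R :> R.
Proof. by rewrite /rlog lerDl ln_ge0 // lerDl. Qed.

Lemma ln2_ge : 2^-1 <= ln 2 :> R.
Proof.
rewrite -[leLHS](expRK (2^-1 : R)) ler_ln ?posrE ?expR_gt0 //.
have := @expR_le R 2^-1; rewrite invr_ge0 ler0n lexx => /(_ isT) h.
by apply: le_trans h _; lra.
Qed.

Lemma ln2_le : ln 2 <= 1 :> R.
Proof. by have := @le_ln1Dx R 1; rewrite -[1 + 1]/(2 : R); apply; lra. Qed.

Definition logsize n d Delta : R := rlog n%:R + rlog d%:R + rlog Delta%:R.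

Lemma logsize_ge n d Delta : 3 <= logsize n d Delta.
Proof.
have := rlog_ge1 n; have := rlog_ge1 d; have := rlog_ge1 Delta.
by rewrite /logsize; lra.
Qed.

Lemma up_log_le_logsize n d Delta : (0 < n)%N -> (0 < d)%N -> (0 < Delta)%N ->
  (up_log 2 (n * d * Delta))%:R <= 2 * logsize n d Delta.
Proof.
move=> n0 d0 D0; set u := up_log _ _.
have K0 : (0 < n * d * Delta)%N by rewrite !muln_gt0 n0 d0.
have h : u%:R * ln 2 <= ln 2 + (ln n%:R + ln d%:R + ln Delta%:R) :> R.
  rewrite mulr_natl -lnXn ?ltr0n // -!lnM ?posrE ?mulr_gt0 ?ltr0n //.
  rewrite ler_ln ?posrE ?exprn_gt0 ?mulr_gt0 ?ltr0n //.
  by rewrite -natrX -!natrM ler_nat up_log_bound.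
have := ln2_ge; have := ln2_le; have := ler_wpM2l (ler0n R u) ln2_ge.
have := ln_le_rlog n0; have := ln_le_rlog d0; have := ln_le_rlog D0.
rewrite /logsize; move: h; set l := _ * ln 2; lra.
Qed.

(** [B] is a power of two above a linear function of log(n d Delta). One half of the exponent pays
    for [a0] and the cube; [12 * e0 <= B] makes the other half pay for B^6. *)
Lemma enough_levels n d Delta a0 : (0 < n)%N -> (0 < d)%N -> (0 < Delta)%N ->
  exists e0, (2 ^ (a0 + 23) * nlev e0 ^ 6 * (n * d * Delta) ^ 3 <= 2 ^ nlev e0)%N /\
    (nlev e0)%:R <= (280 + 4 * a0%:R) * logsize n d Delta.
Proof.
move=> n0 d0 D0; set u := up_log 2 (n * d * Delta).
pose b := (128 + 2 * a0 + 6 * u)%N; exists (up_log 2 b); split.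
  have bB : (b <= nlev (up_log 2 b))%N by apply: up_logP.
  have e12 : (12 * up_log 2 b <= nlev (up_log 2 b))%N.
    have : (7 <= up_log 2 b)%N.
      by rewrite leqNgt; apply/negP => lt; have := up_logP b (isT : (1 < 2)%N);
        rewrite leqNgt => /negP; apply; apply: (@leq_trans (2 ^ 6).+1);
        rewrite ?ltnS ?leq_exp2l // /b; lia.
    rewrite /nlev; elim: (up_log 2 b) => // k IH; rewrite leq_eqVlt => /orP[/eqP<-//|k7].
    by have := IH k7; rewrite expnS; lia.
  have Ku : (n * d * Delta <= 2 ^ u)%N by apply: up_logP.
  apply: (@leq_trans (2 ^ (a0 + 23) * 2 ^ (up_log 2 b * 6) * 2 ^ (u * 3))%N).
    by rewrite !leq_mul // -?expnM ?leqnn // expnM leq_exp2r.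
  by rewrite -!expnD leq_exp2l //; move: bB e12; rewrite /b; lia.
have b0 : (0 < b)%N by rewrite /b; lia.
apply: (@le_trans _ _ (2 * b)%:R); first by rewrite ler_nat up_log_bound.
have ux := up_log_le_logsize n0 d0 D0; rewrite -/u in ux.
have x3 := logsize_ge n d Delta.
have a00 : 0 <= a0%:R :> R := ler0n _ _.
have -> : (2 * b)%:R = 2 * (128 + 2 * a0%:R + 6 * u%:R) :> R by rewrite /b; ring.
move: x3 ux; set x := logsize _ _ _ => x3 ux.
have : 0 <= a0%:R * (x - 1) by rewrite mulr_ge0 //; lra.
lra.
Qed.

End Sizes.

Section EmdFacts.
Variables (R : realType) (p : R) (n d Delta : nat).
Implicit Types A B : n.-tuple (point d Delta).

Lemma EMD_le_cost A B s : EMD p A B <= matching_cost p A B s.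
Proof. exact: bigmin_le_cond. Qed.

Lemma EMD_attained A B : exists s, EMD p A B = matching_cost p A B s.
Proof.
rewrite /EMD; apply: (big_ind (fun e => exists s, e = matching_cost p A B s)).
- by exists 1%g.
- by move=> x y [s ->] [t ->]; rewrite minElt; case: ifP => _; [exists s|exists t].
- by move=> s _; exists s.
Qed.

Hypothesis p1 : 1 <= p.

Lemma EMD_bound A B : EMD p A B <= d%:R * Delta%:R * n%:R.
Proof.
apply: le_trans (EMD_le_cost A B 1%g) _.
rewrite mulr_natr -[n in leRHS]card_ord -sumr_const; apply: ler_sum => i _.
have [d0|d0] := posnP d.
  rewrite /lp_dist big1 ?powR0 ?invr_eq0 ?mulr_ge0 //; first by rewrite gt_eqF // (lt_le_trans ltr01).
  by move=> j; have := leq_ltn_trans (leq0n j) (ltn_ord j); rewrite [X in (_ < X)%N -> _]d0.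
exact: lp_dist_le.
Qed.

Lemma EMD_01 A B : EMD p A B = 0 \/ 1 <= EMD p A B.
Proof.
have [s ->] := EMD_attained A B.
have h i : lp_dist p (tnth A i) (tnth B (s i)) = 0 \/ 1 <= lp_dist p (tnth A i) (tnth B (s i)).
  exact: lp_dist_01.
have [z|/allPn[i _ iz]] := boolP (all (fun i => lp_dist p (tnth A i) (tnth B (s i)) == 0) (enum 'I_n)).
  by left; apply: big1 => i _; apply/eqP/(allP z); rewrite mem_enum.
right; rewrite /matching_cost (bigD1 i) //=.
case: (h i) iz => [->|h1 _]; first by rewrite eqxx.
by apply: le_trans h1 _; rewrite lerDl; apply: sumr_ge0 => j _; apply: powR_ge0.
Qed.

End EmdFacts.

(** * A trial with all parameters fixed *)

Section EmdTrial.
Variables (R : realType) (p Ce : R) (a0 : nat).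
Hypotheses (p1 : 1 <= p) (Ce1 : 1 <= Ce) (Cea0 : Ce ^+ 2 <= 2 ^+ a0).

Variables (n d Delta e0 : nat).
Hypotheses (n0 : (0 < n)%N) (d0 : (0 < d)%N) (Delta0 : (0 < Delta)%N).
Hypothesis levels :
  (2 ^ (a0 + 23) * nlev e0 ^ 6 * (n * d * Delta) ^ 3 <= 2 ^ nlev e0)%N.

Local Notation B := (nlev e0).
Let dD : R := (d * Delta)%:R.
Let Dm : R := Ce * dD.
(** [eta] makes its share of [kappa1_small] equal to 1/8. The power 6 in [G] answers the B^2 pairs
    of rates, the B^2 of [Eut_bound_imb] and the B^2 in 1/[eta]. *)
Let eta : R := (384 * Ce * B%:R ^+ 2)^-1.
Let G : R := 1024 * 1024 * Ce ^+ 2 * B%:R ^+ 6.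

Let Ce0 : 0 < Ce. Proof. by rewrite (lt_le_trans ltr01). Qed.
Let B1 : 1 <= B%:R :> R. Proof. by rewrite ler1n expn_gt0. Qed.
Let n1 : 1 <= n%:R :> R. Proof. by rewrite ler1n. Qed.
Let dD1 : 1 <= dD. Proof. by rewrite ler1n muln_gt0 d0. Qed.

Let G1 : 1 < G.
Proof.
have h1 : 1 <= Ce ^+ 2 * B%:R ^+ 6 by rewrite mulr_ege1 ?exprn_ege1.
by rewrite /G -mulrA; lra.
Qed.

Let levels_real : 8 * (G * (n%:R * dD) ^+ 3) <= 2 ^+ B.
Proof.
have := levels; rewrite -(ler_nat R) natrX; apply: le_trans.
have e2 : 2 ^+ (a0 + 23) = 8 * (1024 * 1024 * 2 ^+ a0) :> R.
  rewrite (_ : (a0 + 23 = 3 + (10 + 10 + a0))%N); last by rewrite addnC.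
  by rewrite !exprD -!natrX.
rewrite (natrM _ (_ * _)) (natrM _ (2 ^ _)) (natrX _ 2) (natrX _ B) (natrX _ (_ * _)).
rewrite (natrM _ (n * d)) (natrM _ n) e2 /G /dD natrM [n%:R * (_ * _)]mulrA.
have X0 : 0 <= B%:R ^+ 6 * (n%:R * d%:R * Delta%:R) ^+ 3 :> R.
  by rewrite mulr_ge0 ?exprn_ge0 ?mulr_ge0.
have := ler_wpM2r X0 Cea0; move: (B%:R ^+ 6) (_ ^+ 3) (Ce ^+ 2) (2 ^+ a0) => b y c a; lra.
Qed.

Let Y1 : [/\ 1 <= (n%:R * dD) ^+ 3, n%:R <= (n%:R * dD) ^+ 3, dD ^+ 3 <= (n%:R * dD) ^+ 3 &
  n%:R ^+ 2 * dD <= (n%:R * dD) ^+ 3].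
Proof.
have n0R : 0 <= n%:R :> R by [].
have n3 : n%:R <= n%:R ^+ 3 :> R by rewrite -[leLHS]expr1 ler_weXn2l.
have d3 : dD <= dD ^+ 3 by rewrite -[leLHS]expr1 ler_weXn2l.
have n23 : n%:R ^+ 2 <= n%:R ^+ 3 :> R by rewrite ler_weXn2l.
have d30 := le_trans dD1 d3; have n30 := le_trans n1 n3.
rewrite exprMn; split.
- by rewrite mulr_ege1.
- by rewrite -[leLHS]mulr1 ler_pM.
- by rewrite -[leLHS]mul1r ler_pM // (le_trans ler01).
- by rewrite ler_pM // ?exprn_ge0 // (le_trans ler01).
Qed.

Let BS : 2 ^+ B = 2 * 2 ^+ B.-1 :> R.
Proof. by rewrite -exprS prednK // expn_gt0. Qed.

Let GB : 4 * n%:R * G <= 2 ^+ B.-1.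
Proof.
have [_ h _ _] := Y1; have G0 : 0 < G := lt_trans ltr01 G1.
have := ler_wpM2l (ltW G0) h; have h2 := levels_real; rewrite BS in h2; lra.
Qed.

Let GB6 : [/\ 16 * B%:R <= G, 16 * B%:R * Ce <= G & 0 < G].
Proof.
have b6 : B%:R <= B%:R ^+ 6 :> R by rewrite -[leLHS]expr1 ler_weXn2l.
have c2 : Ce <= Ce ^+ 2 by rewrite -[leLHS]expr1 ler_weXn2l.
have c21 := le_trans Ce1 c2.
have h1 : Ce * B%:R <= Ce ^+ 2 * B%:R ^+ 6 by rewrite ler_pM // ltW.
have h2 : 1 * B%:R <= Ce ^+ 2 * B%:R ^+ 6 by rewrite ler_pM.
have b1 := B1; have c1 := Ce1; have h3 := mulr_ege1 c1 b1.
by rewrite /G -mulrA; move: h1 h2; set t := Ce ^+ 2 * _; split; lra.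
Qed.

Let M_small (M : R) : M <= 64 * dD ^+ 3 -> M <= 2 ^+ (B.-1 - e0).
Proof.
move=> Mle; have eB : (e0 <= B.-1)%N by rewrite -ltnS prednK ?expn_gt0 // ltn_expl.
have bp : 0 < B%:R :> R by rewrite (lt_le_trans ltr01).
have Be : B%:R = 2 ^+ e0 :> R by rewrite -natrX.
rewrite -(ler_pM2r bp) [X in _ <= _ * X]Be -exprD subnK //.
have [_ _ h _] := Y1; have [g1 _ g0] := GB6.
have d30 : 0 <= dD ^+ 3 by rewrite exprn_ge0 // (le_trans ler01).
have := ler_pM (mulr_ge0 (ler0n R 16) (ltW bp)) d30 g1 h.
have := ler_wpM2r (ltW bp) Mle; have h2 := levels_real; rewrite BS in h2.
lra.
Qed.

Let Dm_small : B.+1%:R * (2 * n%:R) ^+ 2 * (2^-1 ^+ B * Dm) <= 4^-1.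
Proof.
have b2 : B.+1%:R <= 2 * B%:R :> R by rewrite -natr1; have := B1; lra.
have [_ _ _ h] := Y1; have [_ g1 g0] := GB6.
have p2 : 0 < 2 ^+ B :> R by rewrite exprn_gt0.
have x0 : 0 <= n%:R ^+ 2 * dD by rewrite mulr_ge0 ?exprn_ge0 // (le_trans ler01).
have -> : B.+1%:R * (2 * n%:R) ^+ 2 * (2^-1 ^+ B * Dm) =
    4 * (B.+1%:R * (n%:R ^+ 2 * dD) * Ce) / 2 ^+ B by rewrite /Dm exprVn; ring.
rewrite ler_pdivrMr //.
have h3 := ler_pM (mulr_ge0 (mulr_ge0 (ler0n R 16) (ler0n R B)) (ltW Ce0)) x0 g1 h.
have h4 := ler_wpM2r (mulr_ge0 x0 (ltW Ce0)) b2.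
have h2 := levels_real; lra.
Qed.

Let eta0 : 0 < eta.
Proof. by rewrite invr_gt0 !mulr_gt0 ?exprn_gt0 // (lt_le_trans ltr01). Qed.

Let eta1 : eta <= 2^-1.
Proof.
have h : 1 <= Ce * B%:R ^+ 2 by rewrite mulr_ege1 ?exprn_ege1.
rewrite /eta lef_pV2 ?posrE // -?mulrA; lra.
Qed.

Let kappa1_small : 24 * B%:R ^+ 2 * kappa1 G eta * Ce <= 4^-1.
Proof.
have b2 : 1 <= B%:R ^+ 2 :> R by rewrite exprn_ege1.
have bp : 0 < B%:R :> R by rewrite (lt_le_trans ltr01).
have -> : 24 * B%:R ^+ 2 * kappa1 G eta * Ce = 8^-1 + 9 / 128 * (B%:R ^+ 2)^-1.
  by rewrite /kappa1 /G /eta; field; rewrite !gt_eqF.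
have : (B%:R ^+ 2)^-1 <= 1 :> R by rewrite invf_le1 // exprn_gt0.
lra.
Qed.

Let kappa2_small : 8 * B%:R ^+ 2 * kappa2 e0 G eta <= 2.
Proof.
have bp : 0 < B%:R :> R by rewrite (lt_le_trans ltr01).
have -> : 8 * B%:R ^+ 2 * kappa2 e0 G eta = (1 + 3 / 128) / Ce.
  by rewrite /kappa2 /G /eta; field; rewrite !gt_eqF.
rewrite ler_pdivrMr //; have := Ce1; lra.
Qed.

Lemma emd_trial : embeds p d Delta Ce (64 * dD ^+ 3) ->
  exists (Om : finType) (Q : Om -> bool * bool -> pred (point d Delta))
    (val : Om -> (bool * bool -> bool -> R) -> R), dyadic Om /\
  forall A A' : n.-tuple (point d Delta),
  let Z w := val w (fun j b => (count (Q w j) (if b then A else A'))%:R) in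
  [/\ forall w, 0 <= Z w <= 16 * (1024 * 1024) ^+ 2 * Ce ^+ 5 * B%:R ^+ 15 * (dD * n%:R),
     EMD p A A' <= 12 * Ex Z & Ex Z <= 386 * rlog n%:R * (Ce * EMD p A A')].
Proof.
case=> Cut [cut [M [dC /andP[M0 Mle] d2 Dp]]].
have Dm0 : 0 < Dm by rewrite mulr_gt0 // (lt_le_trans ltr01).
have M2 := M_small Mle.
(* So many cuts are expected to separate any pair at most once. This caps the weights at about the
   diameter [Dm] instead of [M], and the range of a trial becomes proportional to
   [d * Delta * n]. *)
pose k0 := maxn 1 (Num.truncn (M / Dm)).
have k00 : (0 < k0)%N by rewrite leq_maxl.
have D_le x y : M * cutd R cut x y <= Dm.
  have /andP[_ h] := Dp x y; apply: le_trans h _; rewrite ler_pM2l // /dD natrM.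
  exact: lp_dist_le.
have d_k0 x y : cutd R cut x y * k0%:R <= 1.
  have c0 := cutd_ge0 R cut x y; have c2 := d2 x y.
  rewrite /k0; case: leqP => _; last by rewrite mulr1; apply: le_trans c2 _; lra.
  apply: (@le_trans _ _ (cutd R cut x y * (M / Dm))).
    by rewrite ler_wpM2l // truncn_le // divr_ge0 // ltW.
  by rewrite mulrA ler_pdivrMr // mul1r mulrC.
have Mk0 : M / k0%:R <= 2 * Dm.
  have k0R : 0 < k0%:R :> R by rewrite ltr0n.
  rewrite ler_pdivrMr // mulrAC -ler_pdivrMr //.
  have h : M / Dm < (Num.truncn (M / Dm)).+1%:R by rewrite truncnS_gt.
  apply: le_trans (ltW h) _; rewrite -natrM ler_nat /k0; move: (Num.truncn _) => t.
  by clear; lia.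
exists (trial Cut e0 k0), (@trial_pred _ _ cut e0 k0), (@trial_val R Cut n e0 k0 M G).
split; first exact: trial_dyadic.
move=> A A'; have [_ _ G0] := GB6.
have optE s : cut_cost cut M (pts A A') s = \sum_a M * cutd R cut (tnth A a) (tnth A' (s a)) by [].
have lo s : EMD p A A' <= cut_cost cut M (pts A A') s.
  apply: le_trans (EMD_le_cost p A A' s) _; rewrite optE; apply: ler_sum => a _.
  by have /andP[] := Dp (tnth A a) (tnth A' (s a)).
have hi : exists s, cut_cost cut M (pts A A') s <= Ce * EMD p A A'.
  have [s ->] := EMD_attained p A A'; exists s; rewrite optE mulr_sumr; apply: ler_sum => a _.
  by have /andP[] := Dp (tnth A a) (tnth A' (s a)).
have D01 x y : M * cutd R cut x y = 0 \/ 1 <= M * cutd R cut x y.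
  have /andP[h1 h2] := Dp x y; case: (lp_dist_01 x y p1) => [l0|l1].
    by left; apply/le_anti; move: h1 h2; rewrite l0 mulr0 => -> ->.
  by right; apply: le_trans l1 h1.
have E01 := EMD_01 p1 A A'.
have [h1 h2] := trial_bounds dC k00 M0 G0 n0 G1 eta0 eta1 GB d2 d_k0 D01 M2 D_le Dm_small
  kappa1_small lo hi E01.
split=> [w||].
- have /andP[Z0 Z1] := trial_out_bounds cut G A A' k00 M0 w.
  rewrite [X in 0 <= X <= _]/(trial_out cut M G A A' w) Z0 /=; apply: le_trans Z1 _.
  apply: (@le_trans _ _ (B%:R ^+ 3 * (2 * Dm * (8 * n%:R * G ^+ 2)))).
    by rewrite ler_wpM2l ?exprn_ge0 // ler_wpM2r ?mulr_ge0 ?exprn_ge0 // ltW.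
  apply: eq_ler; rewrite /Dm /G; ring.
- exact: h1.
apply: le_trans h2 _; apply: ler_wpM2r.
  have e0' : 0 <= EMD p A A' by case: E01 => [->|/(le_trans ler01)].
  by rewrite mulr_ge0 // ltW.
have l1 := ln_le_rlog R n0; have l2 := ln2_le R.
have r1 := rlog_ge1 R n; have k2 := kappa2_small.
have -> : ln (2 * n%:R) = ln 2 + ln n%:R :> R by rewrite lnM ?posrE ?ltr0n.
lra.
Qed.

End EmdTrial.

Lemma constant_algorithm (R : realType) (d Delta : nat) (v : R) :
  exists alg : algorithm R d Delta, alg_space alg = 0%N /\
    forall st (E : pred R), E v ->
      prob_bits R (fun w : (alg_rand alg).-tuple bool => E (alg_run st w)) = 1.
Proof.
exists (@Algorithm R d Delta 0 0 (fun _ => [tuple]) (fun _ s _ => s) (fun _ _ => v)).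
split=> // st E Ev; rewrite /prob_bits /=.
set S := [set _ | _]; have -> : S = setT by apply/setP => w; rewrite !inE.
by rewrite cardsT card_tuple expn0 divr1.
Qed.

Lemma ler_Pr (R : realType) (T : finType) (E E' : pred T) : (forall t, E t -> E' t) ->
  Pr R E <= Pr R E'.
Proof.
move=> EE; apply: ler_Ex => t; rewrite ler_nat.
by case: (boolP (E t)) => // /EE ->.
Qed.

Lemma trunc_log_le_rlog (R : realType) n : (trunc_log 2 n)%:R <= 2 * rlog n%:R :> R.
Proof.
have [->|n0] := posnP n; first by rewrite trunc_log0; have := rlog_ge1 R 0; lra.
have := trunc_logP (isT : (1 < 2)%N) n0; set u := trunc_log _ _ => h.
have h1 : u%:R * ln 2 <= ln n%:R :> R.
  by rewrite mulr_natl -lnXn ?ltr0n // ler_ln ?posrE ?exprn_gt0 ?ltr0n // -natrX ler_nat.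
have := ler_wpM2l (ler0n R u) (ln2_ge R); have := ln_le_rlog R n0.
move: h1; set l := _ * ln 2; lra.
Qed.

(* [Y] is the range of a trial divided by the slack allowed in the average. *)
Lemma number_of_trials (R : realType) (c n : nat) (Y : R) : 0 <= Y ->
  exists2 T : nat, (0 < T)%N &
    T%:R <= 2 * Y * (c.+1%:R * rlog n%:R) + 1 /\
    (0 < Y -> 2 * expR (- (T%:R / (2 * Y))) <= (n.+1%:R ^+ c)^-1).
Proof.
move=> Y0; pose t := c%:R * ln (1 + n%:R) + ln 2 : R.
have ln0 : 0 <= ln (1 + n%:R) :> R by rewrite ln_ge0 // lerDl.
have t0 : 0 <= t by rewrite addr_ge0 ?mulr_ge0 // ln_ge0 // ler1n.
have tle : t <= c.+1%:R * rlog n%:R.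
  rewrite /t /rlog -natr1; have := ln2_le R; have := ler0n R c.
  by move: ln0; set l := ln (1 + _) => l0 c0 h; have := mulr_ge0 c0 l0; lra.
have Yt : 0 <= 2 * Y * t by rewrite !mulr_ge0.
exists (Num.truncn (2 * Y * t)).+1 => //; split.
  rewrite -natr1 lerD2r; apply: (@le_trans _ _ (2 * Y * t)); first by rewrite truncn_le.
  by rewrite ler_wpM2l ?mulr_ge0.
move=> Yp; have h : 2 * Y * t < (Num.truncn (2 * Y * t)).+1%:R by rewrite truncnS_gt.
have et : 2 * expR (- t) = (n.+1%:R ^+ c)^-1.
  rewrite /t opprD expRD !expRN expRM_natl !lnK ?posrE ?ltr0n //; last by rewrite ltr_wpDr.
  by rewrite nat1r mulrCA mulfV ?mulr1 // pnatr_eq0.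
rewrite -et ler_pM2l // ler_expR lerN2 ler_pdivlMr ?mulr_gt0 // mulrC; exact: ltW.
Qed.

(** 48 = 12 * 4 combines the two lower constants; adding [s] before rescaling makes the output an
    upper bound for E. *)
Lemma rescaled_average (R : realType) (E z a s r : R) : E <= 12 * z -> z <= r ->
  z / 4 - s <= a <= 2 * z + s -> E <= 48 * (a + s) <= 96 * r + 96 * s.
Proof. by move=> Ez zr /andP[lo hi]; apply/andP; split; lra. Qed.

Lemma space_arith (R : realType) (u t x e K : R) : 0 <= u <= 2 * x -> 1 <= x ->
  1 <= e -> 0 <= K -> 0 <= t <= e * (K * x ^+ 16) + 1 ->
  (u + 1) * (t * 8) <= e * (8 * (3 * (K + 1)) * x ^+ 17).
Proof.
move=> /andP[u0 ux] x1 e1 K0 /andP[t0 tle]; have x16 : 1 <= x ^+ 16 by rewrite exprn_ege1.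
have te : t <= e * (K + 1) * x ^+ 16.
  by have := mulr_ege1 e1 x16; rewrite mulrDr mulr1; lra.
have ux3 : u + 1 <= 3 * x by lra.
have u10 : 0 <= u + 1 by lra.
have t80 : 0 <= t * 8 by rewrite mulr_ge0.
apply: le_trans (ler_pM u10 t80 ux3 (ler_wpM2r (ler0n R 8) te)) _.
rewrite [x ^+ 17]exprS; apply: eq_ler; ring.
Qed.

Theorem theorem1p3 (R : realType) (p : R) (hp : 1 <= p <= 2) :
  exists (C0 : R) (k0 : nat), forall c : nat, exists (C : R) (k : nat),
  forall (n d Delta : nat) (eps : R), 0 < eps ->
  exists alg : algorithm R d Delta,
    (alg_space alg)%:R <= eps^-1 * polylog3 C k n d Delta /\
    forall (A B : n.-tuple (point d Delta)) (st : seq (update d Delta)),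
      stream_result st A B ->
      1 - (n.+1%:R ^+ c)^-1 <=
        prob_bits R (fun w : (alg_rand alg).-tuple bool =>
          EMD p A B <= alg_run st w <=
            tilde_log C0 k0 n * EMD p A B + eps * d%:R * Delta%:R * n%:R).
Proof.
have /andP[p1 p2] := hp; have [Ce Ce1 emb] := lp_embedding hp.
have Ce0 : 0 < Ce by rewrite (lt_le_trans ltr01).
have [a0 Cea0] : exists a0, Ce ^+ 2 <= 2 ^+ a0.
  exists (Num.truncn (Ce ^+ 2)).+1; apply: le_trans (ltW (truncnS_gt _)) _.
  by rewrite -natrX ler_nat ltnW // ltn_expl.
pose Kb : R := 280 + 4 * a0%:R.
have Kb1 : 1 <= Kb by rewrite /Kb; have := ler0n R a0; lra.
(* Exponent 0: the factor obtained is O(log n), with no power of log log n. *)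
exists (96 * 386 * Ce), 0%N => c.
pose Kz : R := 96 * (16 * (1024 * 1024) ^+ 2 * Ce ^+ 5 * Kb ^+ 15).
have Kz0 : 0 <= Kz by rewrite !(mulr_ge0, exprn_ge0) // ltW // (lt_le_trans ltr01).
(* 17 = 15 + 1 + 1: the range of a trial has degree 15 in [B], the confidence takes one more
   logarithm and the bit length of the counters another. *)
pose C : R := 8 * (3 * (2 * (Kz * c.+1%:R) + 1)); exists C, 17%N => n d Delta eps eps0.
have C00 : 0 <= C.
  by rewrite /C; have := mulr_ge0 Kz0 (ler0n R c.+1); set K := Kz * _; lra.
have x3 := logsize_ge R n d Delta; set x := logsize _ _ _ _ in x3.
have pl : polylog3 C 17 n d Delta = C * x ^+ 17 by [].
have x0 : 0 <= x by lra.
have const : (forall A B : n.-tuple (point d Delta), EMD p A B <= eps * d%:R * Delta%:R * n%:R) ->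
  exists alg : algorithm R d Delta,
    (alg_space alg)%:R <= eps^-1 * polylog3 C 17 n d Delta /\
    forall (A B : n.-tuple (point d Delta)) (st : seq (update d Delta)),
      stream_result st A B ->
      1 - (n.+1%:R ^+ c)^-1 <=
        prob_bits R (fun w : (alg_rand alg).-tuple bool =>
          EMD p A B <= alg_run st w <=
            tilde_log (96 * 386 * Ce) 0 n * EMD p A B + eps * d%:R * Delta%:R * n%:R).
  move=> le; have [alg [sp run]] := constant_algorithm d Delta (eps * d%:R * Delta%:R * n%:R).
  exists alg; split.
    by rewrite sp pl mulr_ge0 ?invr_ge0 ?(ltW eps0) // mulr_ge0 // exprn_ge0.
  move=> A B st _; rewrite (run st (fun v => EMD p A B <= v <= tilde_log (96 * 386 * Ce) 0 n *
    EMD p A B + eps * d%:R * Delta%:R * n%:R)).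
    by rewrite gerBl invr_ge0 exprn_ge0.
  rewrite le lerDr mulr_ge0 //.
    by rewrite /tilde_log expr0 mulr1 !mulr_ge0 ?(ltW Ce0) // (le_trans ler01 (rlog_ge1 R n)).
  by case: (EMD_01 p1 A B) => [->|/(le_trans ler01)].
have W0 : 0 <= d%:R * Delta%:R * n%:R :> R by rewrite !mulr_ge0.
have eW : eps * d%:R * Delta%:R * n%:R = eps * (d%:R * Delta%:R * n%:R) by ring.
(* For eps >= 1 the allowed error covers every possible cost, and a constant output without state
   avoids charging positive space against a small [eps^-1]. *)
have [eps1|eps1] := leP 1 eps.
  apply: const => A B; apply: le_trans (EMD_bound p1 A B) _.
  by rewrite eW ler_peMl.
have [z|] := posnP (d * Delta * n).
  apply: const => A B; apply: le_trans (EMD_bound p1 A B) _.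
  by rewrite eW -!natrM z mulr0.
rewrite !muln_gt0 -andbA => /and3P[d0 D0 n0]; clear const.
have [e0 [lev Bx]] := enough_levels R a0 n0 d0 D0.
have [Om [Q [val [dOm tr]]]] := emd_trial p1 Ce1 Cea0 n0 d0 D0 lev (emb d Delta d0 D0).
set zm := 16 * _ * _ * _ * _ in tr.
(* The output [48 * (average + s)] may exceed the multiplicative bound by [96 * s]. *)
pose s := eps * (d%:R * Delta%:R * n%:R) / 96.
have Wp : 0 < d%:R * Delta%:R * n%:R :> R by rewrite !mulr_gt0 ?ltr0n.
have s0 : 0 < s by apply: divr_gt0 => //; apply: mulr_gt0.
have B0 : 0 < (nlev e0)%:R :> R by rewrite ltr0n expn_gt0.
have zm0 : 0 < zm.
  have K1 : 0 < 16 * (1024 * 1024) ^+ 2 :> R by apply: mulr_gt0 => //; apply: exprn_gt0; apply: mulr_gt0.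
  apply: mulr_gt0; last by rewrite -natrM ltr0n !muln_gt0 d0 D0.
  apply: mulr_gt0; last exact: exprn_gt0.
  by apply: mulr_gt0 K1 _; apply: exprn_gt0.
pose Y := zm / s; have Y0 : 0 < Y by rewrite divr_gt0.
have YE : Y = eps^-1 * (96 * (16 * (1024 * 1024) ^+ 2 * Ce ^+ 5 * (nlev e0)%:R ^+ 15)).
  by rewrite /Y /zm /s natrM; field; rewrite !pnatr_eq0 -!lt0n d0 D0 n0 gt_eqF.
have Yle : Y <= eps^-1 * (Kz * x ^+ 15).
  rewrite YE ler_pM2l ?invr_gt0 // /Kz -[leRHS]mulrA -[in leRHS](mulrA _ (Kb ^+ 15)) -exprMn.
  apply: ler_wpM2l => //; apply: ler_wpM2l.
    apply: mulr_ge0; last exact: exprn_ge0 (ltW Ce0).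
    by apply: mulr_ge0 => //; apply: exprn_ge0; apply: mulr_ge0.
  by rewrite lerXn2r ?nnegrE ?(ltW B0) // mulr_ge0 // (le_trans ler01).
have [T T0 [Tle Tc]] := number_of_trials c n (ltW Y0).
pose J : finType := ('I_T * (bool * bool))%type.
pose Om' : finType := {ffun 'I_T -> Om}.
pose Q' (w : Om') (j : J) : pred (point d Delta) := Q (w j.1) j.2.
pose dec (w : Om') (cnt : {ffun J * bool -> nat}) : R :=
  48 * ((\sum_t val (w t) (fun j b => (cnt ((t, j), b))%:R)) / T%:R + s).
have [alg [sp run]] := algorithm_of_predicates n Q' dec (dyadic_ffun _ dOm).
exists alg; split.
  have epsi : 1 <= eps^-1 by rewrite invf_ge1 // ltW.
  have rx : rlog n%:R <= x.
    by rewrite /x /logsize; have := rlog_ge1 R d; have := rlog_ge1 R Delta; clear; lra.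
  have r0 : 0 <= rlog n%:R :> R := le_trans ler01 (rlog_ge1 R n).
  have ux := trunc_log_le_rlog R n.
  rewrite sp card_prod card_ord card_prod card_bool pl /C natrM -natr1 -mulnA natrM.
  apply: space_arith => //.
  - by rewrite ler0n /=; apply: le_trans ux _; rewrite ler_pM2l.
  - by move: x3; clear; lra.
  - by apply: mulr_ge0 => //; apply: mulr_ge0.
  rewrite ler0n /=; apply: le_trans Tle _; rewrite lerD2r.
  apply: (@le_trans _ _ (2 * (eps^-1 * (Kz * x ^+ 15)) * (c.+1%:R * x))).
    apply: ler_pM; [by apply: mulr_ge0 => //; apply: ltW| exact: mulr_ge0| |].
      by rewrite ler_pM2l.
    exact: ler_wpM2l.
  by apply: eq_ler; rewrite [x ^+ 16]exprSr; ring.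
move=> A B st sr.
rewrite (run A B st sr (fun v => EMD p A B <= v <= tilde_log (96 * 386 * Ce) 0 n *
    EMD p A B + eps * d%:R * Delta%:R * n%:R)).
have [Zb Elo Ehi] := tr A B.
have ch := chernoff s (dyadic_gt0 dOm) T0 zm0 Zb.
apply: le_trans (le_trans ch _).
  rewrite lerD2l lerN2; apply: le_trans (Tc Y0); rewrite ler_pM2l // ler_expR lerN2.
  by apply: eq_ler; rewrite /Y; field; rewrite !gt_eqF.
apply: ler_Pr => w avg_near.
have -> : dec w [ffun jb => count (Q' w jb.1) (if jb.2 then A else B)] =
  48 * ((\sum_t val (w t) (fun j b => (count (Q (w t) j) (if b then A else B))%:R)) / T%:R + s).
  rewrite /dec; congr (48 * (_ / _ + _)); apply: eq_bigr => t _; congr val.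
  by apply: boolp.funext => j; apply: boolp.funext => b; rewrite ffunE.
have -> : tilde_log (96 * 386 * Ce) 0 n * EMD p A B =
  96 * (386 * rlog n%:R * (Ce * EMD p A B)) by rewrite /tilde_log expr0; ring.
have -> : eps * d%:R * Delta%:R * n%:R = 96 * s by rewrite /s; field.
exact: rescaled_average Elo Ehi avg_near.
Qed.
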